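(* Let $d\geq1$, $k\geq1$, $(\boldsymbol\mu,\rho)\in\mathbb{S}^d\times[-1,1]$, $\boldsymbol X\sim\mathrm{C}_k(\boldsymbol\mu,\rho)$, and $m\geq1$. Let $\boldsymbol U\sim\mathrm{Unif}(\mathbb{S}^d)$ and $$\boldsymbol\mu_{d+1,m}:=\mathbb{E}[\boldsymbol U^{\otimes m}]=\frac{(m-1)!!}{\prod_{r=0}^{m/2-1}(d+1+2r)}\,\boldsymbol S_{d+1,m}(\operatorname{vec}\boldsymbol I_{d+1})^{\otimes m/2}\,1_{\{m\text{ even}\}}.$$ Then: (i) If $m<k$, $\mathbb{E}[\boldsymbol X^{\otimes m}]=\boldsymbol\mu_{d+1,m}$. (ii) If $m=k$, $$\mathbb{E}[\boldsymbol X^{\otimes k}]=\boldsymbol\mu_{d+1,k}+\frac{\rho}{d_{k,d}}\,\boldsymbol S_{d+1,k}\sum_{j=0}^{\lfloor k/2\rfloor}a_{k,j}(\operatorname{vec}\boldsymbol I_{d+1})^{\otimes j}\otimes\boldsymbol\mu^{\otimes k-2j},$$ where $a_{k,0}=1$ and $a_{k,j}=(-1)^j\frac{k!}{2^j(k-2j)!j!}\frac{1}{\prod_{r=1}^j(2(k-r)+d-1)}$. (iii) If $m>k$ and $m-k$ is odd, $\mathbb{E}[\boldsymbol X^{\otimes m}]=\boldsymbol\mu_{d+1,m}$. (iv) For general $m\geq1$, $$\mathbb{E}[\boldsymbol X^{\otimes m}]=\boldsymbol\mu_{d+1,m}+\frac{\rho}{C_k^{(d-1)/2}(1)}\frac{\omega_{d-1}}{\omega_d}\,\boldsymbol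 S_{d+1,m}\sum_{j=0}^{\lfloor m/2\rfloor}e_{j,k,m}\,\boldsymbol\mu^{\otimes(m-2j)}\otimes\big[(\operatorname{vec}\boldsymbol I_{d+1}-\boldsymbol\mu^{\otimes2})^{\otimes j}\big],$$ where $e_{j,k,m}:=\binom{m}{2j}\frac{(2j-1)!!}{\prod_{r=0}^{j-1}(d+2r)}f_{j,m,k}1_{\{m+k\text{ even}\}}$, $$f_{j,m,k}:=\int_{-1}^1t^{m-2j}(1-t^2)^{d/2-1+j}C_k^{(d-1)/2}(t)\,\mathrm dt=\frac{\Gamma(d/2+j)}{g_{k,d}}\sum_{s=0}^{\lfloor k/2\rfloor}(-1)^s\frac{2^{k-2s}\Gamma((d-1)/2+k-s)}{s!(k-2s)!}\frac{\Gamma((m+k+1)/2-j-s)}{\Gamma((d+k+m+1)/2-s)},$$ and $g_{k,d}=k/2$ if $d=1$, $g_{k,d}=[\Gamma((d-1)/2)]^{-1}$ if $d\geq2$.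
   Context: For an integer $d\geq1$, $\mathbb{S}^d=\{\boldsymbol x\in\mathbb{R}^{d+1}:\|\boldsymbol x\|=1\}$, $\sigma_d$ is its surface area measure and $\omega_d=2\pi^{(d+1)/2}/\Gamma((d+1)/2)$ (with $\omega_0=2$). For $d\geq2$, $C_k^{(d-1)/2}$ is the standard Gegenbauer polynomial of degree $k$ and index $(d-1)/2$ (generating function $(1-2xt+t^2)^{-(d-1)/2}$, so $C_k^{(d-1)/2}(1)=\Gamma(d-1+k)/(\Gamma(d-1)k!)$); for $d=1$, $C_k^0:=T_k$, $T_k(x)=\cos(k\cos^{-1}x)$. $\tilde C_k^{(d-1)/2}=C_k^{(d-1)/2}/C_k^{(d-1)/2}(1)$. $d_{k,d}=(1+2k/(d-1))\Gamma(d-1+k)/(\Gamma(d-1)k!)$ for $d\geq2$, $d_{k,1}=2-\delta_{k,0}$. $\mathrm{C}_k(\boldsymbol\mu,\rho)$ ($\boldsymbol\mu\in\mathbb{S}^d$, $\rho\in[-1,1]$, integer $k\geq1$) is the distribution on $\mathbb{S}^d$ with density $\omega_d^{-1}\{1+\rho\,\tilde C_k^{(d-1)/2}(\boldsymbol x^\top\boldsymbol\mu)\}$ w.r.t. $\sigma_d$; $\mathrm{Unif}(\mathbb{S}^d)$ has density $1/\omega_d$. $\otimes$ is the Kronecker product, $\boldsymbol x^{\otimes r}$ the $r$-fold Kronecker power, $\operatorname{vec}$ stacks columns of a matrix, and $\boldsymbol S_{d+1,r}$ is the $(d+1)^r\times(d+1)^r$ symmetrizer matrix: $\boldsymbol S_{d+1,r}(\boldsymbol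 v_1\otimes\cdots\otimes\boldsymbol v_r)=\frac{1}{r!}\sum_{\sigma\in S_r}\boldsymbol v_{\sigma(1)}\otimes\cdots\otimes\boldsymbol v_{\sigma(r)}$ for $\boldsymbol v_i\in\mathbb{R}^{d+1}$. Empty products equal $1$ and $(-1)!!=1$.
   Formalization: The Gamma-sum formula for f_{j,m,k} is stated with factor Γ(d/2+j)·g_{k,d} instead of Γ(d/2+j)/g_{k,d}, and only for m+k even; as written it fails (d=2, k=m=1, j=0: integral 2/3, formula 2π/3; for m+k odd the integral is 0 but the sum need not be). *)

(* Defs.v *)
From HB Require Import structures.
From mathcomp Require Import all_boot all_order all_algebra all_fingroup.
From mathcomp Require Import all_classical all_reals all_analysis.
Unset Printing Implicit Defensive.
Import Order.TTheory GRing.Theory Num.Theory.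
Import numFieldNormedType.Exports.
Local Open Scope classical_set_scope.
Local Open Scope ring_scope.

Section Defs.
Variable R : realType.

Definition Gamma (s : R) : R :=
  Rintegral lebesgue_measure `]0%R, +oo[ (fun t : R => t `^ (s - 1) * expR (- t)).

Definition omega (d : nat) : R :=
  2 * pi `^ ((d.+1)%:R / 2) / Gamma ((d.+1)%:R / 2).

(* double factorial, (-1)!! = 0!! = 1 *)
Fixpoint dfact (n : nat) : nat :=
  match n with 0 => 1 | 1 => 1 | n'.+2 => n'.+2 * dfact n' end.

(* Gegenbauer polynomials C_n^lam via the three-term recurrence coming from the
   generating function (1 - 2xt + t^2)^(-lam); returns (C_n(x), C_{n+1}(x)). *)
Fixpoint gegen_pair (lam : R) (n : nat) (x : R) : R * R :=
  match n with
  | 0 => (1, 2 * lam * x)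
  | n'.+1 => let p := gegen_pair lam n' x in
      (p.2, (2 * x * (n'.+1%:R + lam) * p.2 - (n'%:R + 2 * lam) * p.1) / n'.+2%:R)
  end.
Definition gegenbauer (lam : R) (n : nat) (x : R) : R := (gegen_pair lam n x).1.

Fixpoint cheb_pair (n : nat) (x : R) : R * R :=
  match n with
  | 0 => (1, x)
  | n'.+1 => let p := cheb_pair n' x in (p.2, 2 * x * p.2 - p.1)
  end.
Definition chebyshev (n : nat) (x : R) : R := (cheb_pair n x).1.

(* C_k^{(d-1)/2}, with the convention C_k^0 := T_k for d = 1 *)
Definition Cg (d k : nat) (x : R) : R :=
  if d == 1%N then chebyshev k x else gegenbauer ((d%:R - 1) / 2) k x.

Definition Cgn (d k : nat) (x : R) : R := Cg d k x / Cg d k 1.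

Definition dkd (k d : nat) : R :=
  if d == 1%N then 2 - (k == 0%N)%:R
  else (1 + 2 * k%:R / (d%:R - 1)) * Gamma (d%:R - 1 + k%:R)
         / (Gamma (d%:R - 1) * (k`!)%:R).

(* Points of R^n are represented as x : nat -> R (coordinates 0..n-1). *)
(* Iterated Lebesgue integral over R^n (= Lebesgue integral on R^n by Fubini
   for integrable integrands). *)
Fixpoint leb_int (n : nat) (F : (nat -> R) -> R) : R :=
  match n with
  | 0 => F (fun _ => 0)
  | n'.+1 => Rintegral lebesgue_measure setT
      (fun t : R => leb_int n' (fun x => F (fun i => if i is j.+1 then x j else t)))
  end.

Definition sqnorm (n : nat) (x : nat -> R) : R := \sum_(i < n) x i ^+ 2.

(* Integral w.r.t. the surface area measure sigma_d on S^d in R^{d+1}: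
   int_{S^d} g dsigma_d = (d+1) int_{|y| <= 1} g(y/|y|) dy  (cone measure). *)
Definition sphere_int (d : nat) (g : (nat -> R) -> R) : R :=
  (d.+1)%:R * leb_int d.+1 (fun y =>
     if sqnorm d.+1 y <= 1 then g (fun i => y i / Num.sqrt (sqnorm d.+1 y)) else 0).

Definition dotp (d : nat) (x : nat -> R) (mu : 'I_d.+1 -> R) : R :=
  \sum_(i < d.+1) x i * mu i.

Definition ck_density (d k : nat) (mu : 'I_d.+1 -> R) (rho : R) (x : nat -> R) : R :=
  (omega d)^-1 * (1 + rho * Cgn d k (dotp d x mu)).
Definition unif_density (d : nat) (x : nat -> R) : R := (omega d)^-1.

(* ---- tensors: an order-r tensor on R^{d+1} is a function of index sequences
   s = [:: i_1; ...; i_r] (i_l : 'I_d.+1); its value at s is the entry of the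
   corresponding Kronecker vector in R^{(d+1)^r} (lexicographic order). ---- *)
Definition tensor (d : nat) := seq 'I_d.+1 -> R.

Definition tkron (d p : nat) (A B : tensor d) : tensor d :=
  fun s => A (take p s) * B (drop p s).

Fixpoint tpow (d p : nat) (A : tensor d) (r : nat) : tensor d :=
  match r with 0 => fun _ => 1 | r'.+1 => tkron d p A (tpow d p A r') end.

Definition tvec (d : nat) (v : 'I_d.+1 -> R) : tensor d :=
  fun s => if s is i :: _ then v i else 0.

Definition vecI (d : nat) : tensor d :=
  fun s => if s is [:: i, j & _] then (i == j)%:R else 0.

Definition tsym (d r : nat) (T : tensor d) : tensor d :=
  fun s => (r`!%:R)^-1 *
    \sum_(sg : 'S_r) T [seq nth ord0 s (sg i) | i <- enum 'I_r].

(* E[X^{(x)m}] for X with density dens w.r.t. sigma_d; entry at s (size s = m) *)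
Definition moment (d : nat) (dens : (nat -> R) -> R) : tensor d :=
  fun s => sphere_int d (fun x => (\prod_(i <- s) x i) * dens x).

Definition mu_unif (d m : nat) : tensor d :=
  fun s => if odd m then 0 else
    (dfact (m.-1))%:R / (\prod_(0 <= r < m./2) (d.+1 + 2 * r)%:R)
      * tsym d m (tpow d 2 (vecI d) m./2) s.

Definition akj (d k j : nat) : R :=
  (-1) ^+ j * (k`!)%:R / ((2 ^ j)%:R * ((k - 2 * j)`!)%:R * (j`!)%:R)
    / (\prod_(1 <= r < j.+1) (2 * (k - r) + (d - 1))%:R).

Definition fjmk (d j m k : nat) : R :=
  Rintegral lebesgue_measure `[(-1)%R, 1%R]
    (fun t : R => t ^+ (m - 2 * j) * (1 - t ^+ 2) `^ (d%:R / 2 - 1 + j%:R) * Cg d k t).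

Definition gkd (k d : nat) : R :=
  if d == 1%N then k%:R / 2 else (Gamma ((d%:R - 1) / 2))^-1.

Definition ejkm (d j k m : nat) : R :=
  if odd (m + k) then 0 else
    ('C(m, 2 * j))%:R * (dfact (2 * j).-1)%:R
      / (\prod_(0 <= r < j) (d + 2 * r)%:R) * fjmk d j m k.

End Defs.

(* Main.v *)
Require Import Defs.
From HB Require Import structures.
From mathcomp Require Import all_boot all_order all_algebra all_fingroup.
From mathcomp Require Import all_classical all_reals all_analysis.
From mathcomp Require Import measurable_realfun ring lra zify.
Import Order.TTheory GRing.Theory Num.Theory.
Import numFieldNormedType.Exports.
Local Open Scope classical_set_scope.
Local Open Scope ring_scope.

(** A symmetric tensor [T] is determined by the polynomial [v |-> <T, v^(x)m>], so
    everything reduces to [E[(U.v)^m P(U.mu)]] for a polynomial [P]. Integrating one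
    coordinate at a time (Liouville's integral for each step) yields
    [E[(U.w)^M] = (M-1)!! / prod_(r < M/2) (d+1+2r) |w|^M] for every [w]. With [w = v + z mu],
    the coefficients in [z] give [E[(U.v)^m (U.mu)^l]], which is the tangent-normal
    decomposition: with [a = v.mu] and [b = |v|^2 - a^2],
    [E[(U.v)^m P(U.mu)] = sum_j C(m,2j) theta_j a^(m-2j) b^j L(t^(m-2j) (1-t^2)^j P)],
    [L] the law of one coordinate of [U]; this is (iv). Parts (i)-(iii) follow from the
    orthogonality of the Gegenbauer polynomials under [L] (three-term recurrence), parity,
    and, for [m = k], the fact that Laplace's formula for [C_k] and the explicit
    coefficients [a_(k,j)] satisfy the same recurrence. *)

(** * Substitution for the Lebesgue integral of measurable functions *)

(** The functions (x.w)^M psi(|x|^2) are used because fixing a coordinate yields combinations of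
    functions of the same kind in one dimension less. Two difficulties shape the induction.
    [Rintegral] turns a divergent integral into an ordinary number, so the integrability of every
    slice is carried along with its value. On the ball the profile is r^(-M/2), singular at the
    origin: the slice through 0 may contain divergent terms whose coefficient is 0, and these have
    to be removed before integrating. Integrals of nonnegative functions stay in the extended reals,
    where Tonelli and the substitutions apply at once; finiteness is read off afterwards.
    Polarization serves twice: it recovers a symmetric tensor from its polynomial, and it gives the
    integrability of all monomials from that of powers of linear forms. Normalizing by C_k(1) = 1
    puts the Chebyshev case d = 1 under the same recurrence as the others. *)

Section Substitution.
Context {R : realType}.
Local Notation mu := (@lebesgue_measure R).
Local Open Scope ereal_scope.

Section ge0_substitution.
Variables (phi w : R -> R).
Hypotheses (mphi : measurable_fun [set: R] phi).
Hypotheses (mw : measurable_fun [set: R] w) (w0 : forall t, (0 <= w t)%R).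
Hypothesis weight_itv : forall a b : R, (a <= b)%R ->
  \int[mu]_(t in phi @^-1` `]a, b]) (w t)%:E = (b - a)%:E.

Let nu (A : set (measurableTypeR R)) := \int[mu]_(t in phi @^-1` A) (w t)%:E.

Let mpre A : measurable A -> measurable (phi @^-1` A).
Proof. by move=> mA; rewrite -[_ @^-1` _]setTI; exact: mphi. Qed.

Let mwE : measurable_fun [set: R] (fun t : R => (w t)%:E).
Proof. exact/measurable_EFinP. Qed.

Let nu0 : nu set0 = 0. Proof. by rewrite /nu preimage_set0 integral_set0. Qed.

Let nu_ge0 A : 0 <= nu A.
Proof. by apply: integral_ge0 => t _; rewrite lee_fin. Qed.

Let nu_sigma : semi_sigma_additive nu.
Proof.
move=> F mF tF mUF; rewrite /nu preimage_bigcup.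
apply: (@semi_sigma_additive_nng_induced _ _ _ mu (fun t : R => (w t)%:E)) => //.
- by move=> i; apply: mpre; exact: mF.
- by move=> i j Di Dj [t [Fi Fj]]; apply: (tF i j) => //; exists (phi t).
- by rewrite -preimage_bigcup; exact: mpre.
Qed.

HB.instance Definition _ := isMeasure.Build _ _ _ nu nu0 nu_ge0 nu_sigma.

Let nuE A : measurable A -> mu A = nu A.
Proof.
apply: lebesgue_measure_unique => _ [[a b]] /= _ <-.
have [ab|ba] := leP a b; first by rewrite [RHS]weight_itv// lebesgue_measure_itv /= lte_fin; case: ltP => // ba; have /eqP -> : a == b by [rewrite eq_le ab ba]; rewrite subrr.
by rewrite set_itv_ge ?measure0// -leNgt bnd_simp ltW.
Qed.

Import HBNNSimple.

(** By [weight_itv], the image under [phi] of the measure with density [w] gives every half-open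
    interval its length, so it is Lebesgue measure by uniqueness ([nuE]). This settles indicators;
    simple functions and monotone convergence do the rest. *)
Lemma ge0_integral_substitution (g : R -> \bar R) :
  measurable_fun setT g -> (forall u, 0 <= g u) ->
  \int[mu]_t (g (phi t) * (w t)%:E) = \int[mu]_u g u.
Proof.
move=> mg g0; pose h := nnsfun_approx measurableT mg.
have gE u : g u = limn (fun n => (h n u)%:E).
  by apply/esym/cvg_lim => //; exact: (cvg_nnsfun_approx measurableT mg (fun x _ => g0 x)).
have mh n : measurable_fun [set: R] (fun u : R => (h n u)%:E).
  by apply/measurable_EFinP; exact: measurable_funP.
have hnd (m n : nat) u : (m <= n)%N -> (h m u <= h n u)%R.
  by move=> mn; exact/lefP/nd_nnsfun_approx.
transitivity (limn (fun n => \int[mu]_t ((h n (phi t))%:E * (w t)%:E))).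
  rewrite -monotone_convergence//.
  - apply: eq_integral => t _; rewrite gE; apply/esym/cvg_lim => //.
    apply: cvgeZr => //.
    rewrite -gE; exact: (cvg_nnsfun_approx measurableT mg (fun x _ => g0 x)).
  - move=> n; apply: emeasurable_funM => //.
    by apply/measurable_EFinP; exact: measurableT_comp.
  - by move=> n t _; rewrite mule_ge0 ?lee_fin.
  - by move=> t _ a b ab; rewrite lee_wpmul2r ?lee_fin//; exact: hnd.
transitivity (limn (fun n => \int[mu]_t (h n t)%:E)); last first.
  rewrite -monotone_convergence//.
  - by apply: eq_integral => t _; rewrite gE.
  - by move=> n t _; rewrite lee_fin.
  - by move=> t _ a b ab; rewrite lee_fin; exact: hnd.
congr (limn _); apply/funext => n.
have hE (u : R) : h n u = (\sum_(y \in range (h n)) y * \1_(h n @^-1` [set y]) u)%R.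
  exact: fimfunE.
transitivity (\int[mu]_t \sum_(y \in range (h n))
    ((y * \1_(h n @^-1` [set y]) (phi t))%:E * (w t)%:E)).
  apply: eq_integral => t _; rewrite -ge0_mule_fsuml => [|y]; last exact: nnfun_muleindic_ge0.
  by rewrite fsumEFin // -hE.
transitivity (\int[mu]_t \sum_(y \in range (h n)) (y * \1_(h n @^-1` [set y]) t)%:E); last first.
  by apply: eq_integral => t _; rewrite fsumEFin // -hE.
have mind y : measurable_fun [set: R] (fun x => (y * \1_(h n @^-1` [set y]) x)%:E).
  by apply/measurable_EFinP; exact: measurable_funM.
have mindphi y : measurable_fun [set: R] (fun x => (y * \1_(h n @^-1` [set y]) (phi x))%:E).
  by apply: (measurableT_comp (mind y)).
have ind0 y (u : R) : 0 <= (y * \1_(h n @^-1` [set y]) u)%:E by exact: nnfun_muleindic_ge0.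
rewrite !ge0_integral_fsum//; last 2 first.
- by move=> y; apply: emeasurable_funM; [exact (mindphi y)|].
- by move=> y t _; rewrite mule_ge0 ?lee_fin// -lee_fin ind0.
apply: eq_fsbigr => y /[!inE] -[t _ yE].
have y0 : (0 <= y)%R by rewrite -yE.
have mS : measurable (h n @^-1` [set y]) by [].
under eq_integral do rewrite EFinM -muleA.
rewrite ge0_integralZl//; last 2 first.
- apply: emeasurable_funM => //.
  by apply/measurable_EFinP; apply: measurableT_comp.
- by move=> s _; rewrite mule_ge0 ?lee_fin.
under [RHS]eq_integral do rewrite EFinM.
rewrite ge0_integralZl//; last by apply/measurable_EFinP.
congr (_ * _).
transitivity (nu (h n @^-1` [set y])); last by rewrite -(nuE _ mS) integral_indic// setIT.
rewrite /nu [RHS]integral_mkcond; apply: eq_integral => s _.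
rewrite patchE indicE; have -> : (phi s \in h n @^-1` [set y]) = (s \in phi @^-1` (h n @^-1` [set y])) by [].
by case: ifP; rewrite ?mul1e ?mul0e.
Qed.

End ge0_substitution.

End Substitution.

(** * Changes of variables on the real line *)

Section OneVariable.
Context {R : realType}.
Local Notation mu := (@lebesgue_measure R).
Implicit Types (a b s u t : R) (m n : nat).

Lemma ge0_integral_affine (alpha beta : R) (g : R -> \bar R) :
  alpha != 0 -> measurable_fun setT g -> (forall u, 0 <= g u)%E ->
  (\int[mu]_t (g (alpha * t + beta)%R * `|alpha|%:E) = \int[mu]_u g u)%E.
Proof.
move=> alpha0 mg g0.
apply: (ge0_integral_substitution (fun t => alpha * t + beta) (fun=> `|alpha|)) => //.
  by apply: measurable_funD => //; exact: measurable_funM.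
move=> a b ab.
have mpre : measurable ((fun t : R => alpha * t + beta) @^-1` `]a, b]).
  rewrite -[X in measurable X]setTI.
  have /(_ measurableT) : measurable_fun [set: R] (fun t : R => alpha * t + beta).
    by apply: measurable_funD => //; exact: measurable_funM.
  by apply.
rewrite integral_cst//=.
have [alpha_gt0|alpha_lt0] := ltP 0 alpha.
- have -> : (fun t : R => alpha * t + beta) @^-1` `]a, b] = `](a - beta) / alpha, (b - beta) / alpha]%classic.
    apply/seteqP; split => t /=; rewrite !in_itv/= ltr_pdivrMr// ler_pdivlMr// mulrC; lra.
  rewrite lebesgue_measure_itv/= lte_fin ltr_pM2r ?invr_gt0// gtr0_norm//.
  case: ltP => ab'; last by (have -> : a = b by lra); rewrite mule0 subrr.
  by rewrite -EFinD -EFinM; congr EFin; field; lra.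
- have {}alpha_lt0 : alpha < 0 by rewrite lt_neqAle alpha0.
  have -> : (fun t : R => alpha * t + beta) @^-1` `]a, b] = `[(b - beta) / alpha, (a - beta) / alpha[%classic.
    apply/seteqP; split => t /=; rewrite !in_itv/= ltr_ndivlMr// ler_ndivrMr// mulrC; lra.
  rewrite lebesgue_measure_itv/= lte_fin ltr_nM2r ?invr_lt0// ltr0_norm//.
  case: ltP => ab'; last by (have -> : a = b by lra); rewrite mule0 subrr.
  by rewrite -EFinD -EFinM; congr EFin; field; lra.
Qed.

Lemma integral_exprn_itv n (a b : R) : a <= b ->
  (\int[mu]_(t in `]a, b]) (n.+1%:R * t ^+ n)%:E = (b ^+ n.+1 - a ^+ n.+1)%:E)%E.
Proof.
rewrite le_eqVlt => /predU1P[->|ab].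
  by rewrite set_itv_ge ?bnd_simp ?ltxx// integral_set0 subrr.
have mX : measurable_fun [set: R] (fun t : R => (n.+1%:R * t ^+ n)%:E).
  by apply/measurable_EFinP; apply: measurable_funM => //; exact: measurable_funX.
rewrite integral_itv_obnd_cbnd; last exact: measurable_funTS.
rewrite (@continuous_FTC2 _ _ (fun x => x ^+ n.+1))//=.
- apply: continuous_subspaceT => x; apply: cvgM; first exact: cvg_cst.
  exact: exprn_continuous.
- split.
  + by move=> x _; exact: exprn_derivable.
  + by apply: cvg_at_right_filter; exact: exprn_continuous.
  + by apply: cvg_at_left_filter; exact: exprn_continuous.
- by move=> x _; rewrite derive1E exp_derive// /GRing.scale/= mulr1.
Qed.

(** Extension by 0 lets Beta and Gamma integrals run over the whole line, so that translations,
    scalings and Tonelli involve no integration bounds. *)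
Definition pospow (a : R) : R -> R := (fun u => u `^ (a - 1)) \_ `]0%R, +oo[.

Lemma pospowE a u : pospow a u = if 0 < u then u `^ (a - 1) else 0.
Proof. by rewrite /pospow patchE mem_setE in_itv/= andbT. Qed.

Lemma pospow_ge0 a u : 0 <= pospow a u.
Proof. by rewrite pospowE; case: ifP => // _; exact: powR_ge0. Qed.

Lemma measurable_pospow a : measurable_fun [set: R] (pospow a).
Proof.
apply: (measurable_restrictT _ _).1 => //; apply: measurable_funTS; exact: measurable_powR.
Qed.

Lemma pospowM a u t : 0 < u -> pospow a (u * t) = u `^ (a - 1) * pospow a t.
Proof.
move=> u0; rewrite !pospowE pmulr_rgt0//; case: ifP => t0; last by rewrite mulr0.
by rewrite powRM ?ltW.
Qed.

Lemma pospow_sqr n t : 0 < t -> pospow (n.+1%:R / 2) (t ^+ 2) * (2 * t) = 2 * t ^+ n.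
Proof.
move=> t0; rewrite pospowE exprn_gt0// -powR_mulrn ?ltW// -powRrM.
have -> : 2%:R * (n.+1%:R / 2 - 1) = n%:R - 1 :> R by rewrite -natr1; field.
rewrite powRB ?(gt_eqF t0)// ?implybT// powRr1 ?ltW// powR_mulrn ?ltW//.
by field; rewrite gt_eqF.
Qed.

(* [t |-> t^2] on [t > 0] and [t |-> t] on [t <= 0] make up a bijection of [R]. *)
Lemma ge0_integral_sqr (g : R -> \bar R) :
  measurable_fun setT g -> (forall u, 0 <= g u)%E -> (forall u, (u <= 0)%R -> g u = 0%E) ->
  (\int[mu]_u g u = \int[mu]_t (if (0 < t)%R then g (t ^+ 2)%R * (2 * t)%:E else 0))%E.
Proof.
move=> mg g0 gneg.
pose phi (t : R) := if 0 < t then t ^+ 2 else t.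
pose w (t : R) := if 0 < t then 2 * t else 1.
have mpos : measurable_fun [set: R] (fun t : R => 0 < t) by apply: measurable_fun_ltr.
have mphi : measurable_fun [set: R] phi.
  by apply: measurable_fun_ifT => //; exact: measurable_funX.
have mw : measurable_fun [set: R] w.
  by apply: measurable_fun_ifT => //; exact: measurable_funM.
have w0 t : 0 <= w t by rewrite /w; case: ltP => // t0; rewrite mulr_ge0 ?ltW.
rewrite -(ge0_integral_substitution phi w)//; last first.
  move=> a b ab.
  (* As [Num.sqrt] vanishes on negative numbers, this covers every position of 0 relative to [a] and
     [b]. The two pieces have masses min(b,0) - min(a,0) and max(b,0) - max(a,0), which add up to b
     - a. *)
  have -> : phi @^-1` `]a, b] =
      `]Num.min a 0, Num.min b 0]%classic `|` `]Num.sqrt a, Num.sqrt b]%classic.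
    apply/seteqP; split => t /=; rewrite /phi !in_itv/=.
    - case: (ltP 0 t) => t0.
        have [b0|b0] := ltP 0 b; last first.
          by move=> /andP[_ tb]; have := lt_le_trans (exprn_gt0 2 t0) (le_trans tb b0); rewrite ltxx.
        move=> /andP[at2 tb]; right; apply/andP; split.
          have [a0|a0] := leP 0 a; last by rewrite (ltr0_sqrtr a0).
          by rewrite -(ltr_pXn2r (n := 2)) ?nnegrE ?sqrtr_ge0 ?(ltW t0)// sqr_sqrtr.
        by rewrite -(ler_pXn2r (n := 2)) ?nnegrE ?sqrtr_ge0 ?(ltW t0)// sqr_sqrtr ?(ltW b0).
      by move=> /andP[at_ tb]; left; rewrite le_min tb t0 gt_min at_.
    - case=> /andP[].
        rewrite gt_min le_min => /orP h /andP[tb t0].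
        rewrite (ltNge 0 t) t0 /= tb andbT; case: h => // t0'; lra.
      move=> sa sb; have t0 : 0 < t by apply: le_lt_trans sa; exact: sqrtr_ge0.
      have b0 : 0 < b by rewrite -sqrtr_gt0 (lt_le_trans t0).
      rewrite t0; apply/andP; split.
        have [a0|a0] := leP 0 a; last by rewrite (lt_trans a0)// exprn_gt0.
        by rewrite -(sqr_sqrtr a0) ltr_pXn2r ?nnegrE ?sqrtr_ge0 ?(ltW t0).
      by rewrite -(sqr_sqrtr (ltW b0)) ler_pXn2r ?nnegrE ?sqrtr_ge0 ?(ltW t0).
  rewrite ge0_integral_setU//=; last 3 first.
  - by apply: measurable_funTS; exact/measurable_EFinP.
  - by move=> x _; rewrite lee_fin w0.
  - apply/disj_setPS => t [] /=; rewrite !in_itv/= le_min => /andP[_ /andP[_ t0]] /andP[st _].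
    by have := le_lt_trans (sqrtr_ge0 a) st; rewrite ltNge t0.
  rewrite (eq_integral (cst 1%E)); last first.
    move=> t; rewrite inE/= in_itv/= le_min => /andP[_ /andP[_ t0]].
    by rewrite /w ltNge t0.
  rewrite integral_cst//= mul1e lebesgue_measure_itv/= lte_fin.
  have -> : (\int[mu]_(t in `]Num.sqrt a, Num.sqrt b]) (w t)%:E =
             \int[mu]_(t in `]Num.sqrt a, Num.sqrt b]) (2%:R * t ^+ 1)%:E)%E.
    apply: eq_integral => t; rewrite inE/= in_itv/= => /andP[st _].
    by rewrite /w (le_lt_trans (sqrtr_ge0 a) st).
  rewrite integral_exprn_itv ?ler_wsqrtr//.
  have sqr_max c : Num.sqrt c ^+ 2 = Num.max c 0.
    have [c0|c0] := leP 0 c; first by rewrite sqr_sqrtr.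
    by rewrite ltr0_sqrtr// expr0n.
  rewrite !sqr_max.
  case: ltP => h; rewrite -?EFinD ?add0e -?EFinD; congr EFin; move: h; rewrite /Num.min /Num.max; case: (ltP a 0) => ?; case: (ltP b 0) => ? ?; lra.
apply: eq_integral => t _; rewrite /phi /w; case: ltP => // t0.
by rewrite gneg// mul0e.
Qed.

Lemma integral_pospow_sqr n (h : R -> \bar R) :
  measurable_fun setT h -> (forall u, 0 <= h u)%E ->
  (\int[mu]_u ((pospow (n.+1%:R / 2) u)%:E * h u) =
   \int[mu]_t (if (0 < t)%R then (2 * t ^+ n)%:E * h (t ^+ 2)%R else 0))%E.
Proof.
move=> mh h0; rewrite ge0_integral_sqr.
- apply: eq_integral => t _; case: ltP => // t0.
  by rewrite muleAC -EFinM pospow_sqr.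
- by apply: emeasurable_funM => //; apply/measurable_EFinP; exact: measurable_pospow.
- by move=> u; rewrite mule_ge0// lee_fin pospow_ge0.
- by move=> u u0; rewrite pospowE ltNge u0 mul0e.
Qed.

Lemma ge0_integral_even (f : R -> \bar R) :
  measurable_fun setT f -> (forall t, 0 <= f t)%E -> (forall t : R, f (- t)%R = f t) ->
  (\int[mu]_t f t = \int[mu]_t (if (0 < t)%R then 2%:E * f t else 0))%E.
Proof.
move=> mf f0 fN.
have mpos : measurable_fun [set: R] (fun t : R => 0 < t) by apply: measurable_fun_ltr.
pose k t : \bar R := if 0 < t then f t else 0%E.
have mk : measurable_fun [set: R] k by apply: measurable_fun_ifT.
have k0 t : (0 <= k t)%E by rewrite /k; case: ifP.
have mkN : measurable_fun [set: R] (fun t => k (- t)) by apply: measurableT_comp.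
(* The two integrands can differ only at t = 0, hence the removal of this point on both sides. *)
have -> : (\int[mu]_t f t = \int[mu]_t (k t + k (- t)%R))%E.
  rewrite -(@integral_setD1 _ _ 0 [set: R])//; last 2 first.
  - exact: measurableD.
  - exact: measurable_funTS.
  rewrite -[RHS](@integral_setD1 _ _ 0 [set: R])//; last 2 first.
  - exact: measurableD.
  - by apply: measurable_funTS; exact: emeasurable_funD.
  apply: eq_integral => t; rewrite inE/= => -[_ /eqP t0].
  rewrite /k oppr_gt0; case: ltgtP t0 => // t0 _; rewrite ?adde0//.
  by rewrite add0e fN.
rewrite ge0_integralD//.
have -> : (\int[mu]_t k (- t)%R = \int[mu]_t k t)%E.
  rewrite -[RHS](ge0_integral_affine (-1) 0)// ?oppr_eq0 ?oner_eq0//.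
  by apply: eq_integral => t _; rewrite normrN1 mule1 mulN1r addr0.
rewrite -ge0_integralD//; apply: eq_integral => t _; rewrite /k.
by case: ifP => _; rewrite ?adde0// mule_natl mule2n.
Qed.

(** Substitution u = t^2 on each half-line. It turns the integral over a coordinate into one against
    a power of its square, the form that Liouville's formula can merge with the squared norm of the
    other coordinates. *)
Lemma integral_normX_sqr n (h : R -> \bar R) :
  measurable_fun setT h -> (forall u, 0 <= h u)%E ->
  (\int[mu]_t ((`|t| ^+ n)%:E * h (t ^+ 2)%R) =
   \int[mu]_u ((pospow (n.+1%:R / 2) u)%:E * h u))%E.
Proof.
move=> mh h0; rewrite integral_pospow_sqr// ge0_integral_even.
- apply: eq_integral => t _; case: ltP => // t0.
  by rewrite gtr0_norm// muleA -EFinM.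
- apply: emeasurable_funM.
    by apply/measurable_EFinP; apply: measurable_funX; exact: normr_measurable.
  by apply: measurableT_comp => //; exact: measurable_funX.
- by move=> t; rewrite mule_ge0// lee_fin exprn_ge0.
- by move=> t; rewrite normrN sqrrN.
Qed.

End OneVariable.

(** * Half-integer values of the Gamma and Beta integrals *)

Section Gamma.
Context {R : realType}.
Local Notation mu := (@lebesgue_measure R).
Implicit Types (a b s u t : R) (m n : nat).

(** The Beta and Gamma integrals take extended real values, so that the Tonelli identities below
    precede any statement of finiteness. *)
Definition ebeta a b := (\int[mu]_x (pospow a x * pospow b (1 - x))%:E)%E.
Definition egamma a := (\int[mu]_x (pospow a x * expR (- x))%:E)%E.

Lemma ebeta_ge0 a b : (0 <= ebeta a b)%E.
Proof. by apply: integral_ge0 => x _; rewrite lee_fin mulr_ge0 ?pospow_ge0. Qed.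

Lemma egamma_ge0 a : (0 <= egamma a)%E.
Proof. by apply: integral_ge0 => x _; rewrite lee_fin mulr_ge0 ?pospow_ge0 ?expR_ge0. Qed.

Lemma GammaE a : Gamma R a = fine (egamma a).
Proof.
rewrite /Gamma Rintegral_mkcond /Rintegral /egamma; congr fine.
apply: eq_integral => x _; rewrite patchE pospowE mem_setE in_itv/= andbT.
by case: ifP; rewrite ?mul0r.
Qed.

Lemma measurable_pospow_subl b s : measurable_fun [set: R] (fun u => pospow b (s - u)).
Proof.
by apply: (measurableT_comp (measurable_pospow b)) => //; exact: measurable_funB.
Qed.

(** Scaling u by s pulls out the power of s. For s <= 0 both sides vanish, since u and s - u cannot
    both be positive. *)
Lemma integral_pospow_conv a b s :
  (\int[mu]_u (pospow a u * pospow b (s - u))%:E = (pospow (a + b) s)%:E * ebeta a b)%E.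
Proof.
have mG : measurable_fun [set: R] (fun u => (pospow a u * pospow b (s - u))%:E).
  apply/measurable_EFinP; apply: measurable_funM; first exact: measurable_pospow.
  exact: measurable_pospow_subl.
have [s0|s0] := ltP 0 s; last first.
  rewrite (pospowE (a + b)) ltNge s0 /= mul0e; apply: integral0_eq => u _.
  rewrite (pospowE a) (pospowE b); case: ltP; rewrite ?mul0r// => u0.
  by rewrite ltNge (_ : s - u <= 0) ?mulr0//; lra.
rewrite -(ge0_integral_affine s 0)// ?gt_eqF//; last first.
  by move=> u; rewrite lee_fin mulr_ge0 ?pospow_ge0.
rewrite -ge0_integralZl//; last 3 first.
- apply/measurable_EFinP; apply: measurable_funM; first exact: measurable_pospow.
  exact: measurable_pospow_subl.
- by move=> u _; rewrite lee_fin mulr_ge0 ?pospow_ge0.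
- by rewrite lee_fin pospow_ge0.
apply: eq_integral => u _; rewrite -!EFinM addr0 gtr0_norm//; congr EFin.
have -> : s - s * u = s * (1 - u) by ring.
rewrite !pospowM// (pospowE (a + b)) s0.
have -> : a + b - 1 = (a - 1) + (b - 1) + 1 by ring.
rewrite !powRD ?(gt_eqF s0) ?implybT// powRr1 ?ltW//; ring.
Qed.

(** With s = u + r and the order of integration exchanged, the inner integral is the convolution of
    two powers, a multiple of [pospow (a + b) s]. *)
Lemma ge0_integral_liouville a b (psi : R -> R) :
  measurable_fun setT psi -> (forall u, 0 <= psi u) ->
  (\int[mu]_u \int[mu]_r (pospow a u * pospow b r * psi (u + r)%R)%:E =
   ebeta a b * \int[mu]_s (pospow (a + b) s * psi s)%:E)%E.
Proof.
move=> mpsi psi0.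
pose F (z : R * R) := (pospow a z.1 * pospow b (z.2 - z.1) * psi z.2)%:E.
have mF : measurable_fun [set: R * R] F.
  apply/measurable_EFinP; apply: measurable_funM; last exact: measurableT_comp.
  apply: measurable_funM; first by apply: measurableT_comp => //; exact: measurable_pospow.
  apply: (measurableT_comp (measurable_pospow b)); exact: measurable_funB.
have F0 z : (0 <= F z)%E by rewrite lee_fin !mulr_ge0 ?pospow_ge0.
transitivity (\int[mu]_u \int[mu]_s F (u, s))%E.
  apply: eq_integral => u _.
  rewrite -(ge0_integral_affine 1 (- u))// ?oner_eq0//.
  - apply: eq_integral => s _; rewrite normr1 mule1 mul1r /F/=.
    by rewrite [(u + _)%R]addrC subrK.
  - apply/measurable_EFinP; apply: measurable_funM.
      by apply: measurable_funM => //; exact: measurable_pospow.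
    by apply: measurableT_comp => //; exact: measurable_funD.
  - by move=> r; rewrite lee_fin !mulr_ge0 ?pospow_ge0.
transitivity (\int[mu]_s \int[mu]_u F (u, s))%E; first exact (@fubini_tonelli _ _ _ _ R mu mu F mF F0).
rewrite -ge0_integralZl//; last 3 first.
- apply/measurable_EFinP; apply: measurable_funM => //; exact: measurable_pospow.
- by move=> s _; rewrite lee_fin mulr_ge0 ?pospow_ge0.
- exact: ebeta_ge0.
apply: eq_integral => s _; rewrite EFinM muleA [(ebeta a b * _)%E]muleC -integral_pospow_conv.
rewrite -ge0_integralZr//; last 3 first.
- apply/measurable_EFinP; apply: measurable_funM; first exact: measurable_pospow.
  exact: measurable_pospow_subl.
- by move=> u _; rewrite lee_fin mulr_ge0 ?pospow_ge0.
- by rewrite lee_fin.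
Qed.

Lemma measurable_pospow_exp a : measurable_fun [set: R] (fun x : R => (pospow a x * expR (- x))%:E).
Proof.
apply/measurable_EFinP; apply: measurable_funM; first exact: measurable_pospow.
by apply: measurableT_comp.
Qed.

(** Liouville's formula with the profile exp(-s), for which the left-hand side factors. *)
Lemma egammaM a b : (egamma a * egamma b = ebeta a b * egamma (a + b))%E.
Proof.
rewrite /egamma -(@ge0_integral_liouville a b (fun x => expR (- x))); last 2 first.
- by apply: measurableT_comp.
- by move=> u; exact: expR_ge0.
rewrite -ge0_integralZr//; last 3 first.
- exact: measurable_pospow_exp.
- by move=> u _; rewrite lee_fin mulr_ge0 ?pospow_ge0 ?expR_ge0.
- exact: egamma_ge0.
apply: eq_integral => u _; rewrite -ge0_integralZl//; last 3 first.
- exact: measurable_pospow_exp.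
- by move=> r _; rewrite lee_fin mulr_ge0 ?pospow_ge0 ?expR_ge0.
- by rewrite lee_fin mulr_ge0 ?pospow_ge0 ?expR_ge0.
by apply: eq_integral => r _; rewrite -EFinM opprD expRD; congr EFin; ring.
Qed.

Lemma egamma1 : egamma 1 = 1%E.
Proof.
rewrite -(@integral_exponential_pdf R 1)// /egamma.
rewrite -[RHS](@integral_setD1 _ _ 0 [set: R])//; last 2 first.
- exact: measurableD.
- by apply: measurable_funTS; apply/measurable_EFinP; exact: measurable_exponential_pdf.
rewrite -[LHS](@integral_setD1 _ _ 0 [set: R])//; last 2 first.
- exact: measurableD.
- by apply: measurable_funTS; exact: measurable_pospow_exp.
apply: eq_integral => x; rewrite inE/= => -[_ /eqP x0].
rewrite pospowE subrr powRr0; case: ltgtP x0 => // x0 _.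
- by rewrite exponential_pdfE ?ltW// mulN1r.
- by rewrite lt0_exponential_pdf ?mul0r.
Qed.

Lemma egamma_half : egamma (1 / 2) = (Num.sqrt pi)%:E.
Proof.
rewrite -integralT_gauss /egamma.
under eq_integral do rewrite EFinM.
rewrite -(@integral_normX_sqr R 0 (fun x => (expR (- x))%:E)).
- by apply: eq_integral => t _; rewrite expr0 mul1e.
- by apply/measurable_EFinP; apply: measurableT_comp.
- by move=> u; rewrite lee_fin expR_ge0.
Qed.

Lemma ebeta_1 n : ebeta (n.+1%:R / 2) 1 = (2 / n.+1%:R)%:E.
Proof.
rewrite /ebeta; under eq_integral do rewrite EFinM.
rewrite (@integral_pospow_sqr R n (fun x => (pospow 1 (1 - x))%:E)).
- transitivity (\int[mu]_(t in `]0%R, 1%R]) (2 / n.+1%:R * (n.+1%:R * t ^+ n))%:E)%E.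
    rewrite [RHS]integral_mkcond -[LHS](@integral_setD1 _ _ 1 [set: R])//; last 2 first.
    - exact: measurableD.
    - apply: measurable_funTS; apply: measurable_fun_ifT => //; first by apply: measurable_fun_ltr.
      apply: emeasurable_funM.
        by apply/measurable_EFinP; apply: measurable_funM => //; exact: measurable_funX.
      apply/measurable_EFinP; apply: (measurableT_comp (measurable_pospow 1)).
      by apply: measurable_funB => //; exact: measurable_funX.
    rewrite -[RHS](@integral_setD1 _ _ 1 [set: R])//; last 2 first.
    - exact: measurableD.
    - apply: measurable_funTS; apply: (measurable_restrictT _ _).1 => //.
      apply/measurable_funTS/measurable_EFinP; apply: measurable_funM => //.
      by apply: measurable_funM => //; exact: measurable_funX.
    apply: eq_integral => t; rewrite inE/= => -[_ /eqP t1].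
    rewrite patchE mem_setE in_itv/=; case: ltP => //= t0.
    have -> : (t <= 1) = (t < 1) by rewrite le_eqVlt (negbTE t1).
    rewrite pospowE subrr powRr0 subr_gt0 expr_lt1 ?ltW//=.
    by case: ltP => _; rewrite ?mule0// mule1; congr EFin; field.
  under eq_integral do rewrite EFinM.
  rewrite ge0_integralZl//.
  - by rewrite integral_exprn_itv// expr1n expr0n/= subr0 mule1.
  - apply/measurable_funTS/measurable_EFinP; apply: measurable_funM => //.
  - by move=> t /=; rewrite in_itv/= => /andP[t0 _]; rewrite lee_fin mulr_ge0 ?exprn_ge0 ?ltW.
- apply/measurable_EFinP; exact: measurable_pospow_subl.
- by move=> u; rewrite lee_fin pospow_ge0.
Qed.

(** The functional equation of Gamma, obtained from [egammaM] with b = 1. *)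
Lemma egamma_half_rec n :
  egamma (n.+1%:R / 2) = ((2 / n.+1%:R)%:E * egamma (n.+3%:R / 2))%E.
Proof.
have := egammaM (n.+1%:R / 2) 1; rewrite egamma1 mule1 ebeta_1 => ->.
by congr (_ * egamma _)%E; rewrite -[n.+3]addn2 natrD mulrDl divff.
Qed.

(** The functional equation moves the argument by two halves, so the induction carries two
    consecutive values, starting from sqrt(pi) and 1. An infinite value at one stage would force an
    infinite value two stages earlier. *)
Lemma egamma_half_fin n : exists2 g : R, 0 < g & egamma (n.+1%:R / 2) = g%:E.
Proof.
suff : (exists2 g : R, 0 < g & egamma (n.+1%:R / 2) = g%:E) /\
       (exists2 g : R, 0 < g & egamma (n.+2%:R / 2) = g%:E) by case.
elim: n => [|n [[g g0 gE] ?]].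
  split; first by exists (Num.sqrt pi); [rewrite sqrtr_gt0 pi_gt0|exact: egamma_half].
  by exists 1 => //; rewrite divff// egamma1.
split=> //; exists (g * (n.+1%:R / 2)); first by rewrite mulr_gt0.
have := egamma_half_rec n; rewrite gE; case: (egamma _) (egamma_ge0 (n.+3%:R / 2)) => [x _||//].
- by rewrite -EFinM => -[->]; congr EFin; field.
- by move=> _; rewrite gt0_muley ?lte_fin.
Qed.

Lemma egamma_halfE n : egamma (n.+1%:R / 2) = (Gamma R (n.+1%:R / 2))%:E.
Proof. by rewrite GammaE; have [g _ ->] := egamma_half_fin n. Qed.

Lemma Gamma_half_gt0 n : 0 < Gamma R (n.+1%:R / 2).
Proof. by rewrite GammaE; have [g g0 ->] := egamma_half_fin n. Qed.

Lemma Gamma_half_rec n : Gamma R (n.+3%:R / 2) = n.+1%:R / 2 * Gamma R (n.+1%:R / 2).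
Proof.
have := egamma_half_rec n; rewrite !egamma_halfE -EFinM => -[->].
by field.
Qed.

Lemma Gamma_half : Gamma R (1 / 2) = Num.sqrt pi.
Proof. by rewrite GammaE egamma_half. Qed.

Lemma Gamma1 : Gamma R 1 = 1.
Proof. by rewrite GammaE egamma1. Qed.

Lemma ebeta_half m n : ebeta (m.+1%:R / 2) (n.+1%:R / 2) =
  (Gamma R (m.+1%:R / 2) * Gamma R (n.+1%:R / 2) / Gamma R ((m + n).+2%:R / 2))%:E.
Proof.
have := egammaM (m.+1%:R / 2) (n.+1%:R / 2).
have -> : m.+1%:R / 2 + n.+1%:R / 2 = (m + n).+1.+1%:R / 2 :> R.
  by rewrite -mulrDl -natrD addSn addnS.
rewrite !egamma_halfE; have := Gamma_half_gt0 (m + n).+1.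
case: (ebeta _ _) (ebeta_ge0 (m.+1%:R / 2) (n.+1%:R / 2)) => [x _ g0||//].
- by rewrite -!EFinM => -[->]; rewrite mulfK// gt_eqF.
- by move=> _ g0; rewrite gt0_mulye ?lte_fin.
Qed.

End Gamma.

(** * Iterated integrals of ridge functions *)

Section IteratedIntegral.
Context {R : realType}.
Local Notation mu := (@lebesgue_measure R).
Implicit Types (x : nat -> R) (F : (nat -> R) -> R).

Definition scons (t : R) x : nat -> R := fun i => if i is j.+1 then x j else t.

(** [Rintegral] does not signal divergence, so the linearity of [leb_int] needs integrability at
    every level. It is required of the slice at every t, not almost every t, since the inner values
    enter the outer integrand pointwise. *)
Fixpoint leb_integrable n F : Prop :=
  if n is n'.+1 then
    (forall t, leb_integrable n' (fun x => F (scons t x))) /\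
    mu.-integrable [set: R] (fun t : R => (leb_int R n' (fun x => F (scons t x)))%:E)
  else True.

Lemma Rintegral_sum (I : Type) (r : seq I) (f : I -> R -> R) :
  (forall i, mu.-integrable [set: R] (fun t : R => (f i t)%:E)) ->
  mu.-integrable [set: R] (fun t : R => (\sum_(i <- r) f i t)%:E) /\
  Rintegral mu setT (fun t => \sum_(i <- r) f i t) = \sum_(i <- r) Rintegral mu setT (f i).
Proof.
move=> intf; elim: r => [|i r [IH1 IH2]].
  rewrite big_nil; split; under eq_fun do rewrite big_nil; first exact: integrable0.
  by rewrite Rintegral_cst// mul0r.
rewrite big_cons; split; under eq_fun do rewrite big_cons.
  have := integrableD measurableT (intf i) IH1.
  by apply: eq_integrable => //= t _; rewrite EFinD.
rewrite RintegralD//; last exact: intf.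
by congr (_ + _); exact: IH2.
Qed.

Lemma leb_int_sum n (I : Type) (r : seq I) (c : I -> R) (F : I -> (nat -> R) -> R) :
  (forall i, leb_integrable n (F i)) ->
  leb_integrable n (fun x => \sum_(i <- r) c i * F i x) /\
  leb_int R n (fun x => \sum_(i <- r) c i * F i x) = \sum_(i <- r) c i * leb_int R n (F i).
Proof.
elim: n F => [//|n IHn] F gF /=.
have IH t := IHn (fun i x => F i (scons t x)) (fun i => (gF i).1 t).
have IE : (fun t => leb_int R n (fun x => \sum_(i <- r) c i * F i (scons t x))) =
    (fun t => \sum_(i <- r) c i * leb_int R n (fun x => F i (scons t x))).
  by apply/funext => t; rewrite (IH t).2.
have intc i : mu.-integrable [set: R] (fun t : R => (c i * leb_int R n (fun x => F i (scons t x)))%:E).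
  have := integrableZl measurableT (c i) (gF i).2.
  by apply: eq_integrable => //= t _; rewrite EFinM.
have [S1 S2] := @Rintegral_sum I r _ intc.
split.
  split=> [t|]; first exact: (IH t).1.
  by rewrite (_ : (fun t : R => _) = (fun t : R => (\sum_(i <- r) c i * leb_int R n (fun x => F i (scons t x)))%:E))//;
     apply/funext => t; rewrite (IH t).2.
rewrite [LHS](_ : _ = Rintegral mu setT
   (fun t => \sum_(i <- r) c i * leb_int R n (fun x => F i (scons t x)))); last by rewrite -IE.
rewrite S2; apply: eq_bigr => i _; rewrite RintegralZl//.
exact: (gF i).2.
Qed.

Lemma leb_integrable0 n : leb_integrable n (fun=> 0) /\ leb_int R n (fun=> 0) = 0.
Proof.
elim: n => [//|n [IH1 IH2]] /=; rewrite IH2; split.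
  by split=> //; exact: integrable0.
by rewrite Rintegral_cst// mul0r.
Qed.

(** Odd powers cancel under t -> -t; even powers reduce to [integral_normX_sqr]. Finiteness of [h]
    is assumed only at positive arguments, so [fine] may truncate a value only at the null point t =
    0. *)
Lemma Rintegral_exprn_sqr i (h : R -> \bar R) :
  measurable_fun setT h -> (forall u, 0 <= h u)%E -> (forall u : R, 0 < u -> (h u < +oo)%E) ->
  (\int[mu]_u ((pospow (i.+1%:R / 2) u)%:E * h u) < +oo)%E ->
  mu.-integrable [set: R] (fun t : R => (t ^+ i * fine (h (t ^+ 2)))%:E) /\
  Rintegral mu setT (fun t => t ^+ i * fine (h (t ^+ 2))) =
    if odd i then 0 else fine (\int[mu]_u ((pospow (i.+1%:R / 2) u)%:E * h u))%E.
Proof.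
move=> mh h0 hfin; rewrite -integral_normX_sqr// => intfin.
have mh2 : measurable_fun [set: R] (fun t : R => h (t ^+ 2)).
  by apply: measurableT_comp => //; exact: measurable_funX.
have mf : measurable_fun [set: R] (fun t : R => t ^+ i * fine (h (t ^+ 2))).
  apply: measurable_funM; first exact: measurable_funX.
  by apply: measurableT_comp => //; exact: measurable_fine.
have mf' : measurable_fun [set: R] (fun t : R => (t ^+ i * fine (h (t ^+ 2)))%:E).
  exact/measurable_EFinP.
have mg : measurable_fun [set: R] (fun t : R => (`|t| ^+ i)%:E * h (t ^+ 2)%R)%E.
  apply: emeasurable_funM => //.
  by apply/measurable_EFinP; apply: measurable_funX; exact: normr_measurable.
have intf : mu.-integrable [set: R] (fun t : R => (t ^+ i * fine (h (t ^+ 2)))%:E).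
  apply/integrableP; split => //; apply: le_lt_trans intfin.
  apply: ge0_le_integral => //.
  - by apply: measurableT_comp.
  - move=> t _ /=; rewrite normrM normrX EFinM lee_wpmul2l// ?lee_fin ?exprn_ge0//.
    rewrite ger0_norm ?fine_ge0//.
    by case: (h _) (h0 (t ^+ 2)) => //= _; rewrite leey.
split => //; case: ifP => oi.
  rewrite /Rintegral integralE.
  set f := (fun t : R => (t ^+ i * fine (h (t ^+ 2)))%:E).
  have fN t : f (- t)%R = (- f t)%E.
    by rewrite /f exprNn sqrrN -signr_odd oi expr1 mulN1r mulNr.
  have -> : (\int[mu]_t f^\- t = \int[mu]_t f^\+ t)%E.
    rewrite -[RHS](ge0_integral_affine (-1) 0)// ?oppr_eq0 ?oner_eq0//; last exact: measurable_funepos.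
    apply: eq_integral => t _; rewrite normrN1 mule1 mulN1r addr0.
    by rewrite funenegE funeposE fN.
  have := integrable_pos_fin_num measurableT intf.
  by case: (\int[mu]_t f^\+ t)%E => //= r _; rewrite subrr.
rewrite /Rintegral; congr fine.
rewrite -[LHS](@integral_setD1 _ _ 0 [set: R])//; last 2 first.
- exact: measurableD.
- exact: measurable_funTS.
rewrite -[RHS](@integral_setD1 _ _ 0 [set: R])//; last 2 first.
- exact: measurableD.
- exact: measurable_funTS.
apply: eq_integral => t; rewrite inE/= => -[_ /eqP t0].
have t2 : 0 < t ^+ 2 by rewrite exprn_even_gt0.
rewrite EFinM fineK ?ge0_fin_numE ?hfin//; congr (_%:E * _)%E.
by rewrite -normrX ger0_norm// exprn_even_ge0 ?oi.
Qed.

End IteratedIntegral.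

(** * Powers of a linear form against a radial profile *)

Section Ridge.
Context {R : realType}.
Local Notation mu := (@lebesgue_measure R).
Implicit Types (x w : nat -> R) (psi : R -> R) (n M p q j : nat).

Definition dotn n x w : R := \sum_(i < n) x i * w i.

Lemma dotn_scons n t x w : dotn n.+1 (scons t x) w = t * w 0%N + dotn n x (fun i => w i.+1).
Proof. by rewrite /dotn big_ord_recl. Qed.

Lemma sqnorm_scons n t x : sqnorm R n.+1 (scons t x) = t ^+ 2 + sqnorm R n x.
Proof. by rewrite /sqnorm big_ord_recl. Qed.

Lemma sqnormS n w : sqnorm R n.+1 w = w 0%N ^+ 2 + sqnorm R n (fun i => w i.+1).
Proof. by rewrite /sqnorm big_ord_recl. Qed.

(* This bound is inherited by the profiles [r |-> psi (t^2 + r)] of the slices, in all lower degrees. *)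
Definition radial M psi :=
  [/\ measurable_fun [set: R] psi, forall u, 0 <= psi u &
    exists K, forall r, 0 < r -> psi r * Num.sqrt r ^+ M <= K * expR (- r)].

(** Up to a constant, the integral of psi(|x|^2) over R^n in the variable r = |x|^2. *)
Definition radint psi n : \bar R := (\int[mu]_r (pospow (n%:R / 2) r * psi r)%:E)%E.

Lemma sqrtrX_powR M (r : R) : 0 <= r -> Num.sqrt r ^+ M = r `^ (M%:R / 2).
Proof.
move=> r0; rewrite -powR12_sqrt// -powR_mulrn ?powR_ge0// -powRrM; congr (_ `^ _).
by rewrite mulrC.
Qed.

Lemma pospow_sqrt M n (r : R) : 0 < r ->
  pospow ((M + n)%:R / 2) r = Num.sqrt r ^+ M * pospow (n%:R / 2) r.
Proof.
move=> r0; rewrite !pospowE r0 sqrtrX_powR ?ltW// -powRD ?(gt_eqF r0) ?implybT//.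
by congr (_ `^ _); rewrite natrD; field.
Qed.

Lemma radint_lty M n psi : radial M psi -> (radint psi (M + n.+1) < +oo)%E.
Proof.
move=> [mpsi psi0 [K HK]].
have K0 : 0 <= K.
  have /(le_trans (mulr_ge0 (psi0 1) (exprn_ge0 M (sqrtr_ge0 1)))) := HK 1 ltr01.
  by rewrite pmulr_lge0 ?expR_gt0.
apply: (@le_lt_trans _ _ (K%:E * egamma (n.+1%:R / 2))%E); last first.
  by rewrite egamma_halfE -EFinM ltry.
rewrite /egamma -ge0_integralZl//; last 2 first.
- exact: measurable_pospow_exp.
- by move=> r _; rewrite lee_fin mulr_ge0 ?pospow_ge0 ?expR_ge0.
apply: ge0_le_integral => //.
- by move=> r _; rewrite lee_fin mulr_ge0 ?pospow_ge0.
- by apply/measurable_EFinP; apply: measurable_funM => //; exact: measurable_pospow.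
- by apply: measurable_funeM; exact: measurable_pospow_exp.
move=> r _; rewrite -EFinM lee_fin.
have [r0|r0] := ltP 0 r; last by rewrite !pospowE ltNge r0 /= !mul0r mulr0.
rewrite pospow_sqrt// mulrAC [X in X * _]mulrC -mulrA [X in _ <= X]mulrCA.
rewrite [X in X <= _]mulrA [X in X <= _]mulrC.
by apply: ler_wpM2l; [exact: pospow_ge0|exact: HK].
Qed.

Lemma radial_shift M j psi (t : R) : (j <= M)%N -> t != 0 -> radial M psi ->
  radial j (fun r => psi (t ^+ 2 + r)).
Proof.
move=> jM t0 [mpsi psi0 [K HK]]; split.
- by apply: measurableT_comp => //; exact: measurable_funD.
- by move=> u; exact: psi0.
(* For j <= M one has |t|^(M-j) sqrt(r)^j <= sqrt(t^2 + r)^M: the missing powers of r are traded for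
   a constant depending on t. *)
exists (K / `|t| ^+ (M - j)) => r r0.
have t2 : 0 < t ^+ 2 by rewrite exprn_even_gt0.
have nt : 0 < `|t| ^+ (M - j) by rewrite exprn_gt0// normr_gt0.
have s0 : 0 < t ^+ 2 + r by rewrite addr_gt0.
rewrite mulrAC ler_pdivlMr// -mulrA.
have K0 : 0 <= K.
  have /(le_trans (mulr_ge0 (psi0 1) (exprn_ge0 M (sqrtr_ge0 1)))) := HK 1 ltr01.
  by rewrite pmulr_lge0 ?expR_gt0.
apply: (@le_trans _ _ (psi (t ^+ 2 + r) * Num.sqrt (t ^+ 2 + r) ^+ M)).
  apply: ler_wpM2l => //; rewrite -[in leRHS](subnKC jM) exprD.
  apply: ler_pM; rewrite ?exprn_ge0 ?sqrtr_ge0//.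
    by rewrite lerXn2r ?nnegrE ?sqrtr_ge0// ler_wsqrtr// lerDr ltW.
  rewrite lerXn2r ?nnegrE ?sqrtr_ge0// -sqrtr_sqr ler_wsqrtr// lerDl ltW//.
apply: le_trans (HK _ s0) _; rewrite ler_wpM2l// ler_expR; lra.
Qed.

(** Half the integral of the M-th power of a coordinate over the unit sphere of R^n; the half comes
    from using r = |x|^2 as radial variable. *)
Definition ridge_cst n M : R :=
  if odd M then 0 else Gamma R (M.+1%:R / 2) * Num.sqrt pi ^+ n.-1 / Gamma R ((M + n)%:R / 2).

Lemma Gamma_half_fact p :
  Gamma R ((2 * p).+1%:R / 2) = ((2 * p)`!)%:R * Num.sqrt pi / ((4 ^ p)%:R * (p`!)%:R).
Proof.
elim: p => [|p IH]; first by rewrite muln0 Gamma_half fact0 expn0 mul1r mulr1 divr1.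
rewrite mulnS Gamma_half_rec IH !factS expnS !natrM.
have /= := fact_gt0 (2 * p); have := fact_gt0 p; have := expn_gt0 4 p => /= h1 h2 h3.
have n1 : (p`!)%:R != 0 :> R by rewrite pnatr_eq0 -lt0n.
have n2 : (4 ^ p)%:R != 0 :> R by rewrite pnatr_eq0 -lt0n.
have e1 : (2 * p).+2%:R = 2 * p.+1%:R :> R by rewrite -natrM mulnS.
rewrite ?add2n e1; field.
by rewrite n1 n2 andbT addrC natr1 pnatr_eq0.
Qed.

Lemma sum_even p (f : nat -> R) : (forall j, odd j -> f j = 0) ->
  \sum_(j < (2 * p).+1) f j = \sum_(q < p.+1) f (2 * q)%N.
Proof.
move=> f0; elim: p => [|p IH]; first by rewrite !big_ord_recr !big_ord0.
rewrite mulnS add2n big_ord_recr big_ord_recr /= IH [RHS]big_ord_recr /= -addrA.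
congr (_ + _); rewrite f0 ?add0r ?mulnS//.
by rewrite /= mul2n odd_double.
Qed.

(** This replaces the binomials of 2p by those of p, so that the even terms of a binomial expansion
    of degree 2p become a full expansion of degree p. *)
Lemma bin_Gamma_half p q : (q <= p)%N ->
  'C(2 * p, 2 * q)%:R * (Gamma R ((2 * (p - q)).+1%:R / 2) * Gamma R ((2 * q).+1%:R / 2)) =
  'C(p, q)%:R * Num.sqrt pi * Gamma R ((2 * p).+1%:R / 2).
Proof.
move=> qp; rewrite !Gamma_half_fact.
have := @bin_fact (2 * p) (2 * q); rewrite leq_mul2l qp orbT -mulnBr => /(_ isT).
have := bin_fact qp => <- <-; rewrite !natrM.
have h1 : (q`!)%:R != 0 :> R by rewrite pnatr_eq0 -lt0n fact_gt0.
have h2 : ((p - q)`!)%:R != 0 :> R by rewrite pnatr_eq0 -lt0n fact_gt0.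
have h3 : ((2 * q)`!)%:R != 0 :> R by rewrite pnatr_eq0 -lt0n fact_gt0.
have h4 : ((2 * (p - q))`!)%:R != 0 :> R by rewrite pnatr_eq0 -lt0n fact_gt0.
have h5 k : (4 ^ k)%:R != 0 :> R by rewrite pnatr_eq0 -lt0n expn_gt0.
have h6 : 'C(p, q)%:R != 0 :> R by rewrite pnatr_eq0 -lt0n bin_gt0.
have -> : (4 ^ p)%:R = (4 ^ q)%:R * (4 ^ (p - q))%:R :> R by rewrite -natrM -expnD subnKC.
by field; rewrite h1 h2 h6 !h5.
Qed.

(** The left-hand side is what remains after integrating out one coordinate: binomial coefficients,
    constants of one dimension less, and Beta factors. The terms with j even recombine by
    [bin_Gamma_half], and rotation invariance appears in the form a^2 + W. *)
Lemma ridge_cst_rec n M (a W : R) :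
  \sum_(j < M.+1) ('C(M, j)%:R * a ^+ (M - j) * (ridge_cst n.+1 j * W ^+ j./2)) *
     (if odd (M - j) then 0 else
        Gamma R ((M - j).+1%:R / 2) * Gamma R ((j + n.+1)%:R / 2) / Gamma R ((M + n.+2)%:R / 2)) =
  ridge_cst n.+2 M * (a ^+ 2 + W) ^+ M./2.
Proof.
case: (boolP (odd M)) => oM.
  rewrite [in RHS]/ridge_cst oM mul0r big1// => j _; rewrite oddB ?oM -1?ltnS//.
  case: (boolP (odd j)) => oj /=; last by rewrite mulr0.
  by rewrite /ridge_cst oj mul0r mulr0 mul0r.
have [p ->] : exists p, M = (2 * p)%N.
  by exists M./2; rewrite mul2n even_halfK.
rewrite [LHS](@sum_even p (fun j => ('C(2 * p, j)%:R * a ^+ (2 * p - j) * (ridge_cst n.+1 j * W ^+ j./2)) *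
     (if odd (2 * p - j) then 0 else
        Gamma R ((2 * p - j).+1%:R / 2) * Gamma R ((j + n.+1)%:R / 2) / Gamma R ((2 * p + n.+2)%:R / 2)))); last first.
  by move=> j oj; rewrite /ridge_cst oj mul0r mulr0 mul0r.
have half2 k : (2 * k)./2 = k by rewrite mul2n doubleK.
rewrite half2 exprDn mulr_sumr; apply: eq_bigr => q _.
have qp : (q <= p)%N by rewrite -ltnS.
rewrite -mulnBr /ridge_cst !mul2n !odd_double -!mul2n half2 -exprM.
have g1 : Gamma R ((2 * q + n.+1)%:R / 2) != 0 by rewrite addnS gt_eqF ?Gamma_half_gt0.
have g2 : Gamma R ((2 * p + n.+2)%:R / 2) != 0 by rewrite addnS gt_eqF ?Gamma_half_gt0.
have regroup (b1 a1 G1 G2 G3 G4 sp w : R) : G2 != 0 -> G3 != 0 ->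
    b1 * a1 * (G1 * sp / G2 * w) * (G4 * G2 / G3) = b1 * (G4 * G1) * (a1 * w * sp / G3).
  by move=> G20 G30; field; rewrite G20 G30.
transitivity ('C(2 * p, 2 * q)%:R * (Gamma R ((2 * (p - q)).+1%:R / 2) * Gamma R ((2 * q).+1%:R / 2)) *
  (a ^+ (2 * (p - q)) * W ^+ q * Num.sqrt pi ^+ n / Gamma R ((2 * p + n.+2)%:R / 2))).
  exact: regroup.
have regroup2 c (sp G a1 w sn G3 : R) :
    c%:R * sp * G * (a1 * w * sn / G3) = G * (sp * sn) / G3 * (a1 * w *+ c).
  by rewrite -[_ *+ c]mulr_natl; ring.
rewrite bin_Gamma_half// -[n.+2.-1]/(n.+1) [Num.sqrt pi ^+ n.+1]exprS; exact: regroup2.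
Qed.

(** Slicing at t expands (t w_0 + x.w')^M into powers of degree j <= M with profile psi(t^2 + r).
    The induction must therefore quantify over the degree and the profile. *)
Lemma leb_int_ridge n w M psi : radial M psi ->
  leb_integrable n.+1 (fun x => dotn n.+1 x w ^+ M * psi (sqnorm R n.+1 x)) /\
  leb_int R n.+1 (fun x => dotn n.+1 x w ^+ M * psi (sqnorm R n.+1 x)) =
    ridge_cst n.+1 M * sqnorm R n.+1 w ^+ M./2 * fine (radint psi (M + n.+1)).
Proof.
elim: n w M psi => [|n IHn] w M psi rpsi.
  have [mpsi psi0 _] := rpsi.
  have fin := radint_lty _ 0 _ rpsi.
  have [||||I1 I2] := @Rintegral_exprn_sqr R M (fun u => (psi u)%:E).
  - exact/measurable_EFinP.
  - by move=> u; rewrite lee_fin.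
  - by move=> u _; rewrite ltry.
  - by under eq_integral do rewrite -EFinM; rewrite -addn1.
  have FE t : dotn 1 (scons t (fun=> 0)) w ^+ M * psi (sqnorm R 1 (scons t (fun=> 0))) =
      w 0%N ^+ M * (t ^+ M * fine (psi (t ^+ 2))%:E).
    by rewrite dotn_scons sqnorm_scons /dotn /sqnorm !big_ord0 !addr0 exprMn /=; ring.
  split.
    split=> //; have := integrableZl measurableT (w 0%N ^+ M) I1.
    by apply: eq_integrable => // t _; rewrite -EFinM -FE.
  transitivity (Rintegral mu setT (fun t => w 0%N ^+ M * (t ^+ M * fine (psi (t ^+ 2))%:E))).
    by rewrite /= (_ : (fun t : R => _) = (fun t => w 0%N ^+ M * (t ^+ M * fine (psi (t ^+ 2))%:E)))//; apply/funext.
  rewrite RintegralZl// I2 /ridge_cst; case: (boolP (odd M)) => oM; first by rewrite !mul0r mulr0.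
  under eq_integral do rewrite -EFinM.
  rewrite expr0 mulr1 addn1 divff ?gt_eqF ?Gamma_half_gt0// mul1r.
  by rewrite /sqnorm big_ord_recl big_ord0 addr0 -exprM mul2n even_halfK.
have [mpsi psi0 _] := rpsi.
pose w' i := w i.+1; pose W := sqnorm R n.+1 w'.
pose h j (u : R) := radint (fun r => psi (u + r)) (j + n.+1).
have h0 j u : (0 <= h j u)%E by apply: integral_ge0 => r _; rewrite lee_fin mulr_ge0 ?pospow_ge0.
have mh j : measurable_fun [set: R] (h j).
  apply: (@measurable_fun_fubini_tonelli_F _ _ _ _ R mu (fun z : R * R => (pospow ((j + n.+1)%:R / 2) z.2 * psi (z.1 + z.2))%:E)).
    apply/measurable_EFinP; apply: measurable_funM.
      by apply: (measurableT_comp (measurable_pospow _)).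
    by apply: measurableT_comp => //; exact: measurable_funD.
  by move=> z; rewrite lee_fin mulr_ge0 ?pospow_ge0.
(* Liouville's formula merges u = t^2 with the squared norm of the remaining coordinates. *)
have hint i j : (\int[mu]_u ((pospow (i.+1%:R / 2) u)%:E * h j u) =
    ebeta (i.+1%:R / 2) ((j + n.+1)%:R / 2) * radint psi (i.+1 + (j + n.+1)))%E.
  rewrite /radint [(i.+1 + (j + n.+1))%:R]natrD mulrDl -ge0_integral_liouville//.
  apply: eq_integral => u _; rewrite -ge0_integralZl//; last 3 first.
  - apply/measurable_EFinP; apply: measurable_funM; first exact: measurable_pospow.
    by apply: measurableT_comp => //; exact: measurable_funD.
  - by move=> r _; rewrite lee_fin mulr_ge0 ?pospow_ge0.
  - by rewrite lee_fin pospow_ge0.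
  by apply: eq_integral => r _; rewrite -EFinM mulrA.
(* At t = 0 a term with j < M has coefficient t^(M-j) = 0, but its profile is [psi] itself,
   controlled only in degree M and possibly not integrable in degree j. Such terms are replaced by
   0, which leaves the sum unchanged. *)
pose F (t : R) j : (nat -> R) -> R :=
  if (t == 0) && (j < M)%N then fun=> 0
  else fun x => dotn n.+1 x w' ^+ j * psi (t ^+ 2 + sqnorm R n.+1 x).
have HF t j : (j <= M)%N -> leb_integrable n.+1 (F t j) /\
    t ^+ (M - j) * leb_int R n.+1 (F t j) =
      ridge_cst n.+1 j * W ^+ j./2 * (t ^+ (M - j) * fine (h j (t ^+ 2))).
  move=> jM; rewrite /F; case: ifP => [/andP[/eqP -> jM']|tj].
    split; first exact: (leb_integrable0 n.+1).1.
    by rewrite expr0n subn_eq0 leqNgt jM' !mul0r mulr0.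
  have rt : radial j (fun r => psi (t ^+ 2 + r)).
    case: (eqVneq t 0) tj => [t0 /= jM'|t0 _]; last exact: radial_shift rpsi.
    have -> : j = M by apply/eqP; rewrite eqn_leq jM leqNgt jM'.
    by rewrite t0 expr0n /=; under eq_fun do rewrite add0r.
  by have [H1 ->] := IHn w' j _ rt; split=> //; rewrite /h; ring.
have FE t x : dotn n.+2 (scons t x) w ^+ M * psi (sqnorm R n.+2 (scons t x)) =
    \sum_(j < M.+1) ('C(M, j)%:R * (t * w 0%N) ^+ (M - j)) * F t j x.
  rewrite dotn_scons sqnorm_scons exprDn mulr_suml; apply: eq_bigr => j _.
  rewrite -mulr_natl -!mulrA /F; case: ifP => [/andP[/eqP -> jM]|_].
    by rewrite mul0r expr0n subn_eq0 leqNgt jM !mul0r mulr0.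
  by [].
have Fint (t : R) (j : 'I_M.+1) : leb_integrable n.+1 (F t j).
  by apply: (HF t j _).1; rewrite -ltnS.
have IN t := @leb_int_sum R n.+1 _ (index_enum 'I_M.+1)
   (fun j : 'I_M.+1 => 'C(M, j)%:R * (t * w 0%N) ^+ (M - j)) (fun j : 'I_M.+1 => F t j) (Fint t).
pose c j := 'C(M, j)%:R * w 0%N ^+ (M - j) * (ridge_cst n.+1 j * W ^+ j./2).
have INE : (fun t => leb_int R n.+1 (fun x => dotn n.+2 (scons t x) w ^+ M * psi (sqnorm R n.+2 (scons t x)))) =
    (fun t => \sum_(j < M.+1) c j * (t ^+ (M - j) * fine (h j (t ^+ 2)))).
  apply/funext => t; under [fun x => _]eq_fun do rewrite FE.
  rewrite (IN t).2; apply: eq_bigr => j _.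
  have jM : (j <= M)%N by rewrite -ltnS.
  by rewrite exprMn /c -[RHS]mulrA -(HF t j jM).2; ring.
have hfin j (u : R) : (j <= M)%N -> 0 < u -> (h j u < +oo)%E.
  move=> jM u0; rewrite -(sqr_sqrtr (ltW u0)).
  by apply: radint_lty; apply: (radial_shift _ _ _ _ jM _ rpsi); rewrite gt_eqF ?sqrtr_gt0.
have Mj j : (j <= M)%N -> ((M - j).+1 + (j + n.+1) = M + n.+2)%N by move=> jM; lia.
have term (j : 'I_M.+1) : mu.-integrable [set: R] (fun t : R => (t ^+ (M - j) * fine (h j (t ^+ 2)))%:E) /\
    Rintegral mu setT (fun t => t ^+ (M - j) * fine (h j (t ^+ 2))) =
    (if odd (M - j) then 0 else
        Gamma R ((M - j).+1%:R / 2) * Gamma R ((j + n.+1)%:R / 2) / Gamma R ((M + n.+2)%:R / 2)) *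
     fine (radint psi (M + n.+2)).
  have jM : (j <= M)%N by rewrite -ltnS.
  have fin := radint_lty _ n.+1 _ rpsi.
  have hI : (\int[mu]_u ((pospow ((M - j).+1%:R / 2) u)%:E * h j u) =
      (Gamma R ((M - j).+1%:R / 2) * Gamma R ((j + n.+1)%:R / 2) / Gamma R ((M + n.+2)%:R / 2))%:E
       * radint psi (M + n.+2))%E.
    have jn : (j + n.+1 = (j + n).+1)%N by rewrite addnS.
    have M2 : ((M - j + (j + n)).+2 = M + n.+2)%N by lia.
    by rewrite hint Mj// jn ebeta_half M2.
  have radE : radint psi (M + n.+2) = (fine (radint psi (M + n.+2)))%:E.
    rewrite fineK// ge0_fin_numE//; apply: integral_ge0 => r _.
    by rewrite lee_fin mulr_ge0 ?pospow_ge0.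
  have [||||I1 I2] := @Rintegral_exprn_sqr R (M - j) (h j); rewrite ?hI//.
  - by move=> u; exact: hfin.
  - by rewrite radE -EFinM ltry.
  split => //; rewrite I2; case: ifP => _; first by rewrite mul0r.
  by rewrite hI radE -EFinM.
have cterm (j : 'I_M.+1) : mu.-integrable [set: R] (fun t : R => (c j * (t ^+ (M - j) * fine (h j (t ^+ 2))))%:E).
  have := integrableZl measurableT (c j) (term j).1.
  by apply: eq_integrable => // t _; rewrite EFinM.
have [S1 S2] := @Rintegral_sum R _ (index_enum 'I_M.+1) _ cterm.
split.
  split=> [t|].
    rewrite (_ : (fun x => _) = (fun x => \sum_(j < M.+1) ('C(M, j)%:R * (t * w 0%N) ^+ (M - j)) * F t j x)).
      exact: (IN t).1.
    by apply/funext => x; rewrite FE.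
  have := S1; apply: eq_integrable => // t _; congr EFin.
  by move/(congr1 (fun f => f t)) : INE.
transitivity (Rintegral mu setT (fun t => \sum_(j < M.+1) c j * (t ^+ (M - j) * fine (h j (t ^+ 2))))).
  by rewrite -INE.
rewrite S2 sqnormS -ridge_cst_rec mulr_suml; apply: eq_bigr => j _.
by rewrite RintegralZl ?(term j).2 ?(term j).1// /c mulrA.
Qed.

End Ridge.

(** * Polarization and moments of the uniform law on the sphere *)

Section Ryser.
Context {R : comRingType}.

Lemma sum_perm_ffun m (F : {ffun 'I_m -> 'I_m} -> R) :
  \sum_(f : {ffun 'I_m -> 'I_m} | injectiveb f) F f = \sum_(s : 'S_m) F (finfun s).
Proof.
rewrite (reindex (fun s : 'S_m => finfun s)) /=.
  apply: eq_big => // s; apply/injectiveP => i j; rewrite !ffunE; exact: perm_inj.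
exists (fun f => if [pick s : 'S_m | finfun s == f] is Some s then s else 1%g).
  move=> s _; case: pickP => [s' /eqP /ffunP ss'|/(_ s)]; last by rewrite eqxx.
  by apply/permP => i; have := ss' i; rewrite !ffunE.
move=> f; rewrite inE => /injectiveP f_inj; case: pickP => [s /eqP //|/(_ (perm f_inj)) /eqP []].
by apply/ffunP => i; rewrite ffunE permE.
Qed.

Lemma codom_all_injectiveb m (f : {ffun 'I_m -> 'I_m}) :
  [forall i, i \in codom f] = injectiveb f.
Proof.
apply/forallP/idP => [fs|/injectiveP f_inj i]; last exact: injF_onto.
have : #|codom f| = size (codom f).
  by rewrite size_codom; apply: eq_card => i; rewrite fs.
by move/card_uniqP.
Qed.

(** Ryser's formula for the permanent. After expansion, a map f is weighted by the signed count of
    the sets J containing its image; the count vanishes unless the image is everything, that is,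
    unless f is a permutation. *)
Lemma ryser m (A : 'I_m -> 'I_m -> R) :
  \sum_(J : {set 'I_m}) (-1) ^+ #|~: J| * \prod_l \sum_(j in J) A l j =
  \sum_(s : 'S_m) \prod_l A l (s l).
Proof.
under eq_bigr do rewrite bigA_distr_big /= mulr_sumr.
transitivity (\sum_(f : {ffun 'I_m -> 'I_m}) (\sum_(J : {set 'I_m} | f \in ffun_on (mem J)) (-1) ^+ #|~: J|) *
    \prod_l A l (f l)).
  rewrite (exchange_big_dep xpredT)//=; apply: eq_bigr => f _.
  by rewrite mulr_suml.
transitivity (\sum_(f : {ffun 'I_m -> 'I_m} | injectiveb f) \prod_l A l (f l)); last first.
  by rewrite sum_perm_ffun; apply: eq_bigr => s _; apply: eq_bigr => l _; rewrite ffunE.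
rewrite [RHS]big_mkcond; apply: eq_bigr => f _.
suff -> : \sum_(J : {set 'I_m} | f \in ffun_on (mem J)) (-1) ^+ #|~: J| = (injectiveb f)%:R :> R.
  by case: injectiveb; rewrite ?mul1r ?mul0r.
rewrite -codom_all_injectiveb.
(* The signed count factors over the points: 1 if i is in J, and -1 if it is not, which is allowed
   only outside the image of f. *)
transitivity (\prod_i ((1 : R) + (if i \in codom f then 0 else -1))); last first.
  case: (boolP [forall i, _]) => [/forallP h|].
    by rewrite big1// => i _; rewrite h addr0.
  by rewrite negb_forall => /existsP[i hi]; rewrite (bigD1 i)//= (negbTE hi) subrr mul0r.
rewrite bigA_distr big_mkcond; apply: eq_bigr => J _.
case: ifPn => [/ffun_onP fJ|fJ].
  rewrite (eq_bigr (fun i => if i \in ~: J then -1 else 1)).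
    by rewrite -big_mkcond /= prodr_const.
  move=> i _; rewrite inE; case: (boolP (i \in J)) => //= iJ.
  by case: (boolP (i \in codom f)) => // /codomP[l il]; move: iJ; rewrite il fJ.
have [l lJ] : exists l, f l \notin J.
  apply/existsP; apply: contraR fJ; rewrite negb_exists => /forallP h.
  by apply/ffun_onP => l; have := h l; rewrite negbK.
by rewrite (bigD1 (f l))//= (negbTE lJ) codom_f mul0r.
Qed.

(** Ryser's formula for a matrix with all rows equal to [a]. *)
Lemma polarization m (a : 'I_m -> R) :
  (m`!)%:R * \prod_l a l = \sum_(J : {set 'I_m}) (-1) ^+ #|~: J| * (\sum_(j in J) a j) ^+ m.
Proof.
transitivity (\sum_(J : {set 'I_m}) (-1) ^+ #|~: J| * \prod_(l < m) \sum_(j in J) a j); last first.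
  by apply: eq_bigr => J _; rewrite prodr_const card_ord.
rewrite (ryser m (fun _ j => a j)).
transitivity (\sum_(s : 'S_m) \prod_l a l); first by rewrite sumr_const card_Sn mulr_natl.
by apply: eq_bigr => s _; rewrite (reindex_inj (@perm_inj _ s)).
Qed.

End Ryser.

(** * Moments of linear forms on the sphere *)

Section Sphere.
Context {R : realType}.
Local Notation mu := (@lebesgue_measure R).
Implicit Types (x w : nat -> R) (g : (nat -> R) -> R) (d n M p : nat).

Definition ball_ext d g (y : nat -> R) : R :=
  if sqnorm R d.+1 y <= 1 then g (fun i => y i / Num.sqrt (sqnorm R d.+1 y)) else 0.

Definition sphere_integrable d g := leb_integrable d.+1 (ball_ext d g).

Lemma sphere_intE d g : sphere_int R d g = d.+1%:R * leb_int R d.+1 (ball_ext d g).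
Proof. by []. Qed.

Lemma sphere_int_sum d (I : Type) (r : seq I) (c : I -> R) (F : I -> (nat -> R) -> R) :
  (forall i, sphere_integrable d (F i)) ->
  sphere_integrable d (fun x => \sum_(i <- r) c i * F i x) /\
  sphere_int R d (fun x => \sum_(i <- r) c i * F i x) = \sum_(i <- r) c i * sphere_int R d (F i).
Proof.
move=> sF.
have E : ball_ext d (fun x => \sum_(i <- r) c i * F i x) =
    (fun y => \sum_(i <- r) c i * ball_ext d (F i) y).
  apply/funext => y; rewrite /ball_ext; case: ifP => // _.
  by rewrite big1// => i _; rewrite mulr0.
have [H1 H2] := @leb_int_sum R d.+1 I r c (fun i => ball_ext d (F i)) sF.
split; first by rewrite /sphere_integrable E.
rewrite sphere_intE E H2 mulr_sumr.
by apply: eq_bigr => i _; rewrite sphere_intE mulrCA.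
Qed.

(** The M-th moment of one coordinate of a uniform point of S^d. *)
Definition sphere_cst d M : R :=
  if odd M then 0 else (dfact M.-1)%:R / \prod_(0 <= r < M./2) (d.+1 + 2 * r)%:R.

(** Projecting a point of the ball to the sphere divides (y.w)^M by |y|^M, which leaves this
    profile. Its singularity at 0 is the reason why [radial] bounds only the product of psi(r) and
    r^(M/2). *)
Definition radial_unit M (r : R) : R := if r <= 1 then r `^ (- (M%:R / 2)) else 0.

Lemma radial_unitP M : radial M (radial_unit M).
Proof.
split.
- apply: measurable_fun_ifT; first by apply: measurable_fun_ler.
    exact: measurable_powR.
  exact: measurable_cst.
- by move=> u; rewrite /radial_unit; case: ifP => // _; exact: powR_ge0.
(* On ]0, 1] the product is 1, and 1 <= exp(1 - r) there. *)
exists (expR 1) => r r0; rewrite /radial_unit; case: ifP => r1; last by rewrite mul0r mulr_ge0 ?expR_ge0.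
rewrite sqrtrX_powR ?(ltW r0)// -powRD ?(gt_eqF r0) ?implybT// addNr powRr0 -expRD.
by apply: le_trans (expR_ge1Dx _); lra.
Qed.

Lemma radint_unit d M : radint (radial_unit M) (M + d.+1) = (2 / d.+1%:R)%:E.
Proof.
rewrite -ebeta_1 /radint /ebeta.
have [mr _ _] := radial_unitP M.
rewrite -[LHS](@integral_setD1 _ _ 1 [set: R])//; last 2 first.
- exact: measurableD.
- apply/measurable_funTS/measurable_EFinP; apply: measurable_funM => //.
  exact: measurable_pospow.
rewrite -[RHS](@integral_setD1 _ _ 1 [set: R])//; last 2 first.
- exact: measurableD.
- apply/measurable_funTS/measurable_EFinP; apply: measurable_funM.
    exact: measurable_pospow.
  exact: measurable_pospow_subl.
apply: eq_integral => r; rewrite inE/= => -[_ /eqP r1]; congr EFin.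
have [r0|r0] := ltP 0 r; last by rewrite !(pospowE (_ / 2)) ltNge r0 /= !mul0r.
rewrite pospow_sqrt// sqrtrX_powR ?ltW// mulrAC mulrC; congr (_ * _).
rewrite /radial_unit pospowE subr_gt0 subrr powRr0.
have -> : (r <= 1) = (r < 1) by rewrite le_eqVlt (negbTE r1).
case: ifP => _; last by rewrite mulr0.
by rewrite -powRD ?(gt_eqF r0) ?implybT// subrr powRr0.
Qed.

Lemma Gamma_half_dfact p : Gamma R ((2 * p).+1%:R / 2) = (dfact (2 * p).-1)%:R * Num.sqrt pi / (2 ^ p)%:R.
Proof.
elim: p => [|p IH]; first by rewrite muln0 Gamma_half expn0 mul1r divr1.
rewrite mulnS add2n Gamma_half_rec IH expnS.
have -> : dfact ((2 * p).+2).-1 = ((2 * p).+1 * dfact (2 * p).-1)%N by case: p {IH} => // p; rewrite mulnS.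
have n2 : (2 ^ p)%:R != 0 :> R by rewrite pnatr_eq0 -lt0n expn_gt0.
by rewrite !natrM; field.
Qed.

Lemma Gamma_half_prod n p :
  Gamma R ((2 * p + n.+1)%:R / 2) = (\prod_(0 <= r < p) (n.+1 + 2 * r)%:R) / (2 ^ p)%:R * Gamma R (n.+1%:R / 2).
Proof.
elim: p => [|p IH]; first by rewrite muln0 big_nil expn0 divr1 mul1r.
have -> : (2 * p.+1 + n.+1 = (2 * p + n).+3)%N by lia.
rewrite Gamma_half_rec -addnS IH big_nat_recr//= expnS [(2 * p + _)%N]addnC natrM.
have n2 : (2 ^ p)%:R != 0 :> R by rewrite pnatr_eq0 -lt0n expn_gt0.
by field.
Qed.

Lemma natprod_neq0 d p : (\prod_(0 <= r < p) (d.+1 + 2 * r)%:R : R) != 0.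
Proof. by rewrite prodf_seq_neq0; apply/allP => r _; rewrite pnatr_eq0. Qed.

Lemma sphere_cst_ridge d M :
  d.+1%:R * (ridge_cst d.+1 M * (2 / d.+1%:R)) = omega R d * sphere_cst d M.
Proof.
rewrite /ridge_cst /sphere_cst; case: (boolP (odd M)) => oM; first by rewrite mul0r !mulr0.
have [p ->] : exists p, M = (2 * p)%N by exists M./2; rewrite mul2n even_halfK.
have -> : (2 * p)./2 = p by rewrite mul2n doubleK.
rewrite Gamma_half_dfact Gamma_half_prod /omega -sqrtrX_powR ?pi_ge0//=.
have g : Gamma R (d.+1%:R / 2) != 0 by rewrite gt_eqF ?Gamma_half_gt0.
have n2 : (2 ^ p)%:R != 0 :> R by rewrite pnatr_eq0 -lt0n expn_gt0.
have h := natprod_neq0 d p.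
rewrite [Num.sqrt pi ^+ d.+1]exprS.
have d0 : d.+1%:R != 0 :> R by rewrite pnatr_eq0.
have aux (G P s sd q D e : R) : G != 0 -> P != 0 -> q != 0 -> e != 0 ->
    e * (D * s / q * sd / (P / q * G) * (2 / e)) = 2 * (s * sd) / G * (D / P).
  by move=> G0 P0 q0 e0; field; rewrite G0 P0 q0 e0.
exact: aux.
Qed.

Lemma sphere_ridge d w M :
  sphere_integrable d (fun x => dotn d.+1 x w ^+ M) /\
  sphere_int R d (fun x => dotn d.+1 x w ^+ M) =
    omega R d * sphere_cst d M * sqnorm R d.+1 w ^+ M./2.
Proof.
have E : ball_ext d (fun x => dotn d.+1 x w ^+ M) =
    (fun y => dotn d.+1 y w ^+ M * radial_unit M (sqnorm R d.+1 y)).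
  apply/funext => y; rewrite /ball_ext /radial_unit; case: ifP => _; last by rewrite mulr0.
  have -> : dotn d.+1 (fun i => y i / Num.sqrt (sqnorm R d.+1 y)) w =
      dotn d.+1 y w / Num.sqrt (sqnorm R d.+1 y).
    by rewrite /dotn mulr_suml; apply: eq_bigr => i _; rewrite mulrAC.
  have s0 : 0 <= sqnorm R d.+1 y by apply: sumr_ge0 => i _; exact: sqr_ge0.
  rewrite exprMn exprVn sqrtrX_powR//; congr (_ * _).
  by rewrite powRN.
have [H1 H2] := @leb_int_ridge R d w M _ (radial_unitP M).
split; first by rewrite /sphere_integrable E.
rewrite sphere_intE E H2 radint_unit /=.
by rewrite -sphere_cst_ridge; ring.
Qed.

(** Polarization writes a product of linear forms as a combination of powers of single linear forms,
    which [sphere_ridge] covers. *)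
Lemma sphere_integrable_prod d (ws : seq (nat -> R)) :
  sphere_integrable d (fun x => \prod_(w <- ws) dotn d.+1 x w).
Proof.
set m := size ws.
have -> : (fun x => \prod_(w <- ws) dotn d.+1 x w) =
    (fun x => \sum_(J : {set 'I_m}) ((m`!)%:R^-1 * (-1) ^+ #|~: J|) *
       dotn d.+1 x (fun i => \sum_(j in J) nth (fun=> 0) ws j i) ^+ m).
  apply/funext => x; rewrite (big_nth (fun=> 0)) big_mkord -/m.
  have fm : (m`!)%:R != 0 :> R by rewrite pnatr_eq0 -lt0n fact_gt0.
  apply: (mulfI fm); rewrite polarization mulr_sumr; apply: eq_bigr => J _.
  rewrite -mulrA mulVKf//; congr (_ * _ ^+ _).
  rewrite /dotn exchange_big /=; apply: eq_bigr => i _.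
  by rewrite mulr_sumr.
by apply: (sphere_int_sum _ _ _ _ _ _).1 => J; exact: (sphere_ridge _ _ _).1.
Qed.

End Sphere.

(** * Symmetric tensors *)

Section Tensor.
Context {R : realType} (d : nat).
Implicit Types (T A B : tensor R d) (v : 'I_d.+1 -> R) (m p q r : nat).

Definition permute_seq {m} (sg : 'S_m) (s : seq 'I_d.+1) : seq 'I_d.+1 :=
  [seq nth ord0 s (sg i) | i <- enum 'I_m].

Definition permute_tuple {m} (sg : 'S_m) (s : m.-tuple 'I_d.+1) : m.-tuple 'I_d.+1 :=
  [tuple tnth s (sg i) | i < m].

Lemma permute_seqE m (sg : 'S_m) (s : m.-tuple 'I_d.+1) :
  permute_seq sg s = permute_tuple sg s.
Proof. by rewrite /permute_seq; apply: eq_map => i; rewrite -tnth_nth. Qed.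

Lemma permute_tuple_bij m (sg : 'S_m) : bijective (permute_tuple sg).
Proof.
exists (permute_tuple (sg^-1)%g) => s; apply: eq_from_tnth => i;
  by rewrite !tnth_mktuple ?permK ?permKV.
Qed.

Lemma prod_permute m (sg : 'S_m) (s : m.-tuple 'I_d.+1) (f : 'I_d.+1 -> R) :
  \prod_(i <- permute_tuple sg s) f i = \prod_(i <- s) f i.
Proof.
rewrite !big_tuple [RHS](reindex_inj (@perm_inj _ sg)).
by apply: eq_bigr => i _; rewrite tnth_mktuple.
Qed.

Definition teval m T v : R := \sum_(s : m.-tuple 'I_d.+1) T s * \prod_(i <- s) v i.

Lemma teval_permute m (sg : 'S_m) T v :
  teval m (fun s => T (permute_seq sg s)) v = teval m T v.
Proof.
rewrite /teval [RHS](reindex (permute_tuple sg)); last first.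
  exact/onW_bij/permute_tuple_bij.
by apply: eq_bigr => s _; rewrite permute_seqE prod_permute.
Qed.

Lemma teval_sum m (I : Type) (r : seq I) (c : I -> R) (F : I -> tensor R d) v :
  teval m (fun s => \sum_(i <- r) c i * F i s) v = \sum_(i <- r) c i * teval m (F i) v.
Proof.
rewrite /teval; under eq_bigr do rewrite mulr_suml.
rewrite exchange_big; apply: eq_bigr => i _; rewrite mulr_sumr.
by apply: eq_bigr => s _; rewrite mulrA.
Qed.

(** Permuting the slots of [T] only reorders the monomials, so the symmetrizers disappear once
    tensors are replaced by their polynomials. *)
Lemma teval_tsym m T v : teval m (tsym R d m T) v = teval m T v.
Proof.
rewrite (_ : tsym R d m T =
    fun s => \sum_(sg : 'S_m) (m`!%:R)^-1 * T (permute_seq sg s)); last first.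
  by apply/funext => s; rewrite /tsym mulr_sumr.
rewrite teval_sum; under eq_bigr do rewrite teval_permute.
by rewrite sumr_const card_Sn -[LHS]mulr_natl mulrA mulfV ?mul1r// pnatr_eq0 -lt0n fact_gt0.
Qed.

Lemma tsym_permute m T (sg : 'S_m) (s : m.-tuple 'I_d.+1) :
  tsym R d m T (permute_seq sg s) = tsym R d m T s.
Proof.
rewrite /tsym -!/(permute_seq _ _); congr (_ * _).
rewrite [RHS](reindex_inj (mulIg sg)); apply: eq_bigr => t _.
rewrite -!/(permute_seq _ _) permute_seqE !permute_seqE; congr (T (tval _)).
by apply: eq_from_tnth => i; rewrite !tnth_mktuple permM.
Qed.

(** Evaluate at the sums over J of the basis vectors indexed by the entries of [s0]. By Ryser's
    formula the alternating sum over J leaves the sum of T over all rearrangements of [s0], which is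
    m! T(s0) by symmetry. *)
Lemma symmetric_teval_eq0 m T :
  (forall (sg : 'S_m) (s : m.-tuple 'I_d.+1), T (permute_seq sg s) = T s) ->
  (forall v, teval m T v = 0) -> forall s : m.-tuple 'I_d.+1, T s = 0.
Proof.
move=> symT T0 s0.
have : \sum_(J : {set 'I_m}) (-1) ^+ #|~: J| *
    teval m T (fun i => \sum_(j in J) (i == tnth s0 j)%:R) = 0.
  by rewrite big1// => J _; rewrite T0 mulr0.
under eq_bigr do rewrite /teval mulr_sumr.
rewrite exchange_big /=.
have step (s : m.-tuple 'I_d.+1) :
    \sum_(J : {set 'I_m}) (-1) ^+ #|~: J| *
       (T s * \prod_(i <- s) \sum_(j in J) (i == tnth s0 j)%:R) =
    \sum_(sg : 'S_m) T s * (s == permute_tuple sg s0)%:R :> R.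
  transitivity (T s * \sum_(sg : 'S_m) \prod_l (tnth s l == tnth s0 (sg l))%:R : R).
    rewrite -(ryser m (fun l j => (tnth s l == tnth s0 j)%:R)) mulr_sumr.
    by apply: eq_bigr => J _; rewrite mulrCA big_tuple.
  rewrite mulr_sumr; apply: eq_bigr => sg _; congr (_ * _).
  case: eqVneq => [->|].
    by rewrite big1// => l _; rewrite tnth_mktuple eqxx.
  move=> ne; have [l hl] : exists l, tnth s l != tnth s0 (sg l).
    apply/existsP; apply: contraR ne; rewrite negb_exists => /forallP h.
    by apply/eqP/eq_from_tnth => l; rewrite tnth_mktuple; apply/eqP; have := h l; rewrite negbK.
  by rewrite (bigD1 l)//= (negbTE hl) mul0r.
under eq_bigr do rewrite step.
rewrite exchange_big /= (eq_bigr (fun=> T s0)) => [|sg _]; last first.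
  rewrite (bigD1 (permute_tuple sg s0))//= eqxx mulr1 big1 ?addr0 => [|s /negbTE ->]; last by rewrite mulr0.
  by rewrite -permute_seqE symT.
rewrite sumr_const card_Sn => /eqP; rewrite mulrn_eq0 => /orP[|/eqP//].
by rewrite eqn0Ngt fact_gt0.
Qed.

Lemma teval0 T v : teval 0 T v = T [::].
Proof.
rewrite /teval (big_pred1 [tuple]) => [|s]; first by rewrite big_nil mulr1.
by apply/esym/eqP; apply: val_inj; case: s => -[].
Qed.

Lemma tevalS m T v : teval m.+1 T v = \sum_i v i * teval m (fun s => T (i :: s)) v.
Proof.
rewrite /teval (reindex (fun p : 'I_d.+1 * m.-tuple 'I_d.+1 => [tuple of p.1 :: p.2])); last first.
  exists (fun s => (thead s, [tuple of behead s])) => [[i s] _ /=|s _ /=].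
    by congr pair; apply: val_inj.
  by rewrite -tuple_eta.
rewrite -(pair_bigA _ (fun i (s : m.-tuple 'I_d.+1) => T (i :: s) * \prod_(j <- i :: s) v j)) /=.
apply: eq_bigr => i _; rewrite mulr_sumr; apply: eq_bigr => s _.
by rewrite big_cons mulrCA.
Qed.

Lemma eq_teval m T A v : (forall s : m.-tuple 'I_d.+1, T s = A s) -> teval m T v = teval m A v.
Proof. by move=> TA; apply: eq_bigr => s _; rewrite TA. Qed.

Lemma tevalZ m c T v : teval m (fun s => c * T s) v = c * teval m T v.
Proof. by rewrite /teval mulr_sumr; apply: eq_bigr => s _; rewrite mulrA. Qed.

Lemma tevalD m T A v : teval m (fun s => T s + A s) v = teval m T v + teval m A v.
Proof. by rewrite /teval -big_split; apply: eq_bigr => s _; rewrite mulrDl. Qed.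

Lemma tevalB m T A v : teval m (fun s => T s - A s) v = teval m T v - teval m A v.
Proof.
by rewrite /teval -sumrB; apply: eq_bigr => s _; rewrite mulrBl.
Qed.

Lemma teval_tkron p q A B v : teval (p + q) (tkron R d p A B) v = teval p A v * teval q B v.
Proof.
elim: p A => [|p IH] A.
  rewrite teval0 -tevalZ; apply: eq_teval => s.
  by rewrite /tkron take0 drop0.
rewrite addSn !tevalS mulr_suml; apply: eq_bigr => i _.
by rewrite -mulrA -IH.
Qed.

Lemma teval_tpow p A r v : teval (p * r) (tpow R d p A r) v = teval p A v ^+ r.
Proof.
elim: r => [|r IH]; first by rewrite muln0 teval0.
by rewrite mulnS teval_tkron IH exprS.
Qed.

Lemma teval_tvec (u v : 'I_d.+1 -> R) : teval 1 (tvec R d u) v = \sum_i v i * u i.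
Proof. by rewrite tevalS; apply: eq_bigr => i _; rewrite teval0. Qed.

Lemma teval_vecI v : teval 2 (vecI R d) v = \sum_i v i ^+ 2.
Proof.
rewrite tevalS; apply: eq_bigr => i _; rewrite tevalS (bigD1 i)//= teval0 /= eqxx mulr1.
rewrite big1 ?addr0// => j /negbTE ji; by rewrite teval0 /= eq_sym ji mulr0.
Qed.

Lemma teval_monomial m (x : nat -> R) v :
  teval m (fun s => \prod_(i <- s) x i) v =
  (\sum_(i < d.+1) x i * v i) ^+ m.
Proof.
elim: m => [|m IH]; first by rewrite teval0 big_nil.
rewrite tevalS exprS mulr_suml; apply: eq_bigr => i _.
rewrite (eq_teval _ _ (fun s => x i * \prod_(j <- s) x j)); last by move=> s; rewrite big_cons.
by rewrite tevalZ IH mulrCA mulrA.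
Qed.

End Tensor.

(** * Gegenbauer polynomials *)

Section HomogeneousSums.
Context {R : comRingType}.
Implicit Types (u : nat -> R) (a b : R) (k N j : nat).

(** Homogeneous of degree k when b has weight 2. The range N is kept free so that consecutive
    degrees can share it; terms with 2j > k, where the truncated exponent is meaningless, must have
    coefficient 0. *)
Definition homsum k u N a b := \sum_(j < N) u j * a ^+ (k - 2 * j) * b ^+ j.

Lemma homsum_mulX k u N a b : (forall j, (k < 2 * j)%N -> u j = 0) ->
  a * homsum k u N a b = homsum k.+1 u N a b.
Proof.
move=> u0; rewrite mulr_sumr; apply: eq_bigr => j _.
have [kj|kj] := ltnP k (2 * j); first by rewrite u0// !mul0r mulr0.
by rewrite subSn// exprS; ring.
Qed.

Definition shift u j := if j is j'.+1 then u j' else 0.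

Lemma homsum_shift k u N a b : u N = 0 -> b * homsum k u N.+1 a b = homsum k.+2 (shift u) N.+1 a b.
Proof.
move=> uN; rewrite /homsum big_ord_recr /= uN !mul0r addr0 big_ord_recl /= !mul0r add0r mulr_sumr.
apply: eq_bigr => j _; rewrite /bump /= add1n exprS.
have -> : (k.+2 - 2 * j.+1 = k - 2 * j)%N by lia.
by ring.
Qed.

Lemma homsum_lin k u v N a b (x y : R) :
  x * homsum k u N a b + y * homsum k v N a b = homsum k (fun j => x * u j + y * v j) N a b.
Proof.
rewrite !mulr_sumr -big_split; apply: eq_bigr => j _ /=; ring.
Qed.

Lemma homsum_widen k u N N' a b : (N <= N')%N -> (forall j, (N <= j)%N -> u j = 0) ->
  homsum k u N' a b = homsum k u N a b.
Proof.
move=> NN u0; rewrite /homsum [RHS](big_ord_widen N' (fun j => u j * a ^+ (k - 2 * j) * b ^+ j))// [RHS]big_mkcond.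
by apply: eq_bigr => j _; case: ltnP => // Nj; rewrite u0// !mul0r.
Qed.

End HomogeneousSums.

Section Gegenbauer.
Context {R : realType} (d : nat).
Hypothesis d_gt0 : (0 < d)%N.
Implicit Types (a b t V : R) (k m n p j s N : nat).

(** The recurrence of the Gegenbauer polynomials of index (d-1)/2 divided by their values at 1; for
    d = 1 it is the Chebyshev recurrence. *)
Fixpoint ngeg_pair k (a V : R) : R * R :=
  if k is k'.+1 then
    let p := ngeg_pair k' a V in
    (p.2, ((2 * k' + d.+1)%:R * a * p.2 - k'.+1%:R * V * p.1) / (k' + d)%:R)
  else (1, a).
(* The Gegenbauer polynomial normalized by [C_k(1) = 1] and made homogeneous, [V] having degree 2. *)
Definition ngeg k a V := (ngeg_pair k a V).1.

Lemma ngeg_pair2 k a V : (ngeg_pair k a V).2 = ngeg k.+1 a V.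
Proof. by []. Qed.

Lemma kd_neq0 k : (k + d)%:R != 0 :> R.
Proof. by rewrite pnatr_eq0 addn_eq0 negb_and -!lt0n d_gt0 orbT. Qed.

Lemma ngeg_rec k a V : (k + d)%:R * ngeg k.+2 a V =
  (2 * k + d.+1)%:R * a * ngeg k.+1 a V - k.+1%:R * V * ngeg k a V.
Proof. by rewrite {1}/ngeg /= ngeg_pair2 mulrC divfK ?kd_neq0. Qed.

Lemma ngeg_ind (P : nat -> R -> Prop) a V :
  (P 0%N 1) -> (P 1%N a) ->
  (forall k x y z, P k x -> P k.+1 y ->
     (k + d)%:R * z = (2 * k + d.+1)%:R * a * y - k.+1%:R * V * x -> P k.+2 z) ->
  forall k, P k (ngeg k a V).
Proof.
move=> P0 P1 Ps k; suff : P k (ngeg k a V) /\ P k.+1 (ngeg k.+1 a V) by case.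
elim: k => [//|k [IH1 IH2]]; split=> //.
by apply: Ps IH1 IH2 _; exact: ngeg_rec.
Qed.

(** The values g_n at 1 satisfy (n+1) g_(n+1) = (d-1+n) g_n, and dividing by them turns the
    Gegenbauer recurrence into that of [ngeg]. For d = 1 the recurrences agree directly. *)
Lemma Cg_ngeg_aux k t : [/\ Cg R d k t = Cg R d k 1 * ngeg k t 1, Cg R d k 1 != 0 &
  Cg R d k 1 = if d == 1%N then 1 else (\prod_(0 <= r < k) (d.-1 + r)%:R) / (k`!)%:R].
Proof.
rewrite /Cg; case: (eqVneq d 1%N) => [d1|d1].
  have T1 n : Defs.chebyshev R n 1 = 1.
    suff : Defs.chebyshev R n 1 = 1 /\ Defs.chebyshev R n.+1 1 = 1 by case.
    elim: n => [//|n [IH1 IH2]]; split=> //.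
    rewrite /Defs.chebyshev /= -/(Defs.chebyshev R n 1) -[(cheb_pair R n 1).2]/(Defs.chebyshev R n.+1 1) IH1 IH2.
    ring.
  rewrite T1 mul1r; split => //.
  suff : Defs.chebyshev R k t = ngeg k t 1 /\ Defs.chebyshev R k.+1 t = ngeg k.+1 t 1 by case.
  elim: k => [//|k [IH1 IH2]]; split=> //.
  apply: (mulfI (kd_neq0 k)); rewrite ngeg_rec.
  rewrite /Defs.chebyshev /= -/(Defs.chebyshev R k t) -[(cheb_pair R k t).2]/(Defs.chebyshev R k.+1 t) IH1 IH2.
  have -> : (2 * k + d.+1)%:R = 2 * k.+1%:R :> R by rewrite d1 -natrM; congr (_%:R); lia.
  have -> : (k + d)%:R = k.+1%:R :> R by rewrite d1 addn1.
  ring.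
have dE : d%:R - 1 = d.-1%:R :> R by rewrite -[in LHS](prednK d_gt0) -natr1 addrK.
have dp : (0 < d.-1)%N by case: d d_gt0 d1 => // -[].
rewrite dE; set lam := d.-1%:R / 2.
have lam2 : 2 * lam = d.-1%:R by rewrite /lam; field.
pose g n : R := (\prod_(0 <= r < n) (d.-1 + r)%:R) / (n`!)%:R.
have gS n : n.+1%:R * g n.+1 = (d.-1 + n)%:R * g n.
  have nf : (n`!)%:R != 0 :> R by rewrite pnatr_eq0 -lt0n fact_gt0.
  have n1 : n.+1%:R != 0 :> R by rewrite pnatr_eq0.
  have aux (P x f e : R) : f != 0 -> e != 0 -> e * (P * x / (e * f)) = x * (P / f).
    by move=> f0 e0; field; rewrite f0 e0.
  by rewrite /g big_nat_recr//= factS natrM aux.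
have g0 n : g n != 0.
  rewrite mulf_neq0 ?invr_neq0 ?pnatr_eq0 -?lt0n ?fact_gt0//.
  by rewrite prodf_seq_neq0; apply/allP => r _; rewrite pnatr_eq0 -lt0n addn_gt0 dp.
have gegS n x : n.+2%:R * gegenbauer R lam n.+2 x =
    2 * x * (n.+1%:R + lam) * gegenbauer R lam n.+1 x - (n%:R + 2 * lam) * gegenbauer R lam n x.
  rewrite /gegenbauer /= -/(gegenbauer R lam n x) -[(gegen_pair R lam n x).2]/(gegenbauer R lam n.+1 x).
  by rewrite mulrC divfK// pnatr_eq0.
have main n x : gegenbauer R lam n x = g n * ngeg n x 1.
  suff : gegenbauer R lam n x = g n * ngeg n x 1 /\
         gegenbauer R lam n.+1 x = g n.+1 * ngeg n.+1 x 1 by case.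
  elim: n => [|n [IH1 IH2]].
    split; first by rewrite /g big_nil fact0 divr1 mulr1.
    by rewrite /g big_nat1 factS fact0 addn0 muln1 divr1 /gegenbauer /= lam2.
  split=> //; have n2 : n.+2%:R != 0 :> R by rewrite pnatr_eq0.
  apply: (mulfI n2); rewrite gegS IH1 IH2 [RHS]mulrA gS.
  have h1 := gS n; have h2 := ngeg_rec n x 1.
  have e1 : (d.-1 + n.+1)%:R = (n + d)%:R :> R by congr (_%:R); lia.
  have e2 : (2 * n + d.+1)%:R = 2 * (n.+1%:R + lam) :> R.
    by rewrite mulrDr lam2 -[2 * _]natrM -natrD; congr (_%:R); lia.
  rewrite e1 [RHS]mulrAC h2 e2 lam2 -natrD [(n + d.-1)%N]addnC.
  have -> : (d.-1 + n)%:R * (g n * ngeg n x 1) = n.+1%:R * g n.+1 * ngeg n x 1 by rewrite h1 mulrA.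
  ring.
have ng1 n : ngeg n 1 1 = 1.
  apply: (ngeg_ind (fun _ x => x = 1)) => // n' x y z -> ->.
  rewrite !mulr1 -natrB; last by lia.
  have -> : (2 * n' + d.+1 - n'.+1 = n' + d)%N by lia.
  by rewrite -[RHS]mulr1 => /(mulfI (kd_neq0 n')).
by rewrite !main ng1 mulr1; split.
Qed.

Lemma Cg1_neq0 k : Cg R d k 1 != 0. Proof. by have [] := Cg_ngeg_aux k 1. Qed.

Lemma Cgn_ngeg k t : Cgn R d k t = ngeg k t 1.
Proof. by rewrite /Cgn; have [-> c0 _] := Cg_ngeg_aux k t; rewrite mulrC mulKf. Qed.

Lemma CgE k t : Cg R d k t = Cg R d k 1 * ngeg k t 1.
Proof. by have [] := Cg_ngeg_aux k t. Qed.

Lemma Cg1E k : Cg R d k 1 = if d == 1%N then 1 else (\prod_(0 <= r < k) (d.-1 + r)%:R) / (k`!)%:R.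
Proof. by have [] := Cg_ngeg_aux k 1. Qed.

(** The moment of order 2j of one coordinate of a uniform point of S^(d-1), the sphere of directions
    orthogonal to the mean direction. *)
Definition theta j : R := (dfact (2 * j).-1)%:R / \prod_(0 <= r < j) (d + 2 * r)%:R.

Lemma prod_d_neq0 j : (\prod_(0 <= r < j) (d + 2 * r)%:R : R) != 0.
Proof. by rewrite prodf_seq_neq0; apply/allP => r _; rewrite pnatr_eq0 -lt0n addn_gt0 d_gt0. Qed.

Lemma dfact_double_pred j : dfact (2 * j.+1).-1 = ((2 * j).+1 * dfact (2 * j).-1)%N.
Proof. by case: j => // j; rewrite mulnS mulnS. Qed.

Lemma thetaS j : (d + 2 * j)%:R * theta j.+1 = (2 * j).+1%:R * theta j.
Proof.
have h1 := prod_d_neq0 j; have h2 : (d + 2 * j)%:R != 0 :> R by rewrite pnatr_eq0 -lt0n addn_gt0 d_gt0.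
rewrite /theta big_nat_recr//= dfact_double_pred natrM.
have h3 : d%:R + 2 * j%:R != 0 :> R by rewrite -natrM -natrD.
by field; rewrite h1 h3.
Qed.

(* Laplace's formula [C_k(a) = E[(a + i sqrt(1-a^2) xi)^k]], [xi] a coordinate of a uniform
   point of [S^(d-1)], expanded and made homogeneous. *)
Definition laplace_coef k j : R := 'C(k, 2 * j)%:R * theta j * (-1) ^+ j.

Lemma laplace_coef_rec k j :
  (k + d)%:R * laplace_coef k.+2 j = (2 * k + d.+1)%:R * laplace_coef k.+1 j
    - k.+1%:R * (laplace_coef k j + shift (laplace_coef k) j).
Proof.
case: j => [|j].
  rewrite /laplace_coef /= !bin0 addr0 /theta big_nil expr0 !mulr1 divr1 mulr1.
  have -> : (2 * k + d.+1)%:R = (k + d)%:R + k.+1%:R :> R by rewrite -natrD; congr (_%:R); lia.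
  ring.
have dj : (d + 2 * j)%:R != 0 :> R by rewrite pnatr_eq0 -lt0n addn_gt0 d_gt0.
apply: (mulfI dj).
rewrite /laplace_coef /= mulnS add2n exprS.
set T := theta j.+1; set x := (-1) ^+ j.
have h1 : (2 * j).+1%:R * 'C(k.+1, (2 * j).+1)%:R = k.+1%:R * 'C(k, 2 * j)%:R :> R.
  by rewrite -!natrM mul_bin_diag.
have h2 : (2 * j).+2%:R * 'C(k.+1, (2 * j).+2)%:R = k.+1%:R * 'C(k, (2 * j).+1)%:R :> R.
  by rewrite -!natrM mul_bin_diag.
have h3 : (2 * j).+2%:R * 'C(k.+1, (2 * j).+2)%:R = (k%:R - (2 * j)%:R) * 'C(k.+1, (2 * j).+1)%:R :> R.
  have [kj|kj] := leqP (2 * j) k.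
    rewrite -natrB// -!natrM; congr (_%:R).
    by rewrite mul_bin_left subSS.
  by rewrite !bin_small ?mulr0//; lia.
have h4 := thetaS j; rewrite -/T in h4.
have -> : (d + 2 * j)%:R * ((k + d)%:R * ('C(k.+2, (2 * j).+2)%:R * T * (-1 * x))) =
  (k + d)%:R * ('C(k.+2, (2 * j).+2)%:R * ((d + 2 * j)%:R * T) * (-1 * x)) by ring.
have -> : (d + 2 * j)%:R * ((2 * k + d.+1)%:R * ('C(k.+1, (2 * j).+2)%:R * T * (-1 * x)) -
   k.+1%:R * ('C(k, (2 * j).+2)%:R * T * (-1 * x) + 'C(k, 2 * j)%:R * theta j * x)) =
   - x * ((2 * k + d.+1)%:R * 'C(k.+1, (2 * j).+2)%:R * ((d + 2 * j)%:R * T)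
      - k.+1%:R * 'C(k, (2 * j).+2)%:R * ((d + 2 * j)%:R * T)
      + (d + 2 * j)%:R * (k.+1%:R * 'C(k, 2 * j)%:R) * theta j) by ring.
rewrite h4 -h1.
have e1 : 'C(k.+2, (2 * j).+2)%:R = 'C(k.+1, (2 * j).+2)%:R + 'C(k.+1, (2 * j).+1)%:R :> R.
  by rewrite binS natrD.
have e2 : 'C(k.+1, (2 * j).+2)%:R = 'C(k, (2 * j).+2)%:R + 'C(k, (2 * j).+1)%:R :> R.
  by rewrite binS natrD.
move: h2 h3; rewrite e1 {h1 h4 dj}.
have -> : 'C(k, (2 * j).+2)%:R = 'C(k.+1, (2 * j).+2)%:R - 'C(k, (2 * j).+1)%:R :> R by rewrite e2 addrK.
have -> : (2 * j).+2%:R = 2 * j%:R + 2 :> R by rewrite -natrM -natrD addn2.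
have -> : (2 * j).+1%:R = 2 * j%:R + 1 :> R by rewrite -natrM natr1.
have -> : k.+1%:R = k%:R + 1 :> R by rewrite natr1.
have -> : (2 * j)%:R = 2 * j%:R :> R by rewrite natrM.
have -> : (k + d)%:R = k%:R + d%:R :> R by rewrite natrD.
have -> : (d + 2 * j)%:R = d%:R + 2 * j%:R :> R by rewrite natrD natrM.
have -> : (2 * k + d.+1)%:R = 2 * k%:R + d%:R + 1 :> R by rewrite natrD natrM -[d.+1]addn1 natrD addrA.
move: ('C(k.+1, (2 * j).+2)%:R) ('C(k.+1, (2 * j).+1)%:R) ('C(k, (2 * j).+1)%:R) (theta j).
move=> X Y W Th h2 h3.
(* After Pascal's rule the two sides differ by a multiple of this quantity, which vanishes because
   [h2] and [h3] evaluate the same product. *)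
have h : (k%:R + 1) * W - (k%:R - 2 * j%:R) * Y = 0 by rewrite -h3 h2 subrr.
apply/eqP; rewrite -subr_eq0; apply/eqP.
transitivity (x * Th * (2 * j%:R + 1) * ((k%:R + 1) * W - (k%:R - 2 * j%:R) * Y)); last by rewrite h mulr0.
ring.
Qed.

Lemma laplace_coef_eq0 k j : (k < 2 * j)%N -> laplace_coef k j = 0.
Proof. by move=> kj; rewrite /laplace_coef bin_small// !mul0r. Qed.

(** With V = a^2 + b, multiplication by V in the recurrence splits into two multiplications by a,
    which keep the index j, and one by b, which shifts it; [laplace_coef_rec] is the resulting
    identity of coefficients. *)
Lemma ngeg_laplace k a b :
  ngeg k a (a ^+ 2 + b) = homsum k (laplace_coef k) k./2.+1 a b.
Proof.
suff /(_ k.+1 (leqnn _)) : forall N, (k < N)%N -> ngeg k a (a ^+ 2 + b) = homsum k (laplace_coef k) N a b.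
  by move=> ->; apply: homsum_widen => [|j hj]; [lia|rewrite laplace_coef_eq0//; lia].
move: k; apply: (ngeg_ind (fun k x => forall N, (k < N)%N -> x = homsum k (laplace_coef k) N a b)) => [||k x y z IH1 IH2 zE].
- case=> // N _; rewrite (homsum_widen _ _ 1 N.+1)//; last by move=> j hj; rewrite laplace_coef_eq0//; lia.
  by rewrite /homsum big_ord1 /laplace_coef bin0 /theta big_nil divr1 !mulr1.
- case=> // N _; rewrite (homsum_widen _ _ 1 N.+1)//; last by move=> j hj; rewrite laplace_coef_eq0//; lia.
  by rewrite /homsum big_ord1 /laplace_coef bin0 /theta big_nil divr1 !mulr1 mul1r.
case=> // N kN; apply: (mulfI (kd_neq0 k)); rewrite zE (IH1 N.+1) ?(IH2 N.+1); [|lia|lia].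
have c0 i := fun j => laplace_coef_eq0 i j.
have -> : (2 * k + d.+1)%:R * a * homsum k.+1 (laplace_coef k.+1) N.+1 a b -
   k.+1%:R * (a ^+ 2 + b) * homsum k (laplace_coef k) N.+1 a b =
   (2 * k + d.+1)%:R * (a * homsum k.+1 (laplace_coef k.+1) N.+1 a b) +
   (- k.+1%:R) * (1 * (a * (a * homsum k (laplace_coef k) N.+1 a b)) +
                  1 * (b * homsum k (laplace_coef k) N.+1 a b)) by ring.
rewrite !homsum_mulX; [|by move=> j hj; apply: c0; lia|by move=> j hj; apply: c0; lia|exact: c0].
rewrite homsum_shift; last by apply: c0; lia.
rewrite !homsum_lin /homsum mulr_sumr; apply: eq_bigr => j _.
apply/esym; transitivity ((k + d)%:R * laplace_coef k.+2 j * a ^+ (k.+2 - 2 * j) * b ^+ j); first by rewrite !mulrA.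
rewrite laplace_coef_rec; ring.
Qed.

End Gegenbauer.

(** * Power expansion of the Gegenbauer polynomials *)

Section ExplicitCoefficients.
Context {R : realType} (d : nat).
Hypothesis d_gt0 : (0 < d)%N.
Implicit Types (a b t V : R) (k m n p j s N : nat).

(** Gamma((d-1)/2 + n), with a natural numerator so that the half-integer recurrence applies. For d
    = 1 and n = 0 the argument is 0, whence the positivity conditions on n and k below. *)
Definition Gam n : R := Gamma R ((d.-1 + 2 * n)%:R / 2).

Lemma GamS n : (0 < n)%N -> Gam n.+1 = (d.-1 + 2 * n)%:R / 2 * Gam n.
Proof.
case: n => // n _; rewrite /Gam.
have -> : (d.-1 + 2 * n.+2 = (d.-1 + 2 * n).+1.+3)%N by lia.
have -> : (d.-1 + 2 * n.+1 = (d.-1 + 2 * n).+2)%N by lia.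
by rewrite Gamma_half_rec.
Qed.

(** The coefficient of t^(k-2j) in C_k, without the factor [gkd]. The explicit 0 discards the
    indices at which k - 2j would be truncated. *)
Definition geg_coef k j : R := if (2 * j <= k)%N then
  (-1) ^+ j * (2 ^ (k - 2 * j))%:R * Gam (k - j) / ((j`!)%:R * ((k - 2 * j)`!)%:R) else 0.

Lemma geg_coef_eq0 k j : (k < 2 * j)%N -> geg_coef k j = 0.
Proof. by move=> kj; rewrite /geg_coef leqNgt kj. Qed.

Lemma geg_coef_rec k j : (0 < k)%N ->
  k.+2%:R * geg_coef k.+2 j = (2 * k + d.+1)%:R * geg_coef k.+1 j - (k + d.-1)%:R * shift (geg_coef k) j.
Proof.
move=> k0; rewrite /geg_coef.
have fn0 n : (n`!)%:R != 0 :> R by rewrite pnatr_eq0 -lt0n fact_gt0.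
case: j => [|j].
  rewrite /= muln0 !subn0 ?leq0n mulr0 subr0 expr0 ?fact0 !mul1r.
  rewrite GamS//.
  have f2 : (k.+2)`!%:R = k.+2%:R * (k.+1)`!%:R :> R by rewrite -natrM -factS.
  have p2 : (2 ^ k.+2)%:R = 2 * (2 ^ k.+1)%:R :> R by rewrite -natrM -expnS.
  have -> : (d.-1 + 2 * k.+1)%:R = (2 * k + d.+1)%:R :> R by congr (_%:R); lia.
  have aux (e D x G f : R) : e != 0 -> f != 0 -> e * (2 * x * (D / 2 * G) / (e * f)) = D * (x * G / f).
    by move=> e0 f0; field; rewrite e0 f0.
  by rewrite f2 p2; apply: aux => //; rewrite pnatr_eq0.
rewrite /=; case: (ltngtP (2 * j.+1) k.+2) => hj.
- have -> : (2 * j.+1 <= k.+1)%N by lia.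
  have -> : (2 * j <= k)%N by lia.
  have [i kE] : exists i, k = (i + 2 * j).+1 by exists (k.+1 - 2 * j.+1)%N; lia.
  have -> : (k.+2 - 2 * j.+1 = i.+1)%N by lia.
  have -> : (k.+1 - 2 * j.+1 = i)%N by lia.
  have -> : (k - 2 * j = i.+1)%N by lia.
  have -> : (k.+2 - j.+1 = (k - j).+1)%N by lia.
  have -> : (k.+1 - j.+1 = k - j)%N by lia.
  rewrite GamS; last by lia.
  rewrite !factS expnS !natrM exprS.
  have e1 : k.+2%:R = i%:R + 2 * j%:R + 3 :> R by rewrite kE -natrM -!natrD; congr (_%:R); lia.
  have e2 : (2 * k + d.+1)%:R = 2 * i%:R + 4 * j%:R + d.-1%:R + 4 :> R.
    by rewrite kE -!natrM -!natrD; congr (_%:R); lia.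
  have e3 : (k + d.-1)%:R = i%:R + 2 * j%:R + 1 + d.-1%:R :> R 
    by rewrite (_ : (k + d.-1 = i + 2 * j + d.-1 + 1)%N) ; [rewrite natrD natrD natrD natrM; ring|lia].
  have e4 : (d.-1 + 2 * (k - j))%:R = d.-1%:R + 2 * i%:R + 2 * j%:R + 2 :> R.
    by rewrite kE -!natrM -!natrD; congr (_%:R); lia.
  have eI n : n%:R = n.+1%:R - 1 :> R by rewrite -natr1 addrK.
  have aux (I J D s x G fi fj : R) : I != 0 -> J != 0 -> fi != 0 -> fj != 0 ->
    (I - 1 + 2 * (J - 1) + 3) * (-1 * s * (2 * x) * ((D + 2 * (I - 1) + 2 * (J - 1) + 2) / 2 * G) / (J * fj * (I * fi))) =
    (2 * (I - 1) + 4 * (J - 1) + D + 4) * (-1 * s * x * G / (J * fj * fi)) -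
    (I - 1 + 2 * (J - 1) + 1 + D) * (s * (2 * x) * G / (fj * (I * fi))).
    by move=> I0 J0 fi0 fj0; field; rewrite I0 J0 fi0 fj0.
  by rewrite e1 e2 e3 e4 (eI i) (eI j); apply: aux; rewrite // pnatr_eq0.
- by rewrite !ifN ?mulr0 ?subrr//; lia.
have -> : (2 * j.+1 <= k.+1)%N = false by lia.
have -> : (2 * j <= k)%N by lia.
have kE : k = (2 * j)%N by lia.
have -> : (k.+2 - 2 * j.+1 = 0)%N by lia.
have -> : (k - 2 * j = 0)%N by lia.
have -> : (k.+2 - j.+1 = j.+1)%N by lia.
have -> : (k - j = j)%N by lia.
rewrite mulr0 GamS; last by lia.
rewrite expn0 fact0 !mulr1 factS natrM exprS.
have -> : k.+2%:R = 2 * j.+1%:R :> R by rewrite -natrM; congr (_%:R); lia.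
have -> : (k + d.-1)%:R = (d.-1 + 2 * j)%:R :> R by congr (_%:R); lia.
have aux (e D s G f : R) : e != 0 -> f != 0 -> 2 * e * (-1 * s * (D / 2 * G) / (e * f)) = 0 - D * (s * G / f).
  by move=> e0 f0; field; rewrite e0 f0.
by rewrite aux// pnatr_eq0.
Qed.

(** The sum of the coefficients [geg_coef], that is C_k(1) / [gkd], in a form that makes sense for d
    = 1 as well. *)
Definition geg_ratio k : R :=
  2 * Gamma R (d.+1%:R / 2) * (\prod_(1 <= i < k) (i + d.-1)%:R) / (k`!)%:R.

Lemma geg_ratioS k : (0 < k)%N -> k.+1%:R * geg_ratio k.+1 = (k + d.-1)%:R * geg_ratio k.
Proof.
move=> k0; rewrite /geg_ratio big_nat_recr//= factS natrM.
have aux (e D P G f : R) : e != 0 -> f != 0 -> e * (2 * G * (P * D) / (e * f)) = D * (2 * G * P / f).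
  by move=> e0 f0; field; rewrite e0 f0.
by rewrite aux ?pnatr_eq0// -lt0n fact_gt0.
Qed.

(** Both sides obey the same three-term recurrence. The induction starts at degrees 1 and 2, as
    degree 0 would involve Gamma(0) when d = 1. *)
Lemma homsum_geg_coef k N a V : (0 < k)%N -> (k < N)%N ->
  homsum k (geg_coef k) N a V = geg_ratio k * ngeg d k a V.
Proof.
case: k => // k _.
suff : (forall N, (k.+1 < N)%N -> homsum k.+1 (geg_coef k.+1) N a V = geg_ratio k.+1 * ngeg d k.+1 a V) /\
       (forall N, (k.+2 < N)%N -> homsum k.+2 (geg_coef k.+2) N a V = geg_ratio k.+2 * ngeg d k.+2 a V).
  by move=> [+ _]; apply.
have Gd : Gamma R (d.+1%:R / 2) = Gam 1 by congr (Gamma R (_%:R / 2)); lia.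
elim: k {N} => [|k [IH1 IH2]].
  split=> -[//|N] hN.
    rewrite (homsum_widen _ _ 1)//; last by move=> j hj; apply: geg_coef_eq0; lia.
    rewrite /homsum big_ord1 /geg_coef /geg_ratio Gd /= big_geq// /ngeg /= fact0 !mul1r !mulr1 !divr1.
    by rewrite expn1 expr1.
  rewrite (homsum_widen _ _ 2); [|lia|by move=> j hj; apply: geg_coef_eq0; lia].
  have d0 : (0 + d)%:R != 0 :> R := kd_neq0 d d_gt0 0.
  apply: (mulfI d0); rewrite mulrCA ngeg_rec//.
  rewrite /homsum big_ord_recl big_ord1 /bump /= /geg_coef /geg_ratio Gd /= big_nat1.
  rewrite !fact0 !factS fact0 !muln1 /bump /= (GamS 1)// /ngeg /=.
  have -> : (d.-1 + 2 * 1)%:R = d%:R + 1 :> R by rewrite natr1; congr (_%:R); lia.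
  have -> : (1 + d.-1)%:R = d%:R :> R by congr (_%:R); lia.
  by rewrite !add0n -natr1; field.
split=> // N hN.
case: N hN => // N hN.
have k3 : k.+3%:R != 0 :> R by rewrite pnatr_eq0.
apply: (mulfI k3); rewrite [RHS]mulrA geg_ratioS// -mulrA [in RHS]mulrCA.
have e1 : (k.+2 + d.-1)%:R = (k.+1 + d)%:R :> R by congr (_%:R); lia.
rewrite e1 ngeg_rec//.
have r1 := geg_ratioS k.+1 isT.
have -> : geg_ratio k.+2 * ((2 * k.+1 + d.+1)%:R * a * ngeg d k.+2 a V - k.+2%:R * V * ngeg d k.+1 a V) =
  (2 * k.+1 + d.+1)%:R * (a * (geg_ratio k.+2 * ngeg d k.+2 a V)) +
   (- (k.+1 + d.-1)%:R) * (V * (geg_ratio k.+1 * ngeg d k.+1 a V)).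
  transitivity ((2 * k.+1 + d.+1)%:R * (a * (geg_ratio k.+2 * ngeg d k.+2 a V)) -
    V * ngeg d k.+1 a V * (k.+2%:R * geg_ratio k.+2)); first ring.
  rewrite r1; ring.
rewrite -(IH1 N.+1); last by lia.
rewrite -(IH2 N.+1); last by lia.
rewrite homsum_mulX; last by move=> j; exact: geg_coef_eq0.
rewrite homsum_shift; last by apply: geg_coef_eq0; lia.
rewrite homsum_lin /homsum mulr_sumr; apply: eq_bigr => j _.
transitivity (k.+3%:R * geg_coef k.+3 j * a ^+ (k.+3 - 2 * j) * V ^+ j); first by rewrite !mulrA.
rewrite geg_coef_rec//; ring.
Qed.

(** For d >= 2, Gamma((d+1)/2) = (d-1)/2 Gamma((d-1)/2) cancels the Gamma value in [gkd]. The value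
    k/2 at d = 1 reflects that C_k^lam / lam tends to (2/k) T_k as lam tends to 0. *)
Lemma gkd_ratio k : (0 < k)%N -> gkd R k d * geg_ratio k = Cg R d k 1.
Proof.
move=> k0; rewrite Cg1E// /gkd /geg_ratio.
have kf : (k`!)%:R != 0 :> R by rewrite pnatr_eq0 -lt0n fact_gt0.
have k0' : k%:R != 0 :> R by rewrite pnatr_eq0 -lt0n.
case: (eqVneq d 1%N) => [->|d1].
  have kfE : (k`! = k * \prod_(1 <= i < k) i)%N.
    by rewrite -[in LHS](prednK k0) factS prednK// fact_prod prednK.
  have -> : \prod_(1 <= i < k) (i + 1.-1)%:R = (\prod_(1 <= i < k) i)%:R :> R.
    by rewrite natr_prod; apply: eq_bigr => i _; rewrite addn0.
  rewrite divff// Gamma1 kfE natrM; move: kf; rewrite kfE natrM mulf_eq0 negb_or => /andP[_ P0].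
  by field; rewrite P0 k0'.
have d2 : (0 < d.-1)%N by case: d d_gt0 d1 => // -[].
have dE : d%:R - 1 = d.-1%:R :> R by rewrite -[in LHS](prednK d_gt0) -natr1 addrK.
have -> : \prod_(0 <= r < k) (d.-1 + r)%:R = d.-1%:R * \prod_(1 <= i < k) (i + d.-1)%:R :> R.
  rewrite -(prednK k0) big_nat_recl// addn0 big_add1 /=; congr (_ * _).
  by apply: eq_bigr => i _; rewrite addnC.
have -> : Gamma R (d.+1%:R / 2) = d.-1%:R / 2 * Gamma R (d.-1%:R / 2).
  have -> : d.+1 = d.-2.+3 by lia.
  by rewrite Gamma_half_rec; have -> : d.-1 = d.-2.+1 by lia.
have g0 : Gamma R (d.-1%:R / 2) != 0.
  have dS : d.-1 = d.-2.+1 by lia.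
  by rewrite dS gt_eqF// Gamma_half_gt0.
rewrite dE.
have aux (G P D f : R) : G != 0 -> f != 0 -> G^-1 * (2 * (D / 2 * G) * P / f) = D * P / f.
  by move=> G0 f0; field; rewrite G0 f0.
exact: aux.
Qed.

Lemma Cg_homsum k a : (0 < k)%N ->
  Cg R d k a = gkd R k d * \sum_(s < k./2.+1) geg_coef k s * a ^+ (k - 2 * s).
Proof.
move=> k0; rewrite CgE// -gkd_ratio// -mulrA -(homsum_geg_coef k k.+1)//; congr (_ * _).
rewrite (homsum_widen _ _ k./2.+1); [|lia|by move=> j hj; apply: geg_coef_eq0; lia].
by apply: eq_bigr => s _; rewrite expr1n mulr1.
Qed.

End ExplicitCoefficients.

(** * The law of one coordinate and orthogonality *)

Section Marginal.
Context {R : realType} (d : nat).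
Hypothesis d_gt0 : (0 < d)%N.
Implicit Types (P Q : {poly R}) (k m n p j s N l : nat).

Lemma eq_poly_fun P Q : (forall t, P.[t] = Q.[t]) -> P = Q.
Proof.
move=> PQ; apply/eqP; rewrite -subr_eq0; apply/negP => /negP D0.
pose rs := [seq i%:R : R | i <- iota 0 (size (P - Q))].
have := @max_poly_roots _ (P - Q) rs D0.
rewrite size_map size_iota ltnn => H; apply: notF; apply: H.
- by apply/allP => x _; rewrite rootE hornerD hornerN PQ subrr.
- by rewrite map_inj_uniq ?iota_uniq// => i j /eqP; rewrite eqr_nat => /eqP.
Qed.

(* [E P(U_0)], [U] uniform on the unit sphere of [R^(d+1)]. *)
Definition marginal P : R := \sum_(l < size P) P`_l * sphere_cst d l.

Lemma marginal_widen N P : (size P <= N)%N -> marginal P = \sum_(l < N) P`_l * sphere_cst d l.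
Proof.
move=> PN; rewrite /marginal (big_ord_widen N (fun l => P`_l * sphere_cst d l))// [LHS]big_mkcond.
by apply: eq_bigr => l _; case: ltnP => // Pl; rewrite nth_default// mul0r.
Qed.

Lemma marginalD P Q : marginal (P + Q) = marginal P + marginal Q.
Proof.
pose N := maxn (size P) (size Q).
rewrite !(marginal_widen N) ?leq_maxl ?leq_maxr ?size_polyD//.
by rewrite -big_split; apply: eq_bigr => l _; rewrite coefD mulrDl.
Qed.

Lemma marginalZ c P : marginal (c *: P) = c * marginal P.
Proof.
rewrite (marginal_widen (size P)) ?size_scale_leq// mulr_sumr.
by apply: eq_bigr => l _; rewrite coefZ mulrA.
Qed.

Lemma marginalN P : marginal (- P) = - marginal P.
Proof. by rewrite -scaleN1r marginalZ mulN1r. Qed.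

Lemma marginal_sum (I : Type) (r : seq I) (F : I -> {poly R}) :
  marginal (\sum_(i <- r) F i) = \sum_(i <- r) marginal (F i).
Proof.
elim: r => [|i r IH]; last by rewrite !big_cons marginalD IH.
by rewrite !big_nil /marginal size_poly0 big_ord0.
Qed.

Lemma marginalXn n : marginal 'X^n = sphere_cst d n.
Proof.
rewrite (marginal_widen n.+1) ?size_polyXn// big_ord_recr /= coefXn eqxx mul1r.
by rewrite big1 ?add0r// => l _; rewrite coefXn ltn_eqF// mul0r.
Qed.

Definition weight_poly j : {poly R} := (1 - 'X^2) ^+ j.

Lemma sphere_prodS p : \prod_(0 <= r < p.+1) (d.+1 + 2 * r)%:R =
  (\prod_(0 <= r < p) (d.+1 + 2 * r)%:R) * (d.+1 + 2 * p)%:R :> R.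
Proof. by rewrite big_nat_recr. Qed.

(** Induction on j through (1-t^2)^(j+1) = (1-t^2)^j - t^2 (1-t^2)^j; with n = 2p the two terms
    combine because (d+1+2(p+j)) - (2p+1) = d+2j. *)
Lemma marginal_weight n j : marginal ('X^n * weight_poly j) =
  if odd n then 0 else (dfact n.-1)%:R * (\prod_(0 <= r < j) (d + 2 * r)%:R)
     / \prod_(0 <= r < n./2 + j) (d.+1 + 2 * r)%:R.
Proof.
elim: j n => [|j IH] n.
  by rewrite /weight_poly expr0 mulr1 marginalXn /sphere_cst big_nil mulr1 addn0.
have -> : 'X^n * weight_poly j.+1 = 'X^n * weight_poly j - 'X^(n.+2) * weight_poly j.
  rewrite /weight_poly exprS -[n.+2]addn2 exprD; ring.
rewrite marginalD marginalN !IH -[odd n.+2]/(~~ ~~ odd n) negbK -[n.+2./2]/(n./2.+1) -[n.+2.-1]/(n.+1); case: (boolP (odd n)) => on; first by rewrite subrr.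
have [p ->] : exists p, n = (2 * p)%N by exists n./2; rewrite mul2n even_halfK.
have -> : (2 * p)./2 = p by rewrite mul2n doubleK.
have -> : dfact (2 * p).+1 = ((2 * p).+1 * dfact (2 * p).-1)%N by case: p {on IH} => // p; rewrite mulnS.
rewrite addSn !addnS !sphere_prodS big_nat_recr//=.
have e1 := natprod_neq0 (R := R) d (p + j).
have e2 : (d.+1 + 2 * (p + j))%:R != 0 :> R by rewrite pnatr_eq0.
have -> : (d + 2 * j)%:R = (d.+1 + 2 * (p + j))%:R - (2 * p).+1%:R :> R.
  by rewrite -natrB; [congr (_%:R); lia|lia].
rewrite natrM; move: e1 e2.
move: (\prod_(0 <= r < p + j) _) (\prod_(0 <= r < j) _) ((d.+1 + 2 * (p + j))%:R : R) ((2 * p).+1%:R : R) ((dfact (2 * p).-1)%:R : R).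
by move=> E D x y f e1 e2; field; rewrite e1 e2.
Qed.

Fixpoint ngeg_poly_pair k : {poly R} * {poly R} :=
  if k is k'.+1 then
    let p := ngeg_poly_pair k' in
    (p.2, (k' + d)%:R^-1 *: ((2 * k' + d.+1)%:R *: ('X * p.2) - k'.+1%:R *: p.1))
  else (1, 'X).
Definition ngeg_poly k := (ngeg_poly_pair k).1.

Lemma ngeg_poly_rec k : (k + d)%:R *: ngeg_poly k.+2 =
  (2 * k + d.+1)%:R *: ('X * ngeg_poly k.+1) - k.+1%:R *: ngeg_poly k.
Proof.
rewrite {1}/ngeg_poly /= -[(ngeg_poly_pair k).2]/(ngeg_poly k.+1).
by rewrite scalerA divff ?kd_neq0// scale1r.
Qed.

Lemma horner_ngeg_poly k t : (ngeg_poly k).[t] = ngeg d k t 1.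
Proof.
suff : (ngeg_poly k).[t] = ngeg d k t 1 /\ (ngeg_poly k.+1).[t] = ngeg d k.+1 t 1 by case.
elim: k => [|k [IH1 IH2]].
  by rewrite /ngeg_poly /ngeg /= hornerX hornerE.
split=> //; apply: (mulfI (kd_neq0 d d_gt0 k)); rewrite ngeg_rec// -hornerZ ngeg_poly_rec.
by rewrite hornerD hornerN !hornerZ hornerM hornerX IH1 IH2; ring.
Qed.

(* Rodrigues' formula, evaluated on monomials. *)
Lemma marginal_Xn_ngeg_poly k n : marginal ('X^n * ngeg_poly k) =
  if odd (n + k) then 0 else
    (n ^_ k)%:R * (dfact (n - k).-1)%:R / \prod_(0 <= r < (n + k)./2) (d.+1 + 2 * r)%:R.
Proof.
suff : (forall n, marginal ('X^n * ngeg_poly k) = if odd (n + k) then 0 else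
    (n ^_ k)%:R * (dfact (n - k).-1)%:R / \prod_(0 <= r < (n + k)./2) (d.+1 + 2 * r)%:R) /\
  (forall n, marginal ('X^n * ngeg_poly k.+1) = if odd (n + k.+1) then 0 else
    (n ^_ k.+1)%:R * (dfact (n - k.+1).-1)%:R / \prod_(0 <= r < (n + k.+1)./2) (d.+1 + 2 * r)%:R).
  by case.
elim: k {n} => [|k [IH1 IH2]].
  split=> n; first by rewrite mulr1 marginalXn /sphere_cst addn0 subn0 ffactn0 mul1r.
  rewrite -exprSr marginalXn /sphere_cst addn1 /=; case: (boolP (odd n)) => //= on.
  case: n on => // n on; rewrite ffactn1 subn1 /=; congr (_ / _).
  by rewrite -natrM; case: n on.
split=> // n.
have kd := kd_neq0 (R := R) d d_gt0 k.
apply: (mulfI kd); rewrite -marginalZ scalerAr ngeg_poly_rec mulrBr -!scalerAr marginalD marginalN !marginalZ.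
have -> : 'X^n * ('X * ngeg_poly k.+1) = 'X^(n.+1) * ngeg_poly k.+1 by rewrite mulrA exprSr.
rewrite IH1 IH2 !addnS addSn /= !negbK; case: (boolP (odd (n + k))) => onk; first by rewrite !mulr0 subrr.
have [s sE] : exists s, (n + k = 2 * s)%N by exists (n + k)./2; rewrite mul2n even_halfK.
have -> : (n + k)./2 = s by rewrite sE mul2n doubleK.
have e1 := natprod_neq0 (R := R) d s.
have e2 : (d.+1 + 2 * s)%:R != 0 :> R by rewrite pnatr_eq0.
rewrite sphere_prodS subSS ffactSS.
have [kn|nk] := ltnP n k.
  by rewrite !ffact_small ?mul0r ?mulr0 ?muln0 ?mul0r ?mulr0 ?subrr//; lia.
(* As n + k is even, n - k is 0, where both sides vanish, or at least 2, where the last factor of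
   the falling factorial is absorbed by the double factorial. *)
have fE : (n ^_ k.+2 * dfact (n - k.+2).-1 = n ^_ k * (n - k) * dfact (n - k).-1)%N.
  rewrite !ffactnSr.
  case E : (n - k)%N => [|[|i]]; first by rewrite !muln0 !mul0n.
    by have := onk; rewrite (_ : n + k = 2 * k + 1)%N; [rewrite oddD oddM|lia].
  have -> : (n - k.+1 = i.+1)%N by lia.
  have -> : (n - k.+2 = i)%N by lia.
  by rewrite /= -!mulnA; congr (_ * (_ * _))%N; case: i {E}.
rewrite -[(n ^_ k.+2)%:R * _]natrM fE !natrM natrB//.
have -> : (d.+1 + 2 * s)%:R = d%:R + 1 + n%:R + k%:R :> R by rewrite -sE natrD -[d.+1]addn1 !natrD; ring.
move: e2; have -> : (d.+1 + 2 * s)%:R = d%:R + 1 + n%:R + k%:R :> R by rewrite -sE natrD -[d.+1]addn1 !natrD; ring.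
move: e1; have -> : (2 * k + d).+1%:R = 2 * k%:R + d%:R + 1 :> R by rewrite -natr1 natrD natrM.
have -> : (k + d)%:R = k%:R + d%:R :> R by rewrite natrD.
rewrite -![_.+1%:R]natr1.
move: (\prod_(0 <= r < s) _) ((n ^_ k)%:R : R) ((dfact (n - k).-1)%:R : R) (n%:R : R) (k%:R : R) (d%:R : R).
move=> E f D x y z e1 e2; field.
by rewrite e1 e2.
Qed.

(** On a monomial of degree i < k, the falling factorial [i ^_ k] of [marginal_Xn_ngeg_poly]
    vanishes. *)
Lemma marginal_orthogonal k P : (size P <= k)%N -> marginal (P * ngeg_poly k) = 0.
Proof.
move=> Pk; rewrite -[P]coefK poly_def mulr_suml marginal_sum big1// => i _.
rewrite -scalerAl marginalZ marginal_Xn_ngeg_poly ffact_small ?mul0r ?if_same ?mulr0//.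
by rewrite (leq_trans _ Pk).
Qed.

Lemma marginal_parity k n j : odd (n + k) -> marginal ('X^n * weight_poly j * ngeg_poly k) = 0.
Proof.
elim: j n => [|j IH] n onk.
  by rewrite /weight_poly expr0 mulr1 marginal_Xn_ngeg_poly onk.
have -> : 'X^n * weight_poly j.+1 * ngeg_poly k =
    'X^n * weight_poly j * ngeg_poly k - 'X^(n.+2) * weight_poly j * ngeg_poly k.
  rewrite /weight_poly exprS -[n.+2]addn2 exprD; ring.
by rewrite marginalD marginalN !IH ?subrr//= negbK.
Qed.

Lemma size_Xn_weight n j : (size ('X^n * weight_poly j - (-1) ^+ j *: 'X^(n + 2 * j))%R <= n + 2 * j)%N.
Proof.
elim: j n => [|j IH] n.
  by rewrite /weight_poly expr0 mulr1 muln0 addn0 expr0 scale1r subrr size_poly0.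
have -> : 'X^n * weight_poly j.+1 - (-1) ^+ j.+1 *: 'X^(n + 2 * j.+1) =
    ('X^n * weight_poly j - (-1) ^+ j *: 'X^(n + 2 * j)) + (-1) ^+ j *: 'X^(n + 2 * j)
    - ('X^(n.+2) * weight_poly j - (-1) ^+ j *: 'X^(n.+2 + 2 * j)).
  have -> : (n + 2 * j.+1 = n.+2 + 2 * j)%N by lia.
  rewrite [(-1) ^+ j.+1]exprS mulN1r scaleNr subrK /weight_poly exprS.
  have -> : 'X^(n.+2) = 'X^n * 'X^2 :> {poly R} by rewrite -exprD addn2.
  ring.
apply: leq_trans (size_polyD _ _) _; rewrite geq_max size_polyN; apply/andP; split.
  apply: leq_trans (size_polyD _ _) _; rewrite geq_max; apply/andP; split.
    by apply: leq_trans (IH n) _; lia.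
  by apply: leq_trans (size_scale_leq _ _) _; rewrite size_polyXn; lia.
by apply: leq_trans (IH n.+2) _; lia.
Qed.

(** By orthogonality only the leading term (-1)^j X^k counts; its sign is the one in
    [laplace_coef]. *)
Lemma marginal_top k n j : (n + 2 * j = k)%N -> marginal ('X^n * weight_poly j * ngeg_poly k) =
  (-1) ^+ j * ((k`!)%:R / \prod_(0 <= r < k) (d.+1 + 2 * r)%:R).
Proof.
move=> nk.
have -> : 'X^n * weight_poly j * ngeg_poly k =
    ('X^n * weight_poly j - (-1) ^+ j *: 'X^(n + 2 * j)) * ngeg_poly k + (-1) ^+ j *: ('X^(n + 2 * j) * ngeg_poly k).
  by rewrite mulrBl -scalerAl subrK.
rewrite marginalD marginal_orthogonal ?add0r; last by rewrite -[X in (_ <= X)%N]nk size_Xn_weight.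
rewrite marginalZ marginal_Xn_ngeg_poly nk addnn odd_double doubleK ffactnn subnn /=.
by rewrite mulr1.
Qed.

Lemma marginal_low k n j : (n + 2 * j < k)%N -> marginal ('X^n * weight_poly j * ngeg_poly k) = 0.
Proof.
move=> nk; apply: marginal_orthogonal.
rewrite -(subrK ((-1) ^+ j *: 'X^(n + 2 * j)) ('X^n * weight_poly j)).
apply: leq_trans (size_polyD _ _) _; rewrite geq_max; apply/andP; split.
  by apply: leq_trans (size_Xn_weight n j) _; lia.
by apply: leq_trans (size_scale_leq _ _) _; rewrite size_polyXn.
Qed.

End Marginal.

(** * Moments along the direction mu *)

Section SphereMoments.
Context {R : realType} (d : nat).
Hypothesis d_gt0 : (0 < d)%N.
Variable mu : 'I_d.+1 -> R.
Hypothesis hmu : \sum_(i < d.+1) mu i ^+ 2 = 1.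
Implicit Types (v : 'I_d.+1 -> R) (P : {poly R}) (k m n p j s l M : nat) (z : R) (x : nat -> R).

Definition natvec v : nat -> R := fun i => v (inord i).

Lemma dotn_natvec x v : dotn d.+1 x (natvec v) = \sum_(i < d.+1) x i * v i.
Proof. by apply: eq_bigr => i _; rewrite /natvec inord_val. Qed.

Definition vdot v : R := \sum_i v i * mu i.
Definition vsq v : R := \sum_i v i ^+ 2.

Lemma sphere_integrable_monomial (c : seq 'I_d.+1) v m l :
  sphere_integrable d (fun x => \prod_(i <- c) x i * (dotn d.+1 x (natvec v) ^+ m * dotn d.+1 x (natvec mu) ^+ l)).
Proof.
have -> : (fun x => \prod_(i <- c) x i * (dotn d.+1 x (natvec v) ^+ m * dotn d.+1 x (natvec mu) ^+ l)) =
   (fun x => \prod_(w <- [seq natvec (fun j : 'I_d.+1 => (i == j)%:R) | i <- c] ++ nseq m (natvec v) ++ nseq l (natvec mu)) dotn d.+1 x w).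
  apply/funext => x; rewrite !big_cat /= big_map; congr (_ * _).
    apply: eq_bigr => i _; rewrite dotn_natvec (bigD1 i)//= eqxx mulr1 big1 ?addr0// => j ji.
    by rewrite eq_sym (negbTE ji) mulr0.
  have pr n (w : nat -> R) : \prod_(u <- nseq n w) dotn d.+1 x u = dotn d.+1 x w ^+ n.
    by elim: n => [|n IH]; rewrite ?big_nil//= big_cons IH exprS.
  by rewrite !pr.
exact: sphere_integrable_prod.
Qed.

Lemma sphere_mixed_integrable v m l :
  sphere_integrable d (fun x => dotn d.+1 x (natvec v) ^+ m * dotn d.+1 x (natvec mu) ^+ l).
Proof.
have := sphere_integrable_monomial [::] v m l.
by under [fun x => _]eq_fun do rewrite big_nil mul1r.
Qed.

Definition mixed v m l := sphere_int R d (fun x => dotn d.+1 x (natvec v) ^+ m * dotn d.+1 x (natvec mu) ^+ l).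

Lemma mixed_generating v M z :
  \sum_(l < M.+1) ('C(M, l)%:R * mixed v (M - l) l) * z ^+ l =
  omega R d * sphere_cst d M * (vsq v + 2 * z * vdot v + z ^+ 2) ^+ M./2.
Proof.
have [_ E] := sphere_ridge d (natvec (fun i => v i + z * mu i)) M.
have sqE : sqnorm R d.+1 (natvec (fun i => v i + z * mu i)) = vsq v + 2 * z * vdot v + z ^+ 2.
  rewrite /sqnorm /natvec; under eq_bigr do rewrite inord_val.
  rewrite -[z ^+ 2]mulr1 -[in z ^+ 2 * 1]hmu /vsq /vdot !mulr_sumr -!big_split /=.
  by apply: eq_bigr => i _; ring.
rewrite -sqE -E.
have -> : (fun x => dotn d.+1 x (natvec (fun i => v i + z * mu i)) ^+ M) =
   (fun x => \sum_(l < M.+1) ('C(M, l)%:R * z ^+ l) * (dotn d.+1 x (natvec v) ^+ (M - l) * dotn d.+1 x (natvec mu) ^+ l)).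
  apply/funext => x.
  have -> : dotn d.+1 x (natvec (fun i => v i + z * mu i)) = dotn d.+1 x (natvec v) + z * dotn d.+1 x (natvec mu).
    rewrite !dotn_natvec mulr_sumr -big_split; apply: eq_bigr => i _ /=; ring.
  rewrite exprDn; apply: eq_bigr => l _; rewrite exprMn -mulr_natl; ring.
have [_ ->] := @sphere_int_sum R d _ (index_enum 'I_M.+1) (fun l : 'I_M.+1 => 'C(M, l)%:R * z ^+ l)
  (fun l : 'I_M.+1 => fun x => dotn d.+1 x (natvec v) ^+ (M - l) * dotn d.+1 x (natvec mu) ^+ l)
  (fun l : 'I_M.+1 => sphere_mixed_integrable v (M - l) l).
by apply: eq_bigr => l _; rewrite /mixed mulrAC.
Qed.

(** Completing the square gives |v + z mu|^2 = (a + z)^2 + b with a and b free of z; expanding in b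
    first produces the powers b^j of the decomposition. *)
Lemma expand_generating (a b z : R) p :
  ((a + z) ^+ 2 + b) ^+ p =
  \sum_(l < (2 * p).+1) (\sum_(j < p.+1) ('C(p, j)%:R * 'C(2 * (p - j), l)%:R * a ^+ (2 * (p - j) - l) * b ^+ j)) * z ^+ l.
Proof.
rewrite exprDn; under [RHS]eq_bigr do rewrite mulr_suml.
rewrite exchange_big /=; apply: eq_bigr => j _.
rewrite -exprM exprDn.
have -> : \sum_(i < (2 * (p - j)).+1) a ^+ (2 * (p - j) - i) * z ^+ i *+ 'C(2 * (p - j), i) =
   \sum_(i < (2 * p).+1) a ^+ (2 * (p - j) - i) * z ^+ i *+ 'C(2 * (p - j), i).
  have le : ((2 * (p - j)).+1 <= (2 * p).+1)%N by lia.
  rewrite (big_ord_widen _ (fun i => a ^+ (2 * (p - j) - i) * z ^+ i *+ 'C(2 * (p - j), i)) le) big_mkcond.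
  by apply: eq_bigr => i _; case: ltnP => // hi; rewrite bin_small.
rewrite mulr_suml -mulr_natl mulr_sumr; apply: eq_bigr => i _.
by rewrite -[_ *+ 'C(2 * (p - j), i)]mulr_natl; ring.
Qed.

Lemma dfact_fact p : (dfact (2 * p).-1 * (2 ^ p * p`!) = (2 * p)`!)%N.
Proof.
elim: p => [//|p IH]; rewrite dfact_double_pred expnS factS.
have -> : (2 * p.+1)`! = ((2 * p).+2 * ((2 * p).+1 * (2 * p)`!))%N by rewrite mulnS -!factS.
rewrite -IH (_ : (2 * p).+2 = 2 * p.+1)%N; last by lia.
by move: (dfact _) (2 ^ p)%N (p`!) => A B C; nia.
Qed.

(** Matches the coefficient of z^l in [expand_generating] with [theta] and the moments of
    [marginal_weight]; both sides reduce to the same quotient of factorials and powers of 2. *)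
Lemma bin_dfact p l m j : (l + m = 2 * p)%N -> (2 * j <= m)%N ->
  (dfact (2 * p).-1)%:R * 'C(p, j)%:R * 'C(2 * (p - j), l)%:R =
  'C(2 * p, l)%:R * 'C(m, 2 * j)%:R * (dfact (2 * j).-1)%:R * (dfact (2 * (p - j)).-1)%:R :> R.
Proof.
move=> lm jm.
have fn0 n : (n`!)%:R != 0 :> R by rewrite pnatr_eq0 -lt0n fact_gt0.
have tn0 n : (2 ^ n)%:R != 0 :> R by rewrite pnatr_eq0 -lt0n expn_gt0.
have dE n : (dfact (2 * n).-1)%:R = (2 * n)`!%:R / ((2 ^ n)%:R * (n`!)%:R) :> R.
  by rewrite -dfact_fact !natrM mulfK// mulf_neq0.
have bE n i : (i <= n)%N -> 'C(n, i)%:R = n`!%:R / (i`!%:R * (n - i)`!%:R) :> R.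
  by move=> hin; rewrite -(bin_fact hin) !natrM mulfK// mulf_neq0.
rewrite !dE !bE; try lia.
have -> : (2 * p - l = m)%N by lia.
have -> : (2 * (p - j) - l = m - 2 * j)%N by lia.
have -> : (2 ^ p)%:R = (2 ^ j)%:R * (2 ^ (p - j))%:R :> R by rewrite -natrM -expnD subnKC//; lia.
have := (fn0 p, fn0 j, fn0 (p - j)%N, fn0 l, fn0 m, (fn0 (2 * j)%N, fn0 (m - 2 * j)%N, fn0 (2 * p)%N, fn0 (2 * (p - j))%N), (tn0 j, tn0 (p - j)%N)).
move: (p`!%:R : R) (j`!%:R : R) ((p - j)`!%:R : R) (l`!%:R : R) (m`!%:R : R) ((2 * j)`!%:R : R) ((m - 2 * j)`!%:R : R)
  ((2 * p)`!%:R : R) ((2 * (p - j))`!%:R : R) ((2 ^ j)%:R : R) ((2 ^ (p - j))%:R : R).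
move=> x1 x2 x3 x4 x5 x6 x7 x8 x9 y1 y2 [[[[[[h1 h2] h3] h4] h5] [[[h6 h7] h8] h9]] [g1 g2]].
by field; rewrite h1 h2 h3 h4 h5 h6 h7 g1 g2.
Qed.

(* Tangent-normal decomposition along [mu]. *)
Lemma mixedE v m l : mixed v m l = omega R d *
  \sum_(j < m./2.+1) 'C(m, 2 * j)%:R * theta d j * vdot v ^+ (m - 2 * j) * (vsq v - vdot v ^+ 2) ^+ j *
     marginal d ('X^(m - 2 * j + l) * weight_poly j).
Proof.
set a := vdot v; set b := vsq v - a ^+ 2.
have lM : (l <= m + l)%N by lia.
have mlE : (m + l - l = m)%N by lia.
have bn0 : 'C(m + l, l)%:R != 0 :> R by rewrite pnatr_eq0 -lt0n bin_gt0.
have gen := mixed_generating v (m + l).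
case: (boolP (odd (m + l))) => oml.
  have : \poly_(l' < (m + l).+1) ('C(m + l, l')%:R * mixed v (m + l - l') l') = 0 :> {poly R}.
    apply: eq_poly_fun => z; rewrite horner_poly gen /sphere_cst oml mulr0 mul0r horner0.
    by [].
  move/(congr1 (fun P : {poly R} => P`_l)); rewrite coef_poly ltnS lM coef0 mlE => /eqP.
  rewrite mulf_eq0 (negbTE bn0) /= => /eqP ->.
  rewrite big1 ?mulr0// => j _; rewrite marginal_weight//.
  have jm : (2 * j <= m)%N by have := ltn_ord j; lia.
  have -> : odd (m - 2 * j + l) = odd (m + l).
    by rewrite !oddD oddB// mul2n odd_double addbF.
  by rewrite oml mulr0.
have [p pE] : exists p, (m + l = 2 * p)%N by exists ((m + l)%N./2); rewrite mul2n even_halfK.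
(* Equality for all real z is equality of polynomials, so the coefficient of z^l can be
   extracted. *)
have : \poly_(l' < (m + l).+1) ('C(m + l, l')%:R * mixed v (m + l - l') l') =
   \poly_(l' < (m + l).+1) (omega R d * sphere_cst d (m + l) *
     \sum_(j < p.+1) ('C(p, j)%:R * 'C(2 * (p - j), l')%:R * a ^+ (2 * (p - j) - l') * b ^+ j)) :> {poly R}.
  apply: eq_poly_fun => z; rewrite !horner_poly gen.
  have -> : (m + l)./2 = p by rewrite pE mul2n doubleK.
  have -> : vsq v + 2 * z * vdot v + z ^+ 2 = (a + z) ^+ 2 + b by rewrite /b -/a; ring.
  rewrite expand_generating mulr_sumr pE; apply: eq_bigr => i _.
  by rewrite mulrA.
move/(congr1 (fun P : {poly R} => P`_l)); rewrite !coef_poly ltnS lM mlE => H.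
apply: (mulfI bn0); rewrite H -mulrA [RHS]mulrCA; congr (_ * _).
rewrite /sphere_cst (negbTE oml) mulr_sumr.
have -> : (m + l)./2 = p by rewrite pE mul2n doubleK.
have mp : (m./2.+1 <= p.+1)%N by lia.
rewrite mulr_sumr (big_ord_widen _ (fun j => 'C(m + l, l)%:R * ('C(m, 2 * j)%:R * theta d j * a ^+ (m - 2 * j) * b ^+ j *
     marginal d ('X^(m - 2 * j + l) * weight_poly j))) mp) [RHS]big_mkcond.
apply: eq_bigr => j _; case: ltnP => hj; last first.
  (* A term with j > m/2 has degree 2(p-j) < l in z and does not contribute. *)
  have hl : (2 * (p - j) < l)%N by have := ltn_ord j; lia.
  by rewrite (bin_small hl) mulr0 !mul0r mulr0.
have jm : (2 * j <= m)%N by lia.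
have nE : (m - 2 * j + l = 2 * (p - j))%N by lia.
rewrite marginal_weight// nE mul2n odd_double doubleK -mul2n.
have -> : (2 * (p - j) - l = m - 2 * j)%N by lia.
have -> : (p - j + j = p)%N by lia.
rewrite /theta pE.
have E0 := natprod_neq0 (R := R) d p.
have D0 := prod_d_neq0 (R := R) d d_gt0 j.
have bd := bin_dfact p l m j _ jm; rewrite addnC in bd.
move: (bd pE) E0 D0 => {bd}.
move: (\prod_(0 <= r < p) _) (\prod_(0 <= r < j) _) ((dfact (2 * p).-1)%:R : R) ('C(p, j)%:R : R) ('C(2 * (p - j), l)%:R : R)
  ('C(2 * p, l)%:R : R) ('C(m, 2 * j)%:R : R) ((dfact (2 * j).-1)%:R : R) ((dfact (2 * (p - j)).-1)%:R : R) (a ^+ _) (b ^+ _).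
move=> E D f1 c1 c2 c3 c4 f2 f3 x y bd E0 D0.
transitivity (f1 * c1 * c2 * (x * y / E)); first by ring.
by rewrite bd; field; rewrite E0 D0.
Qed.

Definition zonal v m P : R := \sum_(j < m./2.+1) 'C(m, 2 * j)%:R * theta d j *
  vdot v ^+ (m - 2 * j) * (vsq v - vdot v ^+ 2) ^+ j * marginal d ('X^(m - 2 * j) * weight_poly j * P).

Lemma sphere_int_zonal v m P :
  sphere_int R d (fun x => dotn d.+1 x (natvec v) ^+ m * P.[dotn d.+1 x (natvec mu)]) =
  omega R d * zonal v m P.
Proof.
have -> : (fun x => dotn d.+1 x (natvec v) ^+ m * P.[dotn d.+1 x (natvec mu)]) =
   (fun x => \sum_(l < size P) P`_l * (dotn d.+1 x (natvec v) ^+ m * dotn d.+1 x (natvec mu) ^+ l)).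
  by apply/funext => x; rewrite horner_coef mulr_sumr; apply: eq_bigr => l _; rewrite mulrCA.
have [_ ->] := @sphere_int_sum R d _ (index_enum 'I_(size P)) (fun l : 'I_(size P) => P`_l)
  (fun l : 'I_(size P) => fun x => dotn d.+1 x (natvec v) ^+ m * dotn d.+1 x (natvec mu) ^+ l)
  (fun l : 'I_(size P) => sphere_mixed_integrable v m l).
under eq_bigr do rewrite -/(mixed v m _) mixedE mulrCA.
rewrite -mulr_sumr; congr (_ * _).
under eq_bigr do rewrite mulr_sumr.
rewrite exchange_big; apply: eq_bigr => j _ /=.
have -> : 'X^(m - 2 * j) * weight_poly j * P =
    \sum_(l < size P) P`_l *: ('X^(m - 2 * j + l) * weight_poly j).
  rewrite -[in LHS](coefK P) poly_def mulr_sumr; apply: eq_bigr => l _.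
  by rewrite -scalerAr exprD; congr (_ *: _); ring.
rewrite marginal_sum mulr_sumr; apply: eq_bigr => l _.
by rewrite marginalZ; ring.
Qed.

Lemma teval_zonal v m P :
  teval d m (fun s : seq 'I_d.+1 => sphere_int R d (fun x => (\prod_(i <- s) x i) * P.[dotn d.+1 x (natvec mu)])) v =
  omega R d * zonal v m P.
Proof.
rewrite -sphere_int_zonal /teval.
have int1 (s : seq 'I_d.+1) : sphere_integrable d (fun x => (\prod_(i <- s) x i) * P.[dotn d.+1 x (natvec mu)]).
  have -> : (fun x => (\prod_(i <- s) x i) * P.[dotn d.+1 x (natvec mu)]) =
    (fun x => \sum_(l < size P) P`_l * (\prod_(i <- s) x i * (dotn d.+1 x (natvec v) ^+ 0 * dotn d.+1 x (natvec mu) ^+ l))).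
    apply/funext => x; rewrite horner_coef mulr_sumr; apply: eq_bigr => l _.
    by rewrite expr0 mul1r mulrCA.
  by apply: (sphere_int_sum _ _ _ _ _ _).1 => l; exact: sphere_integrable_monomial.
have [_ E] := @sphere_int_sum R d _ (index_enum (m.-tuple 'I_d.+1)) (fun s : m.-tuple 'I_d.+1 => \prod_(i <- s) v i)
  (fun s : m.-tuple 'I_d.+1 => fun x => (\prod_(i <- s) x i) * P.[dotn d.+1 x (natvec mu)])
  (fun s : m.-tuple 'I_d.+1 => int1 s).
under eq_bigr do rewrite mulrC.
rewrite -E; congr (sphere_int R d _); apply/funext => x.
rewrite (dotn_natvec x v) -(teval_monomial d m x v) /teval mulr_suml.
by apply: eq_bigr => s _; ring.
Qed.

Lemma zonal_lin v m (c : R) (P Q : {poly R}) : zonal v m (P + c *: Q) = zonal v m P + c * zonal v m Q.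
Proof.
rewrite /zonal mulr_sumr -big_split; apply: eq_bigr => j _ /=.
by rewrite [_ * (P + _)]mulrDr -[_ * (c *: Q)]scalerAr marginalD marginalZ; ring.
Qed.

Lemma omega_neq0 : omega R d != 0.
Proof.
rewrite /omega mulf_neq0 ?invr_neq0 ?gt_eqF ?Gamma_half_gt0// mulr_gt0// powR_gt0//.
exact: pi_gt0.
Qed.

(** The integral of (x.v)^m is evaluated in two ways, by [sphere_int_zonal] and directly by
    [sphere_ridge]; the sum over j is never computed. *)
Lemma zonal1 v m : zonal v m 1 = sphere_cst d m * vsq v ^+ m./2.
Proof.
apply: (mulfI omega_neq0); rewrite -sphere_int_zonal mulrA.
under [fun x => _]eq_fun do rewrite hornerC mulr1.
have [_ ->] := sphere_ridge d (natvec v) m; congr (_ * _ ^+ _).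
by rewrite /sqnorm /natvec; apply: eq_bigr => i _; rewrite inord_val.
Qed.

Lemma teval_moment_ck v m k rho :
  teval d m (moment R d (ck_density R d k mu rho)) v =
  sphere_cst d m * vsq v ^+ m./2 + rho * zonal v m (ngeg_poly d k).
Proof.
pose P : {poly R} := (omega R d)^-1 *: (1 + rho *: ngeg_poly d k).
have -> : moment R d (ck_density R d k mu rho) =
    (fun s : seq 'I_d.+1 => sphere_int R d (fun x => (\prod_(i <- s) x i) * P.[dotn d.+1 x (natvec mu)])).
  apply/funext => s; rewrite /moment; congr (sphere_int R d _); apply/funext => x; congr (_ * _).
  rewrite /ck_density /P hornerZ hornerD hornerZ hornerC horner_ngeg_poly// -Cgn_ngeg//.
  by rewrite /dotp dotn_natvec.
rewrite teval_zonal -[P]add0r zonal_lin zonal_lin zonal1.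
have -> : zonal v m 0 = 0 by rewrite /zonal big1// => j _; rewrite mulr0 /marginal size_poly0 big_ord0 mulr0.
by rewrite add0r mulrA divff ?omega_neq0// mul1r.
Qed.

Lemma teval_moment_unif v m :
  teval d m (moment R d (unif_density R d)) v = sphere_cst d m * vsq v ^+ m./2.
Proof.
have := teval_moment_ck v m 0 0; rewrite mul0r addr0 => <-.
congr (teval d m _ v); apply/funext => s; rewrite /moment; congr (sphere_int R d _).
by apply/funext => x; rewrite /ck_density mul0r addr0 mulr1.
Qed.

Lemma teval_mu_unif v m : teval d m (mu_unif R d m) v = sphere_cst d m * vsq v ^+ m./2.
Proof.
rewrite /mu_unif /sphere_cst; case: (boolP (odd m)) => om.
  by rewrite mul0r /teval big1// => s _; rewrite mul0r.
have mE : m = (2 * m./2)%N by rewrite mul2n even_halfK.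
by rewrite tevalZ teval_tsym [in teval d m](mE) teval_tpow teval_vecI.
Qed.

Lemma teval_muv v n : teval d n (tpow R d 1 (tvec R d mu) n) v = vdot v ^+ n.
Proof. by have := teval_tpow d 1 (tvec R d mu) n v; rewrite mul1n teval_tvec. Qed.

Lemma tensor_eq m (T A : tensor R d) :
  (forall (sg : 'S_m) (s : m.-tuple 'I_d.+1), T (permute_seq d sg s) = T s) ->
  (forall (sg : 'S_m) (s : m.-tuple 'I_d.+1), A (permute_seq d sg s) = A s) ->
  (forall v, teval d m T v = teval d m A v) -> forall s : seq 'I_d.+1, size s = m -> T s = A s.
Proof.
move=> sT sA TA s /eqP sm; apply/eqP; rewrite -subr_eq0; apply/eqP.
have H := symmetric_teval_eq0 d m (fun s : seq 'I_d.+1 => T s - A s).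
apply: (H _ _ (Tuple sm)) => [sg s'|v]; first by rewrite sT sA.
by rewrite tevalB TA subrr.
Qed.

Lemma moment_permute m dens (sg : 'S_m) (s : m.-tuple 'I_d.+1) :
  moment R d dens (permute_seq d sg s) = moment R d dens s.
Proof.
rewrite /moment; congr (sphere_int R d _); apply/funext => x; congr (_ * _).
by rewrite permute_seqE prod_permute.
Qed.

Lemma mu_unif_permute m (sg : 'S_m) (s : m.-tuple 'I_d.+1) :
  mu_unif R d m (permute_seq d sg s) = mu_unif R d m s.
Proof. by rewrite /mu_unif tsym_permute. Qed.

Lemma zonal_ngeg_low v m k : (m < k)%N -> zonal v m (ngeg_poly d k) = 0.
Proof.
move=> mk; rewrite /zonal big1// => j _; rewrite marginal_low ?mulr0//.
by have := ltn_ord j; lia.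
Qed.

Lemma zonal_ngeg_parity v m k : odd (m + k) -> zonal v m (ngeg_poly d k) = 0.
Proof.
move=> omk; rewrite /zonal big1// => j _; rewrite marginal_parity ?mulr0//.
have jm : (2 * j <= m)%N by have := ltn_ord j; lia.
by rewrite oddD oddB// mul2n odd_double addbF -oddD.
Qed.

(** In degree m = k all the marginal factors equal (-1)^j times one constant, so the sum over j is
    Laplace's expansion of [ngeg]. *)
Lemma zonal_ngeg_top v k : zonal v k (ngeg_poly d k) =
  (k`!)%:R / \prod_(0 <= r < k) (d.+1 + 2 * r)%:R * ngeg d k (vdot v) (vsq v).
Proof.
have -> : ngeg d k (vdot v) (vsq v) = homsum k (laplace_coef d k) k./2.+1 (vdot v) (vsq v - vdot v ^+ 2).
  by rewrite -ngeg_laplace// subrKC.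
rewrite /homsum mulr_sumr; apply: eq_bigr => j _.
rewrite (marginal_top d d_gt0 k); last by have := ltn_ord j; lia.
by rewrite /laplace_coef; ring.
Qed.

End SphereMoments.

(** * Closed forms *)

Section JacobiMoments.
Context {R : realType} (d : nat).
Hypothesis d_gt0 : (0 < d)%N.
Local Notation lmu := (@lebesgue_measure R).
Implicit Types (k m n p q j s l : nat) (t : R).

(** The weight (1-t^2)^(d/2-1+j) of [fjmk], extended by 0 outside ]-1, 1[. *)
Definition jacobi_weight j t : R := pospow ((d + 2 * j)%:R / 2) (1 - t ^+ 2).

Lemma jacobi_moment q j :
  lmu.-integrable [set: R] (fun t : R => (t ^+ (2 * q) * jacobi_weight j t)%:E) /\
  Rintegral lmu setT (fun t => t ^+ (2 * q) * jacobi_weight j t) =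
    Gamma R ((2 * q).+1%:R / 2) * Gamma R ((d + 2 * j)%:R / 2) / Gamma R ((2 * q + d + 2 * j).+1%:R / 2).
Proof.
pose h (u : R) := (pospow ((d + 2 * j)%:R / 2) (1 - u))%:E.
have hI : (\int[lmu]_u ((pospow ((2 * q).+1%:R / 2) u)%:E * h u) =
    (Gamma R ((2 * q).+1%:R / 2) * Gamma R ((d + 2 * j)%:R / 2) / Gamma R ((2 * q + d + 2 * j).+1%:R / 2))%:E)%E.
  transitivity (ebeta ((2 * q).+1%:R / 2) ((d + 2 * j)%:R / 2) : \bar R).
    by rewrite /ebeta; apply: eq_integral => u _; rewrite EFinM.
  have dE : (d + 2 * j = (d.-1 + 2 * j).+1)%N by lia.
  rewrite [in LHS]dE ebeta_half -dE; congr (_ / _)%:E; congr (Gamma R (_%:R / 2)); lia.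
have [||||I1 I2] := @Rintegral_exprn_sqr R (2 * q) h.
- by apply/measurable_EFinP; exact: measurable_pospow_subl.
- by move=> u; rewrite lee_fin pospow_ge0.
- by move=> u _; rewrite ltry.
- by rewrite hI ltry.
split; first exact: I1.
by move: I2; rewrite mul2n odd_double -mul2n hI.
Qed.

(** One coordinate of U has density (1-t^2)^(d/2-1) times omega_(d-1)/omega_d on ]-1, 1[; this is
    the origin of that quotient in the general formula. Here it is checked on moments, by comparing
    constants. *)
Lemma jacobi_marginal q j : Gamma R ((2 * q).+1%:R / 2) * Gamma R ((d + 2 * j)%:R / 2) /
    Gamma R ((2 * q + d + 2 * j).+1%:R / 2) * (omega R d.-1 / omega R d) =
  marginal d ('X^(2 * q) * weight_poly j).
Proof.
rewrite marginal_weight// mul2n odd_double doubleK -mul2n.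
have dE : d = d.-1.+1 by lia.
have -> : (d + 2 * j = 2 * j + d.-1.+1)%N by lia.
have -> : ((2 * q + d + 2 * j).+1 = 2 * (q + j) + d.+1)%N by lia.
rewrite Gamma_half_dfact !Gamma_half_prod -dE.
have -> : \prod_(0 <= r < j) (d + 2 * r)%:R = \prod_(0 <= r < j) (d.-1.+1 + 2 * r)%:R :> R by rewrite -dE.
have -> : (2 ^ (q + j))%:R = (2 ^ q)%:R * (2 ^ j)%:R :> R by rewrite -natrM expnD.
rewrite /omega -dE.
have g1 : Gamma R (d%:R / 2) != 0 by rewrite dE gt_eqF ?Gamma_half_gt0.
have g2 : Gamma R (d.+1%:R / 2) != 0 by rewrite gt_eqF ?Gamma_half_gt0.
have p1 : pi `^ (d%:R / 2) != 0 :> R by rewrite gt_eqF// powR_gt0// pi_gt0.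
have p2 : pi `^ (d.+1%:R / 2) = pi `^ (d%:R / 2) * Num.sqrt pi :> R.
  by rewrite -!sqrtrX_powR ?pi_ge0// exprSr.
have p3 : Num.sqrt pi != 0 :> R by rewrite gt_eqF// sqrtr_gt0 pi_gt0.
rewrite p2.
have E0 := natprod_neq0 (R := R) d (q + j).
have t1 n : (2 ^ n)%:R != 0 :> R by rewrite pnatr_eq0 -lt0n expn_gt0.
have aux (f sp tq tj D G1 G2 E P : R) : sp != 0 -> tq != 0 -> tj != 0 -> G1 != 0 -> G2 != 0 -> E != 0 -> P != 0 ->
   f * sp / tq * (D / tj * G1) / (E / (tq * tj) * G2) * (2 * P / G1 / (2 * (P * sp) / G2)) = f * D / E.
  by move=> h1 h2 h3 h4 h5 h6 h7; field; rewrite h1 h2 h3 h4 h5 h6 h7.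
exact: aux.
Qed.

Lemma fjmk_sum j m k : (0 < k)%N -> ~~ odd (m + k) -> (2 * j <= m)%N ->
  fjmk R d j m k = gkd R k d * \sum_(s < k./2.+1) geg_coef d k s *
    (Gamma R ((m + k - 2 * j - 2 * s).+1%:R / 2) * Gamma R ((d + 2 * j)%:R / 2) /
      Gamma R ((m + k - 2 * s + d).+1%:R / 2)).
Proof.
move=> k0 omk jm.
pose F (s : 'I_k./2.+1) t := (gkd R k d * geg_coef d k s) * (t ^+ (m + k - 2 * j - 2 * s) * jacobi_weight j t).
have qE (s : 'I_k./2.+1) : exists q, (m + k - 2 * j - 2 * s = 2 * q)%N.
  exists ((m + k)./2 - j - s)%N; have : (m + k = 2 * (m + k)./2)%N by rewrite mul2n even_halfK.
  lia.
have FP (s : 'I_k./2.+1) : lmu.-integrable [set: R] (fun t : R => (F s t)%:E) /\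
   Rintegral lmu setT (F s) = gkd R k d * geg_coef d k s * (Gamma R ((m + k - 2 * j - 2 * s).+1%:R / 2) * Gamma R ((d + 2 * j)%:R / 2) /
      Gamma R ((m + k - 2 * s + d).+1%:R / 2)).
  have hs := ltn_ord s.
  have [q qq] := qE s; have [J1 J2] := jacobi_moment q j.
  rewrite /F qq; split.
    have := integrableZl measurableT (gkd R k d * geg_coef d k s) J1.
    by apply: eq_integrable => // t _; rewrite EFinM.
  rewrite RintegralZl// J2; congr (_ * (_ / Gamma R (_%:R / 2))); lia.
have [S1 S2] := @Rintegral_sum R _ (index_enum 'I_k./2.+1) F (fun s : 'I_k./2.+1 => (FP s).1).
rewrite mulr_sumr; under [RHS]eq_bigr do rewrite mulrA -(FP _).2.
rewrite -S2 /fjmk /Rintegral; congr fine.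
have CE t : t ^+ (m - 2 * j) * Cg R d k t * jacobi_weight j t = \sum_(s < k./2.+1) F s t.
  rewrite Cg_homsum// mulr_sumr mulr_sumr mulr_suml; apply: eq_bigr => s _; rewrite /F.
  have hs := ltn_ord s.
  have -> : (m + k - 2 * j - 2 * s = (m - 2 * j) + (k - 2 * s))%N by lia.
  by rewrite exprD; ring.
have IE (t : R) : -1 < t < 1 -> jacobi_weight j t = (1 - t ^+ 2) `^ (d%:R / 2 - 1 + j%:R).
  move=> /andP[t1 t2]; have t0 : 0 < 1 - t ^+ 2.
    have -> : 1 - t ^+ 2 = (1 - t) * (t - -1) by ring.
    by rewrite mulr_gt0 ?subr_gt0.
  rewrite /jacobi_weight pospowE t0; congr (_ `^ _).
  by rewrite natrD natrM; field.
have JE (t : R) : ~~ (-1 < t < 1) -> jacobi_weight j t = 0.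
  move=> ht; rewrite /jacobi_weight pospowE ifF//; apply/negbTE; rewrite -leNgt.
  have -> : 1 - t ^+ 2 = (1 - t) * (t - -1) by ring.
  have [t1|t1] := ltP (-1) t; have [t2|t2] := ltP t 1.
  - by rewrite t1 t2 in ht.
  - by rewrite pmulr_lle0 ?subr_gt0// subr_le0.
  - by rewrite pmulr_rle0 ?subr_gt0//; lra.
  - lra.
have mS : measurable_fun [set: R] (fun t : R => (\sum_(s < k./2.+1) F s t)%:E).
  by apply: measurable_int S1.
(* The endpoints are dropped because the weights may differ there: for d = 2 and j = 0 the power is
   1 at t = 1, while [jacobi_weight] is 0. *)
have -> : (\int[lmu]_(t in `[(-1)%R, 1%R]) (t ^+ (m - 2 * j) * (1 - t ^+ 2) `^ (d%:R / 2 - 1 + j%:R) * Cg R d k t)%:E =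
    \int[lmu]_(t in `](-1)%R, 1%R[) (t ^+ (m - 2 * j) * (1 - t ^+ 2) `^ (d%:R / 2 - 1 + j%:R) * Cg R d k t)%:E)%E.
  apply: integral_itv_bndoo.
  apply: (eq_measurable_fun (fun t : R => (\sum_(s < k./2.+1) F s t)%:E)).
    by move=> t; rewrite inE/= in_itv/= => ht; rewrite -CE IE// mulrAC.
  exact: measurable_funTS.
rewrite [LHS]integral_mkcond; apply: eq_integral => t _; rewrite patchE mem_setE in_itv/= -CE.
case: ifPn => ht; first by rewrite IE// mulrAC.
by rewrite JE// mulr0.
Qed.

Lemma fjmk_marginal j m k : (0 < k)%N -> ~~ odd (m + k) -> (2 * j <= m)%N ->
  fjmk R d j m k / Cg R d k 1 * (omega R d.-1 / omega R d) =
  marginal d ('X^(m - 2 * j) * weight_poly j * ngeg_poly d k).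
Proof.
move=> k0 omk jm.
have r0 : Cg R d k 1 != 0 by exact: Cg1_neq0.
have QE : ngeg_poly d k = \sum_(s < k./2.+1) ((Cg R d k 1)^-1 * gkd R k d * geg_coef d k s) *: 'X^(k - 2 * s) :> {poly R}.
  apply: eq_poly_fun => t; rewrite horner_ngeg_poly// horner_sum.
  apply: (mulfI r0); rewrite -CgE// Cg_homsum// mulr_sumr mulr_sumr; apply: eq_bigr => s _.
  by rewrite hornerZ hornerXn !mulrA divff// mul1r.
rewrite fjmk_sum// QE [X in marginal d X]mulr_sumr marginal_sum !mulr_sumr !mulr_suml; apply: eq_bigr => s _.
have hs := ltn_ord s.
have [q qq] : exists q, (m + k - 2 * j - 2 * s = 2 * q)%N.
  exists ((m + k)./2 - j - s)%N; have : (m + k = 2 * (m + k)./2)%N by rewrite mul2n even_halfK.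
  lia.
have -> : 'X^(m - 2 * j) * weight_poly j * (((Cg R d k 1)^-1 * gkd R k d * geg_coef d k s) *: 'X^(k - 2 * s)) =
    ((Cg R d k 1)^-1 * gkd R k d * geg_coef d k s) *: ('X^(2 * q) * weight_poly j) :> {poly R}.
  rewrite -scalerAr; congr (_ *: _).
  have -> : (2 * q = (m - 2 * j) + (k - 2 * s))%N by lia.
  by rewrite exprD; ring.
rewrite marginalZ -jacobi_marginal qq.
have -> : ((m + k - 2 * s + d).+1 = (2 * q + d + 2 * j).+1)%N by lia.
by ring.
Qed.

Lemma fjmk_closed j m k : (0 < k)%N -> ~~ odd (m + k) -> (j <= m./2)%N ->
  fjmk R d j m k = Gamma R (d%:R / 2 + j%:R) * gkd R k d *
       \sum_(s < k./2.+1) (-1) ^+ s * (2 ^ (k - 2 * s))%:R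
          * Gamma R ((d%:R - 1) / 2 + k%:R - s%:R) / ((s`!)%:R * ((k - 2 * s)`!)%:R)
          * Gamma R ((m + k).+1%:R / 2 - j%:R - s%:R)
          / Gamma R ((d + k + m).+1%:R / 2 - s%:R).
Proof.
move=> k0 omk jm; have jm' : (2 * j <= m)%N by lia.
rewrite fjmk_sum// -mulrA mulrCA; congr (_ * _); rewrite mulr_sumr; apply: eq_bigr => s _.
have hs := ltn_ord s.
have sk : (2 * s <= k)%N by lia.
rewrite /geg_coef sk /Gam.
have -> : (d%:R - 1) / 2 + k%:R - s%:R = (d.-1 + 2 * (k - s))%:R / 2 :> R.
  have -> : d%:R = d.-1%:R + 1 :> R by rewrite natr1; congr (_%:R); lia.
  by rewrite natrD natrM natrB; [field|lia].
have -> : (m + k).+1%:R / 2 - j%:R - s%:R = (m + k - 2 * j - 2 * s).+1%:R / 2 :> R.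
  have -> : (m + k).+1%:R = (m + k - 2 * j - 2 * s).+1%:R + 2 * j%:R + 2 * s%:R :> R.
    by rewrite -!natrM -!natrD; congr (_%:R); lia.
  by field.
have -> : (d + k + m).+1%:R / 2 - s%:R = (m + k - 2 * s + d).+1%:R / 2 :> R.
  have -> : (d + k + m).+1%:R = (m + k - 2 * s + d).+1%:R + 2 * s%:R :> R.
    by rewrite -!natrM -!natrD; congr (_%:R); lia.
  by field.
have -> : d%:R / 2 + j%:R = (d + 2 * j)%:R / 2 :> R by rewrite natrD natrM; field.
by ring.
Qed.

End JacobiMoments.

(** * The coefficients [akj] and the constant [dkd] *)

Section TopCoefficient.
Context {R : realType} (d : nat).
Hypothesis d_gt0 : (0 < d)%N.

Lemma Gam_prod k j : (j < k)%N -> Gam d k =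
  (\prod_(1 <= r < j.+1) (2 * (k - r) + (d - 1))%:R) / (2 ^ j)%:R * Gam d (k - j) :> R.
Proof.
elim: j => [|j IH] jk; first by rewrite big_geq// expn0 divr1 mul1r subn0.
have t0 : (2 ^ j)%:R != 0 :> R by rewrite pnatr_eq0 -lt0n expn_gt0.
rewrite big_nat_recr//= IH ?(ltnW jk)//.
have -> : (k - j = (k - j.+1).+1)%N by lia.
rewrite GamS; [|exact: d_gt0|lia].
have -> : (d.-1 + 2 * (k - j.+1) = 2 * (k - j.+1) + (d - 1))%N by lia.
rewrite expnS natrM.
have aux (P t x G : R) : t != 0 -> P / t * (x / 2 * G) = P * x / (2 * t) * G by move=> t0'; field; rewrite t0'.
exact: aux.
Qed.

(** The numbers [akj] are the coefficients of C_k divided by the leading one; their product in the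
    denominator comes from j uses of the functional equation of Gamma. *)
Lemma geg_coef_akj k j : (0 < k)%N -> (2 * j <= k)%N -> geg_coef d k j = geg_coef d k 0 * akj R d k j.
Proof.
move=> k0 jk; rewrite /geg_coef jk /= muln0 ?leq0n !subn0 expr0 !mul1r ?fact0 ?mul1r /akj.
rewrite (Gam_prod k j); last by lia.
have fn0 n : (n`!)%:R != 0 :> R by rewrite pnatr_eq0 -lt0n fact_gt0.
have t0 n : (2 ^ n)%:R != 0 :> R by rewrite pnatr_eq0 -lt0n expn_gt0.
have P0 : (\prod_(1 <= r < j.+1) (2 * (k - r) + (d - 1))%:R : R) != 0.
  rewrite prodf_seq_neq0; apply/allP => r; rewrite mem_index_iota => /andP[r1 r2] /=.
  rewrite pnatr_eq0; lia.
have -> : (2 ^ k)%:R = (2 ^ (k - 2 * j))%:R * ((2 ^ j)%:R * (2 ^ j)%:R) :> R.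
  by rewrite -!natrM -!expnD; congr (_%:R); congr (2 ^ _)%N; lia.
have aux (s t t2 G fj fkj fk P : R) : t2 != 0 -> fj != 0 -> fkj != 0 -> fk != 0 -> P != 0 ->
   s * t * G / (fj * fkj) = t * (t2 * t2) * (P / t2 * G) / fk * (s * fk / (t2 * fkj * fj) / P).
  by move=> h1 h2 h3 h4 h5; field; rewrite h1 h2 h3 h4 h5.
exact: aux.
Qed.

(** By orthogonality the left-hand side, the leading coefficient of the normalized polynomial times
    its moment against X^k, is the squared norm of that polynomial under the law of one coordinate.
    Its inverse is the dimension of the spherical harmonics of degree k. *)
Lemma dkd_inv k : (0 < k)%N ->
  (k`!)%:R / \prod_(0 <= r < k) (d.+1 + 2 * r)%:R * geg_coef d k 0 / geg_ratio d k = (dkd R k d)^-1.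
Proof.
move=> k0.
have fn0 n : (n`!)%:R != 0 :> R by rewrite pnatr_eq0 -lt0n fact_gt0.
have t0 n : (2 ^ n)%:R != 0 :> R by rewrite pnatr_eq0 -lt0n expn_gt0.
have G0 : Gamma R (d.+1%:R / 2) != 0 by rewrite gt_eqF ?Gamma_half_gt0.
pose Pi : R := \prod_(1 <= i < k) (i + d.-1)%:R.
have Pi0 : Pi != 0.
  rewrite prodf_seq_neq0; apply/allP => r; rewrite mem_index_iota => /andP[r1 r2] /=.
  rewrite pnatr_eq0; lia.
have L : (k`!)%:R / \prod_(0 <= r < k) (d.+1 + 2 * r)%:R * geg_coef d k 0 / geg_ratio d k =
    (k`!)%:R / ((2 * k + d.-1)%:R * Pi).
  rewrite /geg_coef /= muln0 ?leq0n !subn0 expr0 !mul1r ?fact0 ?mul1r /geg_ratio -/Pi.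
  have -> : Gam d k = (\prod_(0 <= r < k.-1) (d.+1 + 2 * r)%:R) / (2 ^ k.-1)%:R * Gamma R (d.+1%:R / 2) :> R.
    by rewrite -Gamma_half_prod /Gam; congr (Gamma R (_%:R / 2)); lia.
  have -> : \prod_(0 <= r < k) (d.+1 + 2 * r)%:R = (\prod_(0 <= r < k.-1) (d.+1 + 2 * r)%:R) * (2 * k + d.-1)%:R :> R.
    by rewrite -[in LHS](prednK k0) big_nat_recr//=; congr (_ * _%:R); lia.
  have -> : (2 ^ k)%:R = 2 * (2 ^ k.-1)%:R :> R by rewrite -natrM -expnS prednK.
  have E0 := natprod_neq0 (R := R) d k.-1.
  have x0 : (2 * k + d.-1)%:R != 0 :> R by rewrite pnatr_eq0; lia.
  have aux (f E x t G P : R) : f != 0 -> E != 0 -> x != 0 -> t != 0 -> G != 0 -> P != 0 ->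
    f / (E * x) * (2 * t * (E / t * G) / f) / (2 * G * P / f) = f / (x * P).
    by move=> h1 h2 h3 h4 h5 h6; field; rewrite h1 h2 h3 h4 h5 h6.
  exact: aux.
rewrite L /dkd; case: (eqVneq d 1%N) => [d1|d1].
  have kfE : (k`! = k * \prod_(1 <= i < k) i)%N.
    by rewrite -[in LHS](prednK k0) factS prednK// fact_prod prednK.
  have PE : Pi = (\prod_(1 <= i < k) i)%:R.
    by rewrite /Pi natr_prod; apply: eq_bigr => i _; rewrite d1 addn0.
  have k0' : k%:R != 0 :> R by rewrite pnatr_eq0 -lt0n.
  rewrite kfE natrM -PE d1 addn0 natrM (gtn_eqF k0) subr0.
  by field; rewrite k0' Pi0.
have d2 : (0 < d.-1)%N by case: d d_gt0 d1 => // -[].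
have dE : d%:R - 1 = d.-1%:R :> R by rewrite -[in LHS](prednK d_gt0) -natr1 addrK.
have GE : Gamma R (d%:R - 1 + k%:R) = d.-1%:R * Pi * Gamma R (d%:R - 1).
  rewrite dE -natrD.
  (* The integer argument is written as a half-integer with a successor numerator, so that
     [Gamma_half_prod] applies. *)
  have -> : (d.-1 + k)%:R = (2 * k + (2 * d.-1).-1.+1)%:R / 2 :> R.
    have -> : (2 * k + (2 * d.-1).-1.+1)%:R = (d.-1 + k)%:R * 2 :> R by rewrite -natrM; congr (_%:R); lia.
    by rewrite mulfK.
  rewrite Gamma_half_prod.
  have -> : (2 * d.-1).-1.+1%:R / 2 = d.-1%:R :> R.
    have -> : (2 * d.-1).-1.+1%:R = d.-1%:R * 2 :> R by rewrite -natrM; congr (_%:R); lia.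
    by rewrite mulfK.
  congr (_ * _).
  have H n : \prod_(0 <= r < n) ((2 * d.-1).-1.+1 + 2 * r)%:R / (2 ^ n)%:R = \prod_(0 <= r < n) (r + d.-1)%:R :> R.
    elim: n => [|n IH]; first by rewrite !big_nil expn0 divr1.
    rewrite !big_nat_recr//= -IH expnS natrM.
    have -> : ((2 * d.-1).-1.+1 + 2 * n)%:R = 2 * (n + d.-1)%:R :> R by rewrite -natrM; congr (_%:R); lia.
    by have h := t0 n; field.
  rewrite H /Pi -(prednK k0) big_nat_recl// add0n; congr (_ * _).
  by rewrite big_add1.
have g0 : Gamma R (d%:R - 1) != 0.
  have -> : d%:R - 1 = (2 * d.-1).-1.+1%:R / 2 :> R.
    rewrite dE; have -> : (2 * d.-1).-1.+1%:R = d.-1%:R * 2 :> R by rewrite -natrM; congr (_%:R); lia.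
    by rewrite mulfK.
  by rewrite gt_eqF ?Gamma_half_gt0.
have d0 : d.-1%:R != 0 :> R by rewrite pnatr_eq0 -lt0n.
rewrite GE dE; rewrite dE in g0.
have -> : (2 * k + d.-1)%:R = 2 * k%:R + d.-1%:R :> R by rewrite natrD natrM.
have x0 : 2 * k%:R + d.-1%:R != 0 :> R by rewrite -natrM -natrD pnatr_eq0; lia.
have aux (x D P G f : R) : 2 * x + D != 0 -> D != 0 -> P != 0 -> G != 0 -> f != 0 ->
   f / ((2 * x + D) * P) = ((1 + 2 * x / D) * (D * P * G) / (G * f))^-1.
  move=> h1 h2 h3 h4 h5.
  have -> : (1 + 2 * x / D) * (D * P * G) / (G * f) = (2 * x + D) * P / f by field; rewrite h2 h4 h5.
  by rewrite invf_div.
exact: aux.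
Qed.

End TopCoefficient.

(** * Comparison of the moment tensors through their polynomials *)

Theorem theorem1 (R : realType) (d k : nat) (mu : 'I_d.+1 -> R) (rho : R) (m : nat)
  (hd : (1 <= d)%N) (hk : (1 <= k)%N)
  (hmu : \sum_(i < d.+1) mu i ^+ 2 = 1) (hrho : -1 <= rho <= 1)
  (hm : (1 <= m)%N) :
  let EX := moment R d (ck_density R d k mu rho) in
  let muv := tpow R d 1 (tvec R d mu) in
  (* mu_{d+1,m} = E[U^{(x)m}] for U ~ Unif(S^d) *)
  (forall s, size s = m -> moment R d (unif_density R d) s = mu_unif R d m s) /\
  (* (i) *)
  ((m < k)%N -> forall s, size s = m -> EX s = mu_unif R d m s) /\
  (* (ii) *)
  (m = k -> forall s, size s = k ->
     EX s = mu_unif R d k s + rho / dkd R k d *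
       tsym R d k (fun s' => \sum_(j < k./2.+1)
          akj R d k j * tkron R d (2 * j) (tpow R d 2 (vecI R d) j)
                                         (muv (k - 2 * j)%N) s') s) /\
  (* (iii) *)
  ((k < m)%N -> odd (m - k) -> forall s, size s = m -> EX s = mu_unif R d m s) /\
  (* (iv) *)
  (forall s, size s = m ->
     EX s = mu_unif R d m s + rho / Cg R d k 1 * (omega R d.-1 / omega R d) *
       tsym R d m (fun s' => \sum_(j < m./2.+1)
          ejkm R d j k m * tkron R d (m - 2 * j) (muv (m - 2 * j)%N)
             (tpow R d 2 (fun s'' => vecI R d s'' - muv 2%N s'') j) s') s) /\
  (* closed form of f_{j,m,k} (for m + k even, the only case where it is used) *)
  (~~ odd (m + k) -> forall j, (j <= m./2)%N ->
     fjmk R d j m k = Gamma R (d%:R / 2 + j%:R) * gkd R k d *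
       \sum_(s < k./2.+1) (-1) ^+ s * (2 ^ (k - 2 * s))%:R
          * Gamma R ((d%:R - 1) / 2 + k%:R - s%:R) / ((s`!)%:R * ((k - 2 * s)`!)%:R)
          * Gamma R ((m + k).+1%:R / 2 - j%:R - s%:R)
          / Gamma R ((d + k + m).+1%:R / 2 - s%:R)).
Proof.
move=> EX muv.
have momP := moment_permute d.
have muP := mu_unif_permute d.
have EXE n (A : tensor R d) :
    (forall (sg : 'S_n) (s : n.-tuple 'I_d.+1), A (permute_seq d sg s) = A s) ->
    (forall v, teval d n A v =
       sphere_cst d n * vsq d v ^+ n./2 + rho * zonal d mu v n (ngeg_poly d k)) ->
    forall s : seq 'I_d.+1, size s = n -> EX s = A s.
  move=> sA AE; apply: tensor_eq => // [sg s|v]; first exact: momP.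
  by rewrite AE teval_moment_ck.
have zonal0 n : (forall v, zonal d mu v n (ngeg_poly d k) = 0) ->
    forall s : seq 'I_d.+1, size s = n -> EX s = mu_unif R d n s.
  move=> z0; apply: EXE => [|v]; first exact: muP.
  by rewrite z0 mulr0 addr0 teval_mu_unif.
have muvE v n : teval d n (muv n) v = vdot d mu v ^+ n by exact: teval_muv.
split.
  apply: tensor_eq => [sg s|sg s|v]; [exact: momP|exact: muP|].
  by rewrite (teval_moment_unif d hd mu hmu) teval_mu_unif.
split.
  by move=> mk; apply: zonal0 => v; exact: zonal_ngeg_low.
split.
  move=> _; apply: EXE => [sg s|v]; first by rewrite muP tsym_permute.
  rewrite tevalD tevalZ teval_tsym teval_sum teval_mu_unif; congr (_ + _).
  rewrite zonal_ngeg_top// -[LHS]mulrA; congr (_ * _).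
  have r0 : geg_ratio d k != 0 :> R.
    by have := Cg1_neq0 (R := R) d hd k; rewrite -gkd_ratio// mulf_eq0 negb_or => /andP[].
  (* Dividing [homsum_geg_coef] by [geg_ratio] and factoring out the leading coefficient leaves
     exactly the constant that [dkd_inv] evaluates. *)
  have -> : ngeg d k (vdot d mu v) (vsq d v) = geg_coef d k 0 / geg_ratio d k *
      \sum_(j < k./2.+1) akj R d k j * (vsq d v ^+ j * vdot d mu v ^+ (k - 2 * j)).
    apply: (mulfI r0); rewrite -(homsum_geg_coef d hd k k.+1)// mulrA mulrCA divff// mulr1.
    rewrite (homsum_widen _ _ k./2.+1); [|lia|by move=> j hj; apply: geg_coef_eq0; lia].
    rewrite mulr_sumr; apply: eq_bigr => j _; rewrite geg_coef_akj//; last by have := ltn_ord j; lia.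
    by ring.
  rewrite -(dkd_inv d hd k hk) [RHS]mulrA [in RHS]mulrA; congr (_ * _); apply: eq_bigr => j _; congr (_ * _).
  have kj : (2 * j <= k)%N by have := ltn_ord j; lia.
  by rewrite -{1}(subnKC kj) teval_tkron muvE teval_tpow teval_vecI.
split.
  move=> km omk; apply: zonal0 => v; apply: zonal_ngeg_parity => //.
  by rewrite -(subnK (ltnW km)) -addnA oddD addnn odd_double addbF.
split; last by move=> omk j jm; exact: fjmk_closed.
apply: EXE => [sg s|v]; first by rewrite muP tsym_permute.
rewrite tevalD tevalZ teval_tsym teval_sum teval_mu_unif; congr (_ + _).
rewrite -[LHS]mulrA -[LHS]mulrA; congr (_ * _); rewrite /zonal !mulr_sumr; apply: eq_bigr => j _.
have mj : (2 * j <= m)%N by have := ltn_ord j; lia.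
have -> : teval d m (tkron R d (m - 2 * j) (muv (m - 2 * j)%N)
    (tpow R d 2 (fun s'' => vecI R d s'' - muv 2%N s'') j)) v =
    vdot d mu v ^+ (m - 2 * j) * (vsq d v - vdot d mu v ^+ 2) ^+ j.
  by rewrite -{1}(subnK mj) teval_tkron muvE teval_tpow tevalB teval_vecI muvE.
rewrite /ejkm; case: (boolP (odd (m + k))) => omk.
  rewrite mul0r !mulr0 marginal_parity ?mulr0//.
  by rewrite oddD oddB// mul2n odd_double addbF -oddD.
rewrite -fjmk_marginal// /theta.
by ring.
Qed.
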